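(* Let $G$ be a finite simple planar graph with maximum degree at most $3$ (a subcubic planar graph). Then $\chi'_{s,l}(G)\leq 10$.
   Context: All graphs are finite and simple. A strong edge-coloring of a graph $G$ is a map $c$ from $E(G)$ to a set of colors such that $c(e_1)\neq c(e_2)$ whenever $e_1,e_2$ are two distinct edges that are either adjacent to each other (share an endpoint) or both adjacent to a common edge of $G$. Equivalently, each color class is an induced matching. A list assignment $L=\{L(e):e\in E(G)\}$ gives each edge $e$ a set $L(e)$ of available colors. $G$ is strongly $L$-edge-colorable if it has a strong edge-coloring $c$ with $c(e)\in L(e)$ for every $e\in E(G)$. For a positive integer $k$, $G$ is strongly $k$-edge-choosable if it is strongly $L$-edge-colorable for every $L$ with $|L(e)|\ge k$ for all $e\in E(G)$. The strong list-chromatic index $\chi'_{s,l}(G)$ is the minimum positive integer $k$ for which $G$ is strongly $k$-edge-choosable. *)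

(* Defs.v *)
From Stdlib Require List.
From HB Require Import structures.
From mathcomp Require Import all_boot all_order all_algebra.
From mathcomp Require Import all_classical all_reals all_analysis.

Set Implicit Arguments.
Unset Strict Implicit.
Unset Printing Implicit Defensive.

Import numFieldNormedType.Exports.

Local Open Scope nat_scope.
Local Open Scope classical_set_scope.
Local Open Scope card_scope.

Record sgraph := SGraph {
  vertex :> finType;
  adj : rel vertex;
  adj_sym : symmetric adj;
  adj_irr : irreflexive adj }.

Arguments adj {s} : rename.

Definition degree (G : sgraph) (x : G) : nat := #|[pred y | adj x y]|.

Definition max_degree (G : sgraph) : nat := \max_(x : G) degree x.

Definition edge_set (G : sgraph) : {set {set G}} :=
  [set e : {set G} | [exists x, exists y, adj x y && (e == [set x; y])]]%SET.

Definition edge (G : sgraph) := {e : {set G} | e \in edge_set G}.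
HB.instance Definition _ (G : sgraph) := SubFinite.on (edge G).

Definition adjacent_edges (G : sgraph) (e f : edge G) : bool :=
  (e != f) && (val e :&: val f != finset.set0)%SET.

Definition strong_edge_coloring (G : sgraph) (C : Type) (c : edge G -> C) :=
  forall e f : edge G, e != f ->
    adjacent_edges e f \/
      (exists g : edge G, adjacent_edges e g /\ adjacent_edges f g) ->
    c e <> c f.

Definition strongly_list_edge_colorable (G : sgraph) (C : Type)
    (L : edge G -> set C) :=
  exists c : edge G -> C,
    strong_edge_coloring c /\ forall e, L e (c e).

(* Lists are arbitrary, possibly infinite, sets of colors, so the condition
   |L(e)| >= k is stated as an inequality of cardinals. *)
Definition strongly_edge_choosable (G : sgraph) (k : nat) :=
  forall (C : Type) (L : edge G -> set C),
    (forall e, `I_k #<= L e) -> strongly_list_edge_colorable L.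

Lemma card_le_fresh (C : Type) (A : set C) (n : nat) (t : seq C) :
  size t < n -> `I_n #<= A -> exists2 a : C, A a & ~ List.In a t.
Proof.
move=> tn /card_leP[f]; apply: contrapT => nofresh.
pose h (i : 'I_n) : C := sval (f (SigSub (mem_set (ltn_ord i : `I_n i)))).
have hA i : A (h i) by rewrite /h; case: (f _) => a /= /set_mem.
have h_inj : injective h.
  move=> i j hij; apply: val_inj.
  suff : SigSub (mem_set (ltn_ord i : `I_n i)) =
         SigSub (mem_set (ltn_ord j : `I_n j)) by move/(congr1 val).
  have finj : set_inj setT f by exact: inj.
  by apply: finj; rewrite ?in_setT //; apply: val_inj.
have hidx i : exists j : 'I_(size t), List.nth_error t j = Some (h i).
  have /(@List.In_nth_error _ t (h i))[j jt] : List.In (h i) t.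
    by apply: contrapT => hit; apply: nofresh; exists (h i).
  have jlt : j < size t.
    by apply/ssrnat.ltP/(List.nth_error_Some t j); rewrite jt.
  by exists (Ordinal jlt).
have [g gP] := choice hidx.
have g_inj : injective g.
  by move=> i j gij; apply: h_inj; have := gP i; rewrite gij gP => -[].
by have := leq_card g g_inj; rewrite !card_ord leqNgt tn.
Qed.

Lemma injective_choice (E : finType) (C : Type) (L : E -> set C) :
  (forall e, `I_(maxn 1 #|E|) #<= L e) ->
  exists2 c : E -> C, injective c & forall e, L e (c e).
Proof.
move=> Lbig.
suff [c cL cinj] : exists2 c : E -> C, (forall e, L e (c e)) &
    {in enum E &, injective c}.
  by exists c => // x y; apply: cinj; rewrite mem_enum.
have : size (enum E) <= #|E| by rewrite cardE.
elim: (enum E) (enum_uniq E) => [_ _|a s IHs /= /andP[as_ us] szs].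
  have ex e : exists x, L e x.
    have [||x Lx _] := @card_le_fresh C (L e) (maxn 1 #|E|) [::] => //.
    - by rewrite leq_max.
    - by exists x.
  by have [c cL] := choice ex; exists c.
have [c cL cinj] := IHs us (ltnW szs).
have [||x Lx xs] := @card_le_fresh C (L a) (maxn 1 #|E|) [seq c e | e <- s] => //.
  by rewrite size_map leq_max szs orbT.
have inmap e : e \in s -> c e <> x.
  move=> es cx; apply: xs; rewrite -cx {cx}.
  elim: s es {IHs as_ us szs cinj} => //= b s IHs.
  by rewrite inE => /predU1P[->|/IHs]; [left|right].
exists (fun e => if e == a then x else c e).
  by move=> e; case: eqP => [->|_].
move=> e f; rewrite !inE; case: eqP => [->|_] /=; case: eqP => [->|_] //=.
- by move=> _ fs /esym /(inmap _ fs).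
- by move=> es _ /(inmap _ es).
- exact: cinj.
Qed.

Lemma strongly_edge_choosable_exists (G : sgraph) :
  exists k, (0 < k) && `[< strongly_edge_choosable G k >].
Proof.
exists (maxn 1 #|{: edge G}|); rewrite leq_max /=; apply/asboolP => C L Lbig.
have [c cinj cL] := injective_choice Lbig.
by exists c; split=> // e f /eqP ef _ /cinj.
Qed.

Definition strong_list_chromatic_index (G : sgraph) : nat :=
  ex_minn (strongly_edge_choosable_exists G).

Section Planarity.
Variables (R : realType) (G : sgraph).
Local Open Scope ring_scope.

(* The vertex x is drawn at the point p x, and the edge e as the simple arc
   traced by gamma e on [0, 1]. Values of gamma e outside [0, 1] are
   irrelevant. *)
Record plane_drawing (p : G -> R * R) (gamma : edge G -> R -> R * R) : Prop :=
  PlaneDrawing {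
  drawing_vertex_inj : injective p;
  drawing_arc_continuous : forall e, {within `[0, 1], continuous (gamma e)};
  drawing_arc_inj : forall e, {in `[0, 1] &, injective (gamma e)};
  drawing_arc_ends : forall e, exists x y : G,
    [/\ val e = [set x; y]%SET, gamma e 0 = p x & gamma e 1 = p y];
  drawing_arc_vertex : forall e x t, t \in `]0, 1[ -> gamma e t <> p x;
  drawing_arc_arc : forall e f, e != f ->
    forall s t, s \in `]0, 1[ -> t \in `]0, 1[ -> gamma e s <> gamma f t }.

Definition planar : Prop :=
  exists (p : G -> R * R) (gamma : edge G -> R -> R * R),
    plane_drawing p gamma.

End Planarity.

(* Main.v *)
Require Import Defs.
From mathcomp Require Import all_classical all_reals all_analysis.
From mathcomp Require Import all_boot all_order all_algebra.
From mathcomp Require Import zify ring lra.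

Set Implicit Arguments.
Unset Strict Implicit.
Unset Printing Implicit Defensive.

Import Order.TTheory GRing.Theory Num.Theory.
Import numFieldNormedType.Exports.

(**
Two edges conflict when they share an endpoint or are joined by an edge, so a
strong list colouring is a list colouring for the conflict relation.  A set S
of vertices stands for the subgraph that it induces, and [colorable S] says
that its edges can be coloured from their lists of size ten.

The induction is on S.  A vertex with at most two neighbours in S can be
deleted, since each of its edges then conflicts with few others
([remove_small_vertex]); hence S may be taken cubic.  If S contains a triangle,
a square or a pentagon, delete a small set R around it, colour the rest, and
strike from the lists of the remaining edges the colours of the coloured edges
that they conflict with.  Counting those edges shows that at least 4 colours
remain for an edge that leaves R and at least 6, often 8, for an edge inside R.
Such lists are too short for distinct colours, but some of the remaining edges
do not conflict, and either two such edges share a colour, which saves one, or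
their disjoint lists are large together.  [hall_sharing] is the version of
Hall's theorem that exploits this; with it each of the three short cycles is
reducible ([reduce_triangle], [reduce_square], [reduce_pentagon]).  This gives
[short_cycles_colorable].

What remains is that a nonempty cubic planar graph has a cycle of length at
most five.  The usual proof counts faces by Euler's formula.  Here no face is
ever constructed as a region of the plane; everything is expressed by parities.
Replace the arcs of the drawing by polygonal lines.  For a set Z of edges of
even degree at every vertex and an edge e outside Z, the parity of the number
of crossings of Z with a ray from a point of e says whether e is inside or
outside Z.  As the point moves along e to an endpoint u, the parity becomes
one that depends on u and Z alone, plus a local term for e and each edge of Z
at u; these local terms obey a symmetry rule that records the cyclic order
around u ([planar_parity]).  A face has an inside or outside position with
respect to every even set Z, so it is a linear functional on the cycle space
over the field with two elements; the two faces along e are two functionals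
whose difference is the functional that tells whether e belongs to Z.  This is
taken as the definition of faces.  The local rule at a cubic vertex shows that the
edges along a face form an even set ([face_border_even]).  The differences of
faces span the dual of the cycle space, so there are more faces than its
dimension, which is at least m - n + 1 for m edges and n vertices.  As each
edge borders at most two faces and 2 m = 3 n, some face has at most five edges
along it ([short_even_set]).  A nonempty even edge set contains a cycle with no
more vertices than the set has edges ([even_edge_set_cycle]), which is the
short cycle needed.
*)

(** * Hall's theorem and list colourings in which pairs share a colour *)

(** Arithmetic about cardinals only: the sets are forgotten first, since the search
is slow when they and a long list of hypotheses are kept. *)
Ltac card_lia :=
  repeat match goal with |- context [card ?X] => move: (card X) => ? end;
  clear; lia.

Section SystemsOfRepresentatives.
Variables (I K : finType).
Implicit Types (X Y A : {set I}) (L : I -> {set K}).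

Definition colors L X : {set K} := \bigcup_(i in X) L i.

Lemma colorsU L X Y : colors L (X :|: Y) = colors L X :|: colors L Y.
Proof. exact: bigcup_setU. Qed.

Lemma colors1 L i : colors L [set i] = L i.
Proof. exact: big_set1. Qed.

Lemma colors_sub L i X : i \in X -> L i \subset colors L X.
Proof. by move=> iX; apply: bigcup_sup. Qed.

Lemma colorsD L X (C : {set K}) :
  colors (fun i => L i :\: C) X = colors L X :\: C.
Proof.
apply/setP=> c; rewrite inE; apply/bigcupP/andP => [[i iX]|[cC /bigcupP[i iX ci]]].
  by rewrite inE => /andP[-> ci]; split=> //; apply/bigcupP; exists i.
by exists i => //; rewrite inE cC.
Qed.

(** The induction splits A along a nonempty proper subset X whose lists contain only
#|X| colours, if there is one: X is served from these colours, and the rest of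
A still satisfies the condition without them.  If there is no such X, any
choice for one element keeps the condition. *)
Theorem hall (k0 : K) L A :
  (forall X, X \subset A -> #|X| <= #|colors L X|) ->
  exists2 f : I -> K, {in A &, injective f} & {in A, forall i, f i \in L i}.
Proof.
have [n] := ubnP #|A|; elim: n => // n IHn in L A *; rewrite ltnS => leAn hallA.
have [->|[a aA]] := set_0Vmem A.
  by exists (fun=> k0) => i; rewrite inE.
have [/existsP[X /and4P[X0 XA XnA]]|/existsPn slack] :=
  boolP [exists X : {set I},
    [&& X != set0, X \subset A, X != A & #|colors L X| <= #|X|]].
  move=> tightX.
  have ltXA : #|X| < #|A| by apply: proper_card; rewrite properEneq XnA.
  have [||f finj fL] := IHn L X.
  - exact: leq_trans ltXA leAn.
  - by move=> Y YX; apply: hallA; apply: subset_trans XA.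
  have [||g ginj gL] := IHn (fun i => L i :\: colors L X) (A :\: X).
  - have := cardsID X A; rewrite (setIidPr XA).
    have : 0 < #|X| by rewrite card_gt0.
    lia.
  - move=> Y /subsetDP[YA dYX]; rewrite colorsD.
    have := hallA (Y :|: X); rewrite subUset YA XA => /(_ isT).
    rewrite colorsU cardsU (_ : Y :&: X = set0) ?cards0; last by apply/eqP; rewrite setI_eq0.
    have := cardsID (colors L X) (colors L Y :|: colors L X).
    rewrite setDUl setDv setU0 (setIidPr (subsetUr _ _)); lia.
  exists (fun i => if i \in X then f i else g i).
    move=> i j iA jA; case: ifP => iX; case: ifP => jX; first exact: finj.
    - move=> fg; have := gL j; rewrite !inE jX jA => /(_ isT) /andP[/negP[]].
      by rewrite -fg; apply: (subsetP (colors_sub L iX)); apply: fL.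
    - move=> fg; have := gL i; rewrite !inE iX iA => /(_ isT) /andP[/negP[]].
      by rewrite fg; apply: (subsetP (colors_sub L jX)); apply: fL.
    - by apply: ginj; rewrite inE ?iX ?jX.
  move=> i iA; case: ifP => iX; first exact: fL.
  by have := gL i; rewrite !inE iX iA => /(_ isT) /andP[].
have /set0Pn[c cL] : L a != set0.
  rewrite -card_gt0 -colors1; apply: leq_trans (hallA _ _); first by rewrite cards1.
  by rewrite sub1set.
have [||g ginj gL] := IHn (fun i => L i :\ c) (A :\ a).
- by rewrite (cardsD1 a) aA in leAn.
- move=> X /subsetD1P[XA aX].
  have [->|X0] := eqVneq X set0; first by rewrite cards0.
  have := slack X; rewrite X0 XA /= (contraNneq _ aX); last by move->.
  rewrite -ltnNge colorsD; have := cardsD1 c (colors L X).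
  case: (c \in _) => /=; lia.
exists (fun i => if i == a then c else g i).
  move=> i j iA jA; case: eqP => [->|/eqP ia]; case: eqP => [->|/eqP ja] //.
  - move=> cg; have := gL j; rewrite !inE ja jA => /(_ isT).
    by rewrite -cg eqxx.
  - move=> cg; have := gL i; rewrite !inE ia iA => /(_ isT).
    by rewrite cg eqxx.
  - by apply: ginj; rewrite !inE ?ia ?ja.
move=> i iA; case: eqP => [->//|/eqP ia].
by have := gL i; rewrite !inE ia iA => /(_ isT) /andP[].
Qed.

End SystemsOfRepresentatives.

Section SharedRepresentatives.
Variables (I K : finType) (h : rel I) (mate : I -> I).
Hypothesis h_sym : symmetric h.
Implicit Types (X A B : {set I}) (L : I -> {set K}).

Definition list_colorable L A := exists2 f : I -> K,
  {in A, forall i, f i \in L i} &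
  {in A &, forall i j, i != j -> h i j -> f i != f j}.

Lemma list_colorable_shared L A i j c :
    i \in A -> j \in A -> ~~ h i j -> c \in L i -> c \in L j ->
  list_colorable (fun k => L k :\ c) (A :\ i :\ j) -> list_colorable L A.
Proof.
move=> iA jA hij ci cj [f fL fh].
pose ij k := (k == i) || (k == j).
have A'P k : k \in A -> ij k = false -> k \in A :\ i :\ j.
  by rewrite !inE /ij => -> /norP[-> ->].
have fc k : k \in A -> ij k = false -> f k != c.
  by move=> kA kij; have := fL k (A'P k kA kij); rewrite !inE => /andP[].
exists (fun k => if ij k then c else f k).
  move=> k kA; case: ifP => [/orP[]/eqP -> //|kij].
  by have := fL k (A'P k kA kij); rewrite !inE => /andP[].
move=> k l kA lA kl hkl; case: ifP => kij; case: ifP => lij.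
- move: kl hkl; case/orP: kij => /eqP ->; case/orP: lij => /eqP ->; rewrite ?eqxx // => _.
    by rewrite (negPf hij).
  by rewrite h_sym (negPf hij).
- by rewrite eq_sym fc.
- exact: fc.
- by apply: fh; rewrite ?A'P.
Qed.

(** A pair consists of an element i of B and of [mate i]; the pairs are disjoint in
all uses. *)
Definition missed B X := [set i in B | (i \notin X) && (mate i \notin X)].

Definition pair_free B X := [forall i in B, ~~ ((i \in X) && (mate i \in X))].

(** If a pair missing X spends a common colour that X sees as well, then X loses that
colour without losing an element. *)
Definition threats L B X :=
  [set i in missed B X | L i :&: L (mate i) :&: colors L X != set0].

(** Each pair contributes one element to B, and leaves at least one element of A
outside both X and the missed part of B: a pair that meets X does so only once,
and a missed pair has its mate left over. *)
Lemma pair_free_bound A B X :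
    B \subset A -> mate @: B \subset A -> {in B &, injective mate} ->
    [disjoint mate @: B & B] -> X \subset A -> pair_free B X ->
  #|X| + #|missed B X| + #|B| <= #|A|.
Proof.
move=> BA mBA minj dB XA /forall_inP pfX.
(* The element of the pair of i that is neither in X nor counted as missed. *)
pose g i := if i \in X then mate i else if mate i \in X then i else mate i.
have mB i j : i \in B -> j \in B -> mate i != j.
  move=> iB jB; apply: contraTneq jB => <-.
  by rewrite (disjointFr dB) // imset_f.
have ginj : {in B &, injective g}.
  move=> i j iB jB; rewrite /g.
  do 4?case: ifP => ?; move=> E //; try exact: minj.
  - by have := mB _ _ iB jB; rewrite E eqxx.
  - by have := mB _ _ jB iB; rewrite -E eqxx.
  - by have := mB _ _ jB iB; rewrite -E eqxx.
  - by have := mB _ _ iB jB; rewrite E eqxx.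
have XM : [disjoint X & missed B X].
  rewrite -setI_eq0; apply/eqP/setP=> i; rewrite !inE.
  by case: (i \in X); rewrite ?andbF.
have gout : [disjoint g @: B & X :|: missed B X].
  rewrite disjoint_subset; apply/subsetP=> _ /imsetP[i iB ->].
  rewrite !inE /g; have := pfX i iB.
  case: ifP => [iX /= /negPf ->|iX _]; last first.
    case: ifP => [miX|/negbT miX]; first by rewrite iX miX /= !andbF.
    by rewrite (negPf miX) /= (disjointFr dB) // imset_f.
  by rewrite /= (disjointFr dB) // imset_f.
rewrite -(card_in_imset ginj).
move: XM gout; rewrite -!leq_card_setU => /eqP XM /eqP gout.
rewrite -XM addnC -gout; apply: subset_leq_card.
rewrite !subUset XA (_ : missed B X \subset A) ?andbT; last first.
  by apply: subset_trans BA; apply/subsetP=> i; rewrite inE => /andP[].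
apply/subsetP=> _ /imsetP[i iB ->]; rewrite /g.
have iA := subsetP BA i iB; have miA : mate i \in A by apply: (subsetP mBA); rewrite imset_f.
by do 2?case: ifP.
Qed.

(** A pair with a common colour is given that colour on both of its elements, and
the colour is struck from all other lists.  A set X not meeting the pair loses
at most this one colour, and if it does, the pair was one of its threats, so
the inequality survives.  A pair also leaves A with two elements fewer and
shortens the two lists of another pair by two together.  When no pair has a
common colour, a set containing a pair sees at least #|A| colours, and Hall's
theorem gives distinct colours. *)
Theorem hall_sharing (k0 : K) L A B :
    B \subset A -> mate @: B \subset A -> {in B &, injective mate} ->
    [disjoint mate @: B & B] -> {in B, forall i, ~~ h i (mate i)} ->
    {in B, forall i, #|A| <= #|L i| + #|L (mate i)|} ->
    (forall X, X != set0 -> X \subset A -> pair_free B X ->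
      #|X| + #|threats L B X| <= #|colors L X|) ->
  list_colorable L A.
Proof.
have [n] := ubnP #|B|; elim: n => // n IHn in L A B *.
rewrite ltnS => leBn BA mBA minj dB hB bigL hX.
have [/exists_inP[b bB] /set0Pn[c /setIP[cb cmb]]|/exists_inPn disj] :=
  boolP [exists i in B, L i :&: L (mate i) != set0]; last first.
  have [X XA|f finj fL] := @hall I K k0 L A.
    have [->|X0] := eqVneq X set0; first by rewrite cards0.
    have [pfX|] := boolP (pair_free B X).
      by apply: leq_trans (hX X X0 XA pfX); apply: leq_addr.
    rewrite negb_forall_in => /exists_inP[i iB]; rewrite negbK => /andP[iX miX].
    apply: leq_trans (subset_leq_card XA) _; apply: leq_trans (bigL i iB) _.
    have := disj i iB; rewrite negbK setI_eq0 -leq_card_setU => /eqP <-.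
    by apply: subset_leq_card; rewrite subUset !colors_sub.
  by exists f => // i j iA jA + _; apply: contra => /eqP /finj ->.
have bA := subsetP BA b bB.
have mbA : mate b \in A by apply: (subsetP mBA); rewrite imset_f.
have mBN i j : i \in B -> j \in B -> (mate i == j) = false.
  by move=> iB jB; apply: contraTF jB => /eqP <-; rewrite (disjointFr dB) // imset_f.
have minjb i j : i \in B -> j \in B -> (mate i == mate j) = (i == j).
  by move=> iB jB; apply/eqP/eqP => [/minj->|->].
pose L' i := L i :\ c; pose A' := A :\ b :\ mate b; pose B' := B :\ b.
have cardA' : #|A| = #|A'|.+2.
  rewrite (cardsD1 b) bA (cardsD1 (mate b) (A :\ b)).
  by rewrite !inE mbA mBN.
have B'B i : i \in B' -> (i \in B) * (i != b).
  by rewrite !inE => /andP[-> ->].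
have B'P i : i \in B' -> (i \in A') /\ (mate i \in A').
  move=> /B'B [iB ib]; rewrite !inE eq_sym mBN // ib minjb // ib mBN // (subsetP BA) //.
  by split => //=; apply: (subsetP mBA); rewrite imset_f.
apply: (list_colorable_shared bA mbA (hB b bB) cb cmb); apply: (IHn L' A' B').
- by move: leBn; rewrite (cardsD1 b) bB.
- by apply/subsetP=> i /B'P[].
- by apply/subsetP=> _ /imsetP[i /B'P[_ ? ->]].
- by move=> i j /B'B[iB _] /B'B[jB _]; apply: minj.
- rewrite disjoint_subset; apply/subsetP=> _ /imsetP[i /B'B[iB _] ->].
  by rewrite !inE negb_and (disjointFr dB) ?orbT // imset_f.
- by move=> i /B'B[iB _]; apply: hB.
- move=> i /B'B[iB _]; have := bigL i iB; rewrite cardA' /L'.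
  have := cardsD1 c (L i); have := cardsD1 c (L (mate i)).
  case: (c \in _); case: (c \in _) => /=; card_lia.
- move=> X X0 XA' pfX.
  have XA : X \subset A by apply/subsetP=> i /(subsetP XA'); rewrite !inE => /and3P[].
  have bX : b \notin X by apply: contraTN XA' => bX; apply/subsetPn; exists b; rewrite ?inE ?eqxx ?andbF.
  have mbX : mate b \notin X by apply: contraTN XA' => bX'; apply/subsetPn; exists (mate b); rewrite ?inE ?eqxx.
  have pfX' : pair_free B X.
    apply/forall_inP=> i iB; have [->|ib] := eqVneq i b; first by rewrite (negPf bX).
    by apply: (forall_inP pfX); rewrite !inE ib.
  have := hX X X0 XA pfX'; rewrite colorsD.
  have sub : threats L' B' X \subset threats L B X :\ b.
    apply/subsetP=> i; rewrite !inE -!andbA colorsD => /and5P[-> -> -> ->] /= /set0Pn[d].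
    rewrite !inE => /andP[/andP[/andP[_ d1] /andP[_ d2]] /andP[_ d3]].
    by apply/set0Pn; exists d; rewrite !inE d1 d2.
  have := subset_leq_card sub; have := cardsD1 c (colors L X).
  have := cardsD1 b (threats L B X).
  have -> : (b \in threats L B X) = (L b :&: L (mate b) :&: colors L X != set0).
    by rewrite !inE bB bX mbX.
  have [cX|_] := boolP (c \in colors L X); last by case: (_ != _) => /=; card_lia.
  have -> : L b :&: L (mate b) :&: colors L X != set0.
    by apply/set0Pn; exists c; rewrite !inE cb cmb cX.
  by rewrite /=; card_lia.
Qed.

End SharedRepresentatives.

(** * The list colourings left by short cycles *)

Section ReducibleLists.
Variables (K : finType) (k0 : K).

Lemma list_colorable_hall (I : finType) (h : rel I) (L : I -> {set K}) (A : {set I}) :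
    (forall X : {set I}, X \subset A -> X != set0 -> #|X| <= #|colors L X|) ->
  list_colorable h L A.
Proof.
move=> H; have [X XA|f finj fL] := @hall I K k0 L A.
  by have [->|X0] := eqVneq X set0; [rewrite cards0|apply: H].
by exists f => // i j iA jA + _; apply: contra => /eqP /finj ->.
Qed.

Lemma missed_bound (I : finType) (mate : I -> I) (B C X : {set I}) :
  B \subset C -> X \subset C -> #|X| + #|missed mate B X| <= #|C|.
Proof.
move=> BC XC; have XM : [disjoint X & missed mate B X].
  rewrite -setI_eq0; apply/eqP/setP=> i; rewrite !inE.
  by case: (i \in X); rewrite ?andbF.
move: XM; rewrite -leq_card_setU => /eqP <-; apply: subset_leq_card.
rewrite subUset XC; apply: subset_trans BC.
by apply/subsetP=> i; rewrite inE => /andP[].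
Qed.

Lemma threats_missed (I : finType) (mate : I -> I) (L : I -> {set K}) (B X : {set I}) :
  #|threats mate L B X| <= #|missed mate B X|.
Proof. by apply/subset_leq_card/subsetP=> i; rewrite inE => /andP[]. Qed.

Lemma sum_dichotomy (I1 I2 : finType) (X : {set (I1 + I2)}) :
  (exists i, inr i \in X) \/ X \subset [set inl i | i : I1].
Proof.
have [/existsP[i iX]|/existsPn H] := boolP [exists i, inr i \in X].
  by left; exists i.
right; apply/subsetP=> -[i iX|i iX]; first by rewrite imset_f.
by have := H i; rewrite iX.
Qed.

Lemma card_inl (I1 I2 : finType) : #|[set inl i | i : I1] : {set (I1 + I2)}| = #|I1|.
Proof. by rewrite card_imset // => i j []. Qed.

(** In these three lemmas [inl i] is the edge leaving the cycle at its vertex i, and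
[inr i] is the edge of the cycle from vertex i to vertex i + 1.  Six edges
with lists of sizes 4 and 6 form no obstacle to Hall's condition. *)
Lemma triangle_lists (h : rel ('I_3 + 'I_3)) (L : 'I_3 + 'I_3 -> {set K}) :
    (forall i, 4 <= #|L (inl i)|) -> (forall i, 6 <= #|L (inr i)|) ->
  list_colorable h L setT.
Proof.
move=> Lf Le; apply: list_colorable_hall => X _ X0.
have [[i iX]|Xf] := sum_dichotomy X.
  apply: leq_trans (subset_leq_card (colors_sub L iX)); apply: leq_trans (Le i).
  by rewrite (leq_trans (max_card _)) // card_sum !card_ord.
have /set0Pn[[i|i] iX] := X0; last by have /imsetP[] := subsetP Xf _ iX.
apply: leq_trans (subset_leq_card (colors_sub L iX)); apply: leq_trans (Lf i).
by rewrite (leq_trans (subset_leq_card Xf)) // card_inl card_ord.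
Qed.

(** Opposite leaving edges do not conflict, so they are paired: a set containing no
pair has at most two leaving edges. *)
Lemma square_lists (h : rel ('I_4 + 'I_4)) (L : 'I_4 + 'I_4 -> {set K}) :
    symmetric h -> (forall i : 'I_4, ~~ h (inl i) (inl (i + 2)%R)) ->
    (forall i, 4 <= #|L (inl i)|) -> (forall i, 6 <= #|L (inr i)|) ->
  list_colorable h L setT.
Proof.
move=> h_sym hf Lf Le.
pose mate (x : 'I_4 + 'I_4) := if x is inl i then inl (i + 2)%R else x.
pose B : {set ('I_4 + 'I_4)} := [set inl 0%R; inl 1%R].
have mate_inj : {in B &, injective mate}.
  move=> x y; rewrite !inE => /orP[]/eqP -> /orP[]/eqP -> //=.
have mB : mate @: B \subset [set inl i | i : 'I_4].
  by apply/subsetP=> _ /imsetP[x + ->]; rewrite !inE => /orP[]/eqP -> /=; rewrite imset_f.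
have Bl : B \subset [set inl i | i : 'I_4].
  by apply/subsetP=> x; rewrite !inE => /orP[]/eqP ->; rewrite imset_f.
have dB : [disjoint mate @: B & B].
  rewrite disjoint_subset; apply/subsetP=> _ /imsetP[x + ->].
  by rewrite !inE => /orP[]/eqP ->.
have cB : #|B| = 2 by rewrite cards2.
apply: (hall_sharing h_sym k0 (B := B) (mate := mate)) => //.
- by move=> x; rewrite !inE => /orP[]/eqP ->; apply: hf.
- move=> x; rewrite !inE cardsT card_sum !card_ord.
  by move=> /orP[]/eqP -> /=; apply: (leq_add (Lf _) (Lf _)).
move=> X X0 _ pfX; apply: leq_trans (leq_add (leqnn _) (threats_missed _ _ _ _)) _.
have [[i iX]|Xf] := sum_dichotomy X.
  apply: leq_trans (subset_leq_card (colors_sub L iX)); apply: leq_trans (Le i).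
  have := pair_free_bound (subsetT _) (subsetT _) mate_inj dB (subsetT X) pfX.
  rewrite cardsT card_sum !card_ord cB; card_lia.
have /set0Pn[[i|i] iX] := X0; last by have /imsetP[] := subsetP Xf _ iX.
apply: leq_trans (subset_leq_card (colors_sub L iX)); apply: leq_trans (Lf i).
have := pair_free_bound Bl mB mate_inj dB Xf pfX.
rewrite card_inl card_ord cB; card_lia.
Qed.

(** A leaving edge does not conflict with the opposite edge of the pentagon, so these
are paired.  If two nonconflicting leaving edges have a common colour, using it
on both leaves eight edges, for which three pairs suffice.  Otherwise all five
pairs are used, and the delicate case is a set X of leaving edges seeing only
four colours: a leaving edge at distance two then has a list disjoint from
these, so X and the pairs threatening X lie among three consecutive edges. *)
Lemma pentagon_lists (h : rel ('I_5 + 'I_5)) (L : 'I_5 + 'I_5 -> {set K}) :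
    symmetric h -> (forall i : 'I_5, ~~ h (inl i) (inr (i + 2)%R)) ->
    (forall i, 4 <= #|L (inl i)|) ->
    (forall i j : 'I_5, j = (i + 2)%R \/ i = (j + 2)%R -> h (inl i) (inl j) -> 5 <= #|L (inl i)|) ->
    (forall i, 6 <= #|L (inr i)|) ->
  list_colorable h L setT.
Proof.
move=> h_sym hfe Lf Lf5 Le.
pose mate (x : 'I_5 + 'I_5) : 'I_5 + 'I_5 := if x is inl i then inr (i + 2)%R else x.
pose spokes (D : {set 'I_5}) : {set ('I_5 + 'I_5)} := [set inl i | i in D].
have cspokes D : #|spokes D| = #|D| by rewrite card_imset // => i j [].
have mate_inj D : {in spokes D &, injective mate}.
  move=> _ _ /imsetP[i _ ->] /imsetP[j _ ->] E.
  have ij := inr_inj E; by rewrite (addIr _ ij).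
have dB D : [disjoint mate @: spokes D & spokes D].
  rewrite disjoint_subset; apply/subsetP=> _ /imsetP[_ /imsetP[i _ ->] ->].
  by rewrite inE; apply/imsetP=> -[].
have hB D : {in spokes D, forall x, ~~ h x (mate x)} by move=> _ /imsetP[i _ ->].
have [/existsP[i /andP[hi /set0Pn[c /setIP[ci cj]]]]|/existsPn disj] :=
  boolP [exists i : 'I_5, ~~ h (inl i) (inl (i + 2)%R)
    && (L (inl i) :&: L (inl (i + 2)%R) != set0)].
  apply: (list_colorable_shared h_sym _ _ hi ci cj) => //.
  set A := _ :\ _; set L' := fun k => _.
  have i2 : (i + 2)%R != i by case: (i) => -[|[|[|[|[|]]]]].
  pose D := ~: [set i; (i + 2)%R].
  have cD : #|D| = 3 by have := cardsC [set i; (i + 2)%R]; rewrite cards2 eq_sym i2 card_ord => -[].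
  have cA : #|A| = 8.
    have := cardsT ('I_5 + 'I_5)%type; rewrite card_sum !card_ord.
    have := cardsD1 (inl i) [set: 'I_5 + 'I_5]; rewrite inE => ->.
    have := cardsD1 (inl (i + 2)%R) ([set: 'I_5 + 'I_5] :\ inl i).
    by rewrite !inE (inj_eq inl_inj) i2 => -> [].
  have L'P x n : n.+1 <= #|L x| -> n <= #|L' x|.
    by rewrite /L' (cardsD1 c (L x)); case: (c \in L x); card_lia.
  have DA : spokes D \subset A.
    by apply/subsetP=> _ /imsetP[k kD ->]; move: kD; rewrite !inE !(inj_eq inl_inj) negb_or andbT andbC.
  have mA : mate @: spokes D \subset A.
    by apply/subsetP=> _ /imsetP[_ /imsetP[k kD ->] ->]; rewrite !inE.
  apply: (hall_sharing h_sym k0 DA mA (@mate_inj D) (dB D) (hB D)).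
    move=> _ /imsetP[k _ ->]; rewrite cA.
    exact: (leq_add (L'P (inl k) 3 (Lf k)) (L'P (inr _) 5 (Le _))).
  move=> X X0 XA pfX; apply: leq_trans (leq_add (leqnn _) (threats_missed _ _ _ _)) _.
  have [[k kX]|Xf] := sum_dichotomy X.
    apply: leq_trans (subset_leq_card (colors_sub L' kX)); apply: leq_trans (L'P _ 5 (Le k)).
    have := pair_free_bound DA mA (@mate_inj D) (dB D) XA pfX.
    by rewrite cA cspokes cD; card_lia.
  have XD : X \subset spokes D.
    apply/subsetP=> x xX; have /imsetP[k _ xk] := subsetP Xf x xX.
    have := subsetP XA x xX; rewrite xk !inE !(inj_eq inl_inj) => /and3P[k2 k1 _].
    by rewrite imset_f // !inE negb_or k1.
  have /set0Pn[x xX] := X0; have /imsetP[k _ xk] := subsetP XD x xX.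
  apply: leq_trans (subset_leq_card (colors_sub L' xX)).
  apply: (@leq_trans #|spokes D|); first exact: missed_bound.
  by rewrite cspokes cD xk L'P.
(* No common colour for nonconflicting leaving edges: the lists are disjoint. *)
have far_disj i j : j = (i + 2)%R \/ i = (j + 2)%R -> 5 <= #|L (inl i)| \/ [disjoint L (inl i) & L (inl j)].
  move=> ij; have [hij|hij] := boolP (h (inl i) (inl j)); first by left; apply: Lf5 ij hij.
  right; rewrite -setI_eq0; case: ij => E.
    by have := disj i; rewrite -E hij /= negbK.
  by have := disj j; rewrite -E h_sym hij /= negbK setIC.
apply: (hall_sharing h_sym k0 (B := spokes setT) (mate := mate)) => //.
  move=> _ /imsetP[k _ ->]; rewrite cardsT card_sum !card_ord.
  exact: (leq_add (Lf k) (leq_trans _ (Le _))).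
move=> X X0 _ pfX; rewrite -/(spokes setT).
have [[k kX]|Xf] := sum_dichotomy X.
  apply: leq_trans (leq_add (leqnn _) (threats_missed _ _ _ _)) _.
  apply: leq_trans (subset_leq_card (colors_sub L kX)); apply: leq_trans (Le k).
  have := pair_free_bound (subsetT _) (subsetT _) (@mate_inj setT) (dB setT) (subsetT X) pfX.
  by rewrite cardsT card_sum !card_ord cspokes cardsT card_ord; card_lia.
have XS : X \subset spokes setT.
  by apply: subset_trans Xf _; apply/subsetP=> _ /imsetP[k _ ->]; rewrite imset_f.
have [big|small] := leqP 5 #|colors L X|.
  apply: leq_trans (leq_add (leqnn _) (threats_missed _ _ _ _)) _.
  apply: leq_trans (@missed_bound _ mate _ _ X (subxx (spokes setT)) XS) _.
  by rewrite cspokes cardsT card_ord.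
have eqL i : inl i \in X -> L (inl i) = colors L X.
  by move=> iX; apply/eqP; rewrite eqEcard colors_sub //= (leq_trans _ (Lf i)).
have /set0Pn[x xX] := X0; have /imsetP[i _ xi] := subsetP XS x xX; rewrite xi {x xi} in xX.
have i4 : #|colors L X| = 4.
  by apply/eqP; rewrite eqn_leq -ltnS small -(eqL i xX) Lf.
have far j : j = (i + 2)%R \/ i = (j + 2)%R -> [disjoint colors L X & L (inl j)].
  by move=> ij; have := far_disj i j ij; rewrite (eqL i xX) i4 => -[].
pose near := [set inl i; inl (i + 1)%R; inl (i - 1)%R] : {set ('I_5 + 'I_5)}.
have nearP j : j = (i + 2)%R \/ i = (j + 2)%R \/ inl j \in near.
  rewrite !inE !(inj_eq inl_inj); move: i j {xX far near} => i j.
  case: i => -[|[|[|[|[|//]]]]] ?; case: j => -[|[|[|[|[|//]]]]] ?;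
    by [left; apply: val_inj | right; left; apply: val_inj | right; right].
have Xn : X \subset near.
  apply/subsetP=> x xX'; have /imsetP[j _ xj] := subsetP XS x xX'; rewrite xj in xX' *.
  have Lj : ~ [disjoint colors L X & L (inl j)].
    by rewrite (eqL j xX') -setI_eq0 setIid => /eqP L0; have := Lf j; rewrite (eqL j xX') L0 cards0.
  by case: (nearP j) => [|[|//]] ij; case: Lj; apply: far; [left|right].
have Tn : threats mate L (spokes setT) X \subset near.
  apply/subsetP=> x; rewrite !inE -!andbA => /and4P[/imsetP[j _ ->] _ _ thr].
  have Lj : ~ [disjoint colors L X & L (inl j)].
    rewrite disjoint_sym => dj; case/set0Pn: thr => c; rewrite !inE => /andP[/andP[cj _] cX].
    by have := disjointFr dj cj; rewrite cX.
  have : inl j \in near by case: (nearP j) => [|[|//]] ij; case: Lj; apply: far; [left|right].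
  by rewrite !inE.
have XT : [disjoint X & threats mate L (spokes setT) X].
  rewrite -setI_eq0; apply/eqP/setP=> y; rewrite !inE.
  by case: (y \in X); rewrite ?andbF.
move: XT; rewrite -leq_card_setU => /eqP <-.
apply: leq_trans (_ : #|near| <= _); first by rewrite subset_leq_card // subUset Xn.
by rewrite i4; apply: leq_trans (leq_card_setU _ _) _; rewrite cards1 cards2; case: (_ != _).
Qed.

End ReducibleLists.

Section BranchLists.
Variables (K : finType) (k0 : K) (H Bg : finType).
Hypothesis card_Bg : #|Bg| = 6.
Notation item := ('I_3 + (H + Bg))%type.
Variables (h : rel item) (L : item -> {set K}).

Let tips (D : {set 'I_3}) : {set item} := [set inl t | t in D].

Let card_tips D : #|tips D| = #|D|.
Proof. by rewrite card_imset // => i j []. Qed.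

(** The tips are three edges leaving the removed part, H indexes further leaving
edges and Bg six inner ones.  Each edge of H is paired with an inner edge that
it does not conflict with.  Either two tips share a colour and the rest is
smaller, or the tips together see nine colours, as many as Hall's condition can
ask for, a set without pairs having at most nine elements. *)
Lemma branch_lists (beta : H -> Bg) :
    symmetric h -> #|H| <= 2 -> injective beta ->
    (forall k, ~~ h (inr (inl k)) (inr (inr (beta k)))) ->
    (forall t, 4 <= #|L (inl t)|) -> (forall k, 4 <= #|L (inr (inl k))|) ->
    (forall b, 8 <= #|L (inr (inr b))|) ->
    ((forall s t, s != t -> ~~ h (inl s) (inl t) -> [disjoint L (inl s) & L (inl t)]) ->
      9 <= #|colors L (tips setT)|) ->
  list_colorable h L setT.
Proof.
move=> h_sym cH beta_inj hbeta Lt Lh Lb L9.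
have card_item : #|[set: item]| = 9 + #|H| by rewrite cardsT !card_sum card_ord card_Bg addnCA addnC.
pose mate (x : item) : item := if x is inr (inl k) then inr (inr (beta k)) else x.
pose B : {set item} := [set inr (inl k) | k : H].
have cB : #|B| = #|H| by rewrite card_imset // => i j [].
have mate_inj : {in B &, injective mate}.
  move=> _ _ /imsetP[i _ ->] /imsetP[j _ ->] E.
  by rewrite (beta_inj _ _ (inr_inj (inr_inj E))).
have dB : [disjoint mate @: B & B].
  rewrite disjoint_subset; apply/subsetP=> _ /imsetP[_ /imsetP[i _ ->] ->].
  by rewrite inE; apply/imsetP=> -[].
have hB : {in B, forall x, ~~ h x (mate x)} by move=> _ /imsetP[i _ ->].
have kinds (X : {set item}) (D : {set 'I_3}) : X \subset tips D :|: ~: tips setT ->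
    (exists b, inr (inr b) \in X) \/ X \subset tips D :|: B.
  move=> XD; have [/existsP[b bX]|/existsPn nb] := boolP [exists b, inr (inr b) \in X].
    by left; exists b.
  right; apply/subsetP=> -[t|[k|b]] xX; last by have := nb b; rewrite xX.
    have := subsetP XD _ xX; rewrite !inE.
    by rewrite [inl t \in tips setT]imset_f // orbF => ->.
  by rewrite inE [_ \in B]imset_f // orbT.
have [/existsP[s /existsP[t /and3P[st hst /set0Pn[c /setIP[cs ct]]]]]|/existsPn nshare] :=
  boolP [exists s, exists t, [&& s != t, ~~ h (inl s) (inl t) & L (inl s) :&: L (inl t) != set0]].
  apply: (list_colorable_shared h_sym _ _ hst cs ct) => //.
  set A := _ :\ _; set L' := fun k => _.
  have cA : #|A| = 7 + #|H|.
    move: card_item; have := cardsD1 (inl s) [set: item]; rewrite inE => ->.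
    have := cardsD1 (inl t) ([set: item] :\ inl s).
    by rewrite !inE (inj_eq inl_inj) eq_sym st => -> [].
  have L'P x n : n.+1 <= #|L x| -> n <= #|L' x|.
    by rewrite /L' (cardsD1 c (L x)); case: (c \in L x); card_lia.
  have BA : B \subset A by apply/subsetP=> _ /imsetP[k _ ->]; rewrite !inE.
  have mA : mate @: B \subset A.
    by apply/subsetP=> _ /imsetP[_ /imsetP[k _ ->] ->]; rewrite !inE.
  apply: (hall_sharing h_sym k0 BA mA mate_inj dB hB).
    move=> _ /imsetP[k _ ->]; rewrite cA.
    apply: leq_trans (leq_add (L'P (inr (inl k)) 3 (Lh k)) (L'P (inr _) 7 (Lb _))).
    by rewrite -ltnS !addSn !ltnS; apply: leq_trans cH _.
  move=> X X0 XA pfX; apply: leq_trans (leq_add (leqnn _) (threats_missed _ _ _ _)) _.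
  pose D := ~: [set s; t].
  have cD : #|D| = 1 by have := cardsC [set s; t]; rewrite cards2 st card_ord => -[].
  have [|[b bX]|XD] := kinds X D.
  - apply/subsetP=> -[u|x] xX; rewrite inE.
      have := subsetP XA _ xX; rewrite !inE !(inj_eq inl_inj) andbT => ust.
      by rewrite [_ \in tips D]imset_f // !inE negb_or andbC.
    by rewrite orbC inE; apply/orP; left; apply/imsetP=> -[].
  - apply: leq_trans (subset_leq_card (colors_sub L' bX)); apply: leq_trans (L'P _ 7 (Lb b)).
    have := pair_free_bound BA mA mate_inj dB XA pfX; rewrite cA cB; card_lia.
  apply: (@leq_trans #|tips D :|: B|); first exact: missed_bound (subsetUr _ _) XD.
  apply: (@leq_trans 3).
    by apply: leq_trans (leq_card_setU _ _) _; rewrite card_tips cD cB add1n ltnS.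
  have /set0Pn[[u|[k|b]] xX] := X0.
  - exact: leq_trans (L'P _ 3 (Lt u)) (subset_leq_card (colors_sub L' xX)).
  - exact: leq_trans (L'P _ 3 (Lh k)) (subset_leq_card (colors_sub L' xX)).
  - by apply: leq_trans (subset_leq_card (colors_sub L' xX)); apply/L'P/(leq_trans _ (Lb b)).
have {nshare}L9 : 9 <= #|colors L (tips setT)|.
  apply: L9 => s t st hst; rewrite -setI_eq0.
  by have := nshare s; rewrite negb_exists => /forallP/(_ t); rewrite st hst /= negbK.
apply: (hall_sharing h_sym k0 (subsetT B) (subsetT _) mate_inj dB hB).
  move=> _ /imsetP[k _ ->]; rewrite card_item.
  apply: leq_trans (leq_add (Lh k) (Lb _)); rewrite -[4 + 8]/(9 + 3).
  by rewrite leq_add2l (leq_trans cH).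
move=> X X0 _ pfX; apply: leq_trans (leq_add (leqnn _) (threats_missed _ _ _ _)) _.
have [TX|] := boolP (tips setT \subset X).
  apply: leq_trans (_ : #|colors L (tips setT)| <= _); last first.
    by apply: subset_leq_card; rewrite -(setUidPr TX) colorsU subsetUl.
  apply: leq_trans L9.
  have := pair_free_bound (subsetT B) (subsetT _) mate_inj dB (subsetT X) pfX.
  by rewrite card_item cB; card_lia.
case/subsetPn=> _ /imsetP[t _ ->] tX.
pose A := [set: item] :\ inl t.
have cA : #|A| = 8 + #|H|.
  by move: card_item; have := cardsD1 (inl t) [set: item]; rewrite inE => -> [].
have XA : X \subset A by apply/subsetP=> x xX; rewrite !inE andbT; apply: contraNneq tX => <-.
have BA : B \subset A by apply/subsetP=> _ /imsetP[k _ ->]; rewrite !inE.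
have mA : mate @: B \subset A.
  by apply/subsetP=> _ /imsetP[_ /imsetP[k _ ->] ->]; rewrite !inE.
have [|[b bX]|XD] := kinds X (~: [set t]).
- apply/subsetP=> -[u|x] xX; rewrite inE.
    have := subsetP XA _ xX; rewrite !inE !(inj_eq inl_inj) andbT => ut.
    by rewrite [_ \in tips _]imset_f // !inE.
  by rewrite orbC inE; apply/orP; left; apply/imsetP=> -[].
- apply: leq_trans (subset_leq_card (colors_sub L bX)); apply: leq_trans (Lb b).
  have := pair_free_bound BA mA mate_inj dB XA pfX; rewrite cA cB; card_lia.
apply: (@leq_trans #|tips (~: [set t]) :|: B|); first exact: missed_bound (subsetUr _ _) XD.
apply: (@leq_trans 4).
  apply: leq_trans (leq_card_setU _ _) _; rewrite card_tips cB.
  have := cardsC [set t]; rewrite cards1 card_ord add1n => -[->].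
  exact: (leq_add (leqnn 2) cH).
have /set0Pn[[u|[k|b]] xX] := X0.
- exact: leq_trans (Lt u) (subset_leq_card (colors_sub L xX)).
- exact: leq_trans (Lh k) (subset_leq_card (colors_sub L xX)).
- by apply: leq_trans (subset_leq_card (colors_sub L xX)); apply: leq_trans (Lb b).
Qed.

(** Here H is empty and there are nine edges in all, so that an inner edge with a
list of size 9 settles Hall's condition for every set that contains it.  A set
without such edges has at most five elements. *)
Lemma merged_tips_lists (Y : {set Bg}) : #|H| = 0 -> #|Y| <= 2 ->
    (forall t, 4 <= #|L (inl t)|) -> (forall b, 8 <= #|L (inr (inr b))|) ->
    (forall b, b \notin Y -> 9 <= #|L (inr (inr b))|) ->
  list_colorable h L setT.
Proof.
move=> H0 cY Lt Lb Lb9; apply: list_colorable_hall => // X _ X0.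
have [/existsP[b /andP[bX bY]]|/existsPn XY] :=
  boolP [exists b, (inr (inr b) \in X) && (b \notin Y)].
  apply: leq_trans (subset_leq_card (colors_sub L bX)); apply: leq_trans (Lb9 b bY).
  by apply: leq_trans (max_card _) _; rewrite !card_sum card_ord card_Bg H0.
have [/existsP[b bX]|/existsPn Xb] := boolP [exists b, inr (inr b) \in X].
  apply: leq_trans (subset_leq_card (colors_sub L bX)); apply: leq_trans (Lb b).
  apply: (@leq_trans #|tips setT :|: [set inr (inr b) | b in Y]|).
    apply/subset_leq_card/subsetP=> -[t|[k|b']] xX; rewrite inE.
    - by rewrite [_ \in tips _]imset_f.
    - by have : k \in H by []; rewrite (card0_eq H0).
    - by rewrite orbC imset_f //; have := XY b'; rewrite xX /= negbK.
  apply: leq_trans (leq_card_setU _ _) _; rewrite card_tips cardsT card_ord.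
  by apply: leq_trans (leq_add (leqnn 3) (leq_imset_card _ _)) _; lia.
have XT : X \subset tips setT.
  apply/subsetP=> -[t|[k|b]] xX; first by rewrite imset_f.
    by have : k \in H by []; rewrite (card0_eq H0).
  by have := Xb b; rewrite xX.
have /set0Pn[[t|x] tX] := X0; last by have /imsetP[] := subsetP XT _ tX.
apply: leq_trans (subset_leq_card (colors_sub L tX)); apply: leq_trans (Lt t).
by apply: leq_trans (subset_leq_card XT) _; rewrite card_tips cardsT card_ord.
Qed.

End BranchLists.

(** * Extending a partial colouring of an induced subgraph *)

Section StrongListColorings.
Variables (V : finType) (adj : rel V).
Hypotheses (adj_sym : symmetric adj) (adj_irr : irreflexive adj).
Variables (K : finType) (k0 : K) (L : {set V} -> {set K}).
Hypothesis L10 : forall A, 10 <= #|L A|.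
Implicit Types (S R A B Z : {set V}) (x y z u v : V).

Definition edges S : {set {set V}} :=
  [set A | [exists x in S, exists y in S, adj x y && (A == [set x; y])]].

Definition conflict A B := [exists x in A, exists y in B, (x == y) || adj x y].

Definition colorable S := list_colorable conflict L (edges S).

Definition nbr S x := [set y in S | adj x y].

(** The edges away from R, hence coloured before, that conflict with A. *)
Definition blocked S R A := [set B in edges (S :\: R) | conflict A B].

Lemma conflict_sym : symmetric conflict.
Proof.
suff H A B : conflict A B -> conflict B A by move=> A B; apply/idP/idP; apply: H.
case/exists_inP=> x xA /exists_inP[y yB xy].
by apply/exists_inP; exists y => //; apply/exists_inP; exists x; rewrite // eq_sym adj_sym.
Qed.

Lemma edgesP S A :
  reflect (exists x y, [/\ x \in S, y \in S, adj x y & A = [set x; y]]) (A \in edges S).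
Proof.
rewrite inE; apply: (iffP exists_inP) => [[x xS /exists_inP[y yS /andP[xy /eqP ->]]]|].
  by exists x, y.
move=> [x [y [xS yS xy ->]]]; exists x => //; apply/exists_inP; exists y => //.
by rewrite xy eqxx.
Qed.

Lemma in_nbr S x y : (y \in nbr S x) = (y \in S) && adj x y.
Proof. by rewrite inE. Qed.

(** The new edges are indexed by a finite type, so that the remaining problem is about
one of a few fixed index types.  Striking the colours of the blocked edges makes
every conflict between a new and an old edge harmless. *)
Lemma extend_coloring S R (I : finType) (emb : I -> {set V}) (D : {set I}) :
    colorable (S :\: R) ->
    (forall x y, x \in R -> x \in S -> y \in S -> adj x y ->
       exists2 i, i \in D & emb i = [set x; y]) ->
    (forall M : I -> {set K},
       {in D, forall i, 10 <= #|M i| + #|blocked S R (emb i)|} ->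
       list_colorable (fun i j => conflict (emb i) (emb j)) M D) ->
  colorable S.
Proof.
move=> [c cL cP] cover /(_ (fun i => L (emb i) :\: c @: blocked S R (emb i)))[].
  move=> i _; have := cardsID (c @: blocked S R (emb i)) (L (emb i)).
  have := subset_leq_card (subsetIr (L (emb i)) (c @: blocked S R (emb i))).
  have := leq_imset_card c (mem (blocked S R (emb i))).
  have := L10 (emb i); card_lia.
move=> f fM fP.
pose c' A := if A \in edges (S :\: R) then c A
  else if [pick i in D | emb i == A] is Some i then f i else k0.
have c'P A : A \in edges S -> A \in edges (S :\: R) /\ c' A = c A \/
    exists2 i, i \in D & [/\ A = emb i, A \notin edges (S :\: R) & c' A = f i].
  rewrite /c'; case: ifP => [|AR]; first by left.
  move=> /edgesP[x [y [xS yS xy AE]]]; right.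
  have [i0 i0D Ei0] : exists2 i, i \in D & emb i = A.
    have [xR|xR] := boolP (x \in R); first by rewrite AE; apply: cover.
    have [yR|yR] := boolP (y \in R).
      by rewrite AE setUC; apply: cover; rewrite // adj_sym.
    by case/edgesP: AR; exists x, y; rewrite !inE xR yR.
  case: pickP => [i /andP[iD /eqP Ei]|/(_ i0)]; last by rewrite i0D Ei0 eqxx.
  by exists i.
have c'L A : A \in edges S -> c' A \in L A.
  case/c'P=> [[AR ->]|[i iD [-> _ ->]]]; first exact: cL.
  by have := fM i iD; rewrite inE => /andP[].
have new_old i B : i \in D -> B \in edges (S :\: R) -> conflict (emb i) B -> f i != c B.
  move=> iD BR iB; have := fM i iD; rewrite inE => /andP[ci _].
  by apply: contraNneq ci => ->; rewrite imset_f // inE BR.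
exists c' => // A B AS BS AB hAB.
case: (c'P A AS) (c'P B BS) => [[AR ->]|[i iD [Ai _ ->]]] [[BR ->]|[j jD [Bj _ ->]]].
- exact: cP.
- by rewrite eq_sym; apply: new_old; rewrite // -Bj conflict_sym.
- by apply: new_old; rewrite // -Ai.
- apply: fP; rewrite -?Ai -?Bj //; apply: contraNneq AB => ij.
  by rewrite Ai Bj ij.
Qed.

(** Each blocked edge is counted at one of its endpoints in Z. *)
Lemma blocked_le S R A Z :
    (forall B, B \in edges (S :\: R) -> conflict A B -> exists2 z, z \in Z & z \in B) ->
  #|blocked S R A| <= \sum_(z in Z) #|nbr (S :\: R) z|.
Proof.
move=> H; apply: (@leq_trans #|\bigcup_(z in Z) [set [set z; y] | y in nbr (S :\: R) z]|).
  apply/subset_leq_card/subsetP=> B; rewrite inE => /andP[BR AB].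
  have [z zZ zB] := H B BR AB; apply/bigcupP; exists z => //.
  case/edgesP: BR zB => x [y [xR yR xy ->]] /set2P[] ->.
    by apply/imsetP; exists y; rewrite // in_nbr yR.
  by apply/imsetP; exists x; rewrite 1?setUC // in_nbr xR adj_sym.
elim/big_rec2: _ => [|z n U _ IH]; first by rewrite cards0.
apply: leq_trans (leq_card_setU _ _) _.
by apply: leq_add IH; apply: leq_imset_card.
Qed.

Lemma nbr_split S R z : #|nbr (S :\: R) z| + #|nbr S z :&: R| = #|nbr S z|.
Proof.
rewrite addnC -(cardsID R (nbr S z)); congr (_ + #|pred_of_set _|).
by apply/setP=> y; rewrite !inE andbA.
Qed.

(** An edge from v to y conflicts with at most 8 edges away from v: two at the other
neighbour of v, and those at the two further neighbours of y, at most three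
each.  So two colours remain for each of the at most two edges at v. *)
Lemma remove_small_vertex S v : v \in S -> (forall x, x \in S -> #|nbr S x| <= 3) ->
  #|nbr S v| <= 2 -> colorable (S :\ v) -> colorable S.
Proof.
move=> vS deg3 v2 colv.
apply: (extend_coloring (emb := fun y => [set v; y]) (D := nbr S v) colv).
  by move=> x y /set1P -> _ yS vy; exists y; rewrite // in_nbr yS.
move=> M MP; apply: list_colorable_hall => // X XN /set0Pn[y yX].
have yN := subsetP XN y yX.
apply: leq_trans (subset_leq_card XN) _; apply: (leq_trans v2).
apply: leq_trans (subset_leq_card (colors_sub M yX)).
have := MP y yN; have := yN; rewrite in_nbr => /andP[yS vy].
have dR z : z \in S -> adj v z -> #|nbr (S :\ v) z| <= 2.
  move=> zS vz; have := nbr_split S [set v] z; have := deg3 z zS.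
  suff : 0 < #|nbr S z :&: [set v]| by card_lia.
  by rewrite card_gt0; apply/set0Pn; exists v; rewrite !inE vS adj_sym vz eqxx.
pose Z := (nbr S v :\ y) :|: nbr (S :\ v) y.
have : #|blocked S [set v] [set v; y]| <= \sum_(z in Z) #|nbr (S :\ v) z|.
  apply: blocked_le => B /edgesP[p [q [+ + pq ->]]].
  rewrite !inE => /andP[pv pS] /andP[qv qS] /exists_inP[a aA /exists_inP[b bB ab]].
  have toZ w w' : w = y -> adj w w' -> w' \in S -> w' != v -> w' \in Z.
    by move=> -> yw w'S w'v; rewrite !inE w'v w'S yw orbT.
  have yB : b = y -> exists2 z, z \in Z & z \in [set p; q].
    case/set2P: bB => -> E; [exists q|exists p]; rewrite ?set21 ?set22 //.
      exact: toZ E pq qS qv.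
    by apply: toZ E _ pS pv; rewrite adj_sym.
  have [bS bv] : b \in S /\ b != v by case/set2P: bB => ->.
  case/set2P: aA ab => -> /orP[/eqP E|ab].
  - by rewrite -E eqxx in bv.
  - have [/yB//|by_] := eqVneq b y.
    by exists b => //; rewrite !inE by_ ab bS.
  - exact/yB.
  - by exists b => //; apply: toZ ab bS bv.
have : \sum_(z in Z) #|nbr (S :\ v) z| <= 8; last by card_lia.
apply: (@leq_trans (\sum_(z in nbr S v :\ y) 2 + \sum_(z in nbr (S :\ v) y) 3)).
  rewrite (bigID (mem (nbr S v :\ y))) /= leq_add //.
    rewrite (eq_bigl (fun z => z \in nbr S v :\ y)) => [|z]; last first.
      by rewrite [z \in Z]inE; case: (z \in _ :\ y) => //; rewrite andbF.
    by apply: leq_sum => z; rewrite !inE => /and3P[_ zS vz]; apply: dR.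
  apply: (@leq_trans (\sum_(z in nbr (S :\ v) y) #|nbr (S :\ v) z|)).
    rewrite [leqRHS](bigID (mem (nbr S v :\ y))) /= -[leqLHS]add0n leq_add //.
    rewrite big_mkcond [leqRHS]big_mkcond leq_sum // => z _; rewrite inE.
    by case: (z \in nbr S v :\ y); case: (_ \in _).
  apply: leq_sum => z; rewrite in_nbr => /andP[/setD1P[_ zS] _].
  by apply: leq_trans (deg3 z zS); rewrite -(nbr_split S [set v]) leq_addr.
rewrite !sum_nat_const; have := dR y yS vy.
have := cardsD1 y (nbr S v); rewrite yN; move: v2; card_lia.
Qed.

Lemma third_element (A : {set V}) a b : #|A| = 3 -> a \in A -> b \in A -> a != b ->
  exists c, [/\ A = [set a; b; c], c != a & c != b].
Proof.
move=> A3 aA bA ab; have : #|A :\ a :\ b| == 1.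
  move: A3; rewrite (cardsD1 a) aA (cardsD1 b (A :\ a)) !inE bA eq_sym ab !add1n.
  by move=> [->].
case/cards1P=> c cE; have : c \in A :\ a :\ b by rewrite cE inE.
rewrite !inE => /and3P[cb ca cA]; exists c; split=> //.
apply/setP=> z; have /setP/(_ z) := cE; rewrite !inE.
case: (eqVneq z b) => [->|zb]; first by rewrite bA orbT.
by case: (eqVneq z a) => [->|za]; rewrite ?aA //= => <-.
Qed.

Lemma sum_le_pair (Z : {set V}) (F : V -> nat) a b :
  Z \subset [set a; b] -> \sum_(z in Z) F z <= F a + F b.
Proof.
move=> ZP; apply: (@leq_trans (\sum_(z in [set a; b]) F z)).
  rewrite [leqRHS](bigID (mem Z)) /=.
  have -> : \sum_(z in Z) F z = \sum_(z in [set a; b] | z \in Z) F z.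
    by apply: eq_bigl => z; have := subsetP ZP z; case: (z \in Z); rewrite ?andbF // => ->.
  exact: leq_addr.
have [->|ab] := eqVneq a b; first by rewrite setUid big_set1 leq_addr.
by rewrite big_setU1 ?inE //= big_set1.
Qed.

Section CubicPart.
Variables (S R : {set V}).
Hypothesis cubic : forall x, x \in S -> #|nbr S x| = 3.
Hypothesis RS : R \subset S.

Let outdeg z := #|nbr (S :\: R) z|.

Lemma outdeg_le (W : {set V}) z : z \in S -> W \subset R -> {in W, forall r, adj z r} ->
  outdeg z + #|W| <= 3.
Proof.
move=> zS WR zW; rewrite -(cubic zS) -(nbr_split S R) leq_add2l subset_leq_card //.
apply/subsetP=> r rW; rewrite !inE zW // (subsetP RS) (subsetP WR) //.
Qed.

Lemma outdeg_le2 z r : z \in S -> r \in R -> adj z r -> outdeg z <= 2.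
Proof.
move=> zS rR zr; have := @outdeg_le [set r] z zS; rewrite cards1 addn1; apply.
  by rewrite sub1set.
by move=> _ /set1P ->.
Qed.

Lemma outdeg_le1 z r r' : z \in S -> r \in R -> r' \in R -> r != r' -> adj z r -> adj z r' ->
  outdeg z <= 1.
Proof.
move=> zS rR r'R rr' zr zr'; have := @outdeg_le [set r; r'] z zS.
rewrite cards2 rr' addn2; apply; first by rewrite subUset !sub1set rR.
by move=> _ /set2P[]->.
Qed.

(** An edge inside R conflicts with an outer edge only through a neighbour outside R
of one of its endpoints. *)
Lemma core_blocked x y Z : x \in R -> y \in R ->
    (nbr S x :|: nbr S y) :\: R \subset Z ->
  #|blocked S R [set x; y]| <= \sum_(z in Z) outdeg z.
Proof.
move=> xR yR ZP; apply: blocked_le => B /edgesP[p [q [pR qR pq ->]]].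
case/exists_inP=> a aA /exists_inP[b bB ab]; exists b => //.
have : b \in S :\: R by case/set2P: bB => ->.
rewrite inE => /andP[bR bS]; apply: (subsetP ZP); rewrite !inE bR bS /=.
have aR : a \in R by case/set2P: aA => ->.
case/orP: ab => [/eqP E|ab]; first by rewrite -E aR in bR.
by case/set2P: aA ab => -> ->; rewrite ?orbT.
Qed.

Lemma core_blocked1 x y z r : x \in R -> y \in R -> z \in S -> r \in R -> adj z r ->
    (nbr S x :|: nbr S y) :\: R \subset [set z] ->
  #|blocked S R [set x; y]| <= 2.
Proof.
move=> xR yR zS rR zr ZP; apply: leq_trans (core_blocked xR yR ZP) _.
by rewrite big_set1; apply: outdeg_le2 zr.
Qed.

Lemma core_blocked2 x y z z' r r' : x \in R -> y \in R -> z \in S -> z' \in S ->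
    r \in R -> r' \in R -> adj z r -> adj z' r' ->
    (nbr S x :|: nbr S y) :\: R \subset [set z; z'] ->
  #|blocked S R [set x; y]| <= 4.
Proof.
move=> xR yR zS z'S rR r'R zr z'r' ZP; apply: leq_trans (core_blocked xR yR ZP) _.
apply: leq_trans (sum_le_pair outdeg (subxx _)) _.
exact: (leq_add (outdeg_le2 zS rR zr) (outdeg_le2 z'S r'R z'r')).
Qed.

(** For an edge leaving R at x, every blocked edge has an endpoint among the outer
neighbours of w, whether it starts at w or one step further. *)
Lemma pendant_blocked x w : x \in R -> w \in S :\: R -> nbr S x \subset w |: R ->
  #|blocked S R [set x; w]| <= \sum_(z in nbr S w :\: R) outdeg z.
Proof.
move=> xR /setDP[wS wR] xN; apply: blocked_le => B /edgesP[p [q [pR qR pq ->]]].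
case/exists_inP=> a aA /exists_inP[b bB ab].
have wB : b = w -> exists2 z, z \in nbr S w :\: R & z \in [set p; q].
  move=> bw; case/setDP: (pR) => pS pR'; case/setDP: (qR) => qS qR'.
  case/set2P: bB => E; [exists q|exists p]; rewrite ?set21 ?set22 // inE in_nbr.
    by rewrite qR' qS -bw E.
  by rewrite pR' pS -bw E adj_sym.
have : b \in S :\: R by case/set2P: bB => ->.
case/setDP=> bS bR; case/set2P: aA ab => -> /orP[/eqP E|ab].
- by rewrite -E xR in bR.
- have : b \in nbr S x by rewrite in_nbr bS.
  by move/(subsetP xN); rewrite !inE (negPf bR) orbF => /eqP /wB.
- exact/wB.
- by exists b; rewrite // inE bR in_nbr bS.
Qed.

Lemma outer_pair x w : x \in R -> w \in S -> adj x w ->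
  exists a b, [/\ nbr S w :\: R \subset [set a; b], a \in S & b \in S].
Proof.
move=> xR wS xw; have xS := subsetP RS x xR.
have xNw : x \in nbr S w by rewrite in_nbr xS adj_sym.
have [y /setDP[yN]] : exists y, y \in nbr S w :\: [set x].
  by apply/set0Pn; rewrite -card_gt0; have := cardsD1 x (nbr S w); rewrite cubic // xNw add1n => -[<-].
rewrite inE eq_sym => yx; have [z [NE _ _]] := third_element (cubic wS) xNw yN yx.
have zN : z \in nbr S w by rewrite NE !inE eqxx orbT.
exists y, z; split.
- rewrite NE; apply/subsetP=> t; rewrite !inE => /andP[tR /orP[/orP[/eqP tx|->]|->]] //.
    by rewrite tx xR in tR.
  by rewrite orbT.
- by move: yN; rewrite in_nbr => /andP[].
- by move: zN; rewrite in_nbr => /andP[].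
Qed.

Lemma outdeg_le3 z : z \in S -> outdeg z <= 3.
Proof. by move=> zS; rewrite -(cubic zS) -(nbr_split S R) leq_addr. Qed.

Lemma pendant_blocked6 x w : x \in R -> w \in S :\: R -> adj x w ->
  nbr S x \subset w |: R -> #|blocked S R [set x; w]| <= 6.
Proof.
move=> xR wSR xw xN; have [wS _] := setDP wSR.
have [a [b [ZP aS bS]]] := outer_pair xR wS xw.
apply: leq_trans (pendant_blocked xR wSR xN) _.
exact: leq_trans (sum_le_pair outdeg ZP) (leq_add (outdeg_le3 aS) (outdeg_le3 bS)).
Qed.

Lemma pendant_blocked5 x w t r : x \in R -> w \in S :\: R -> adj x w ->
    nbr S x \subset w |: R -> t \in S :\: R -> adj w t -> r \in R -> adj t r ->
  #|blocked S R [set x; w]| <= 5.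
Proof.
move=> xR wSR xw xN tSR wt rR tr; have [wS _] := setDP wSR.
have [a [b [ZP aS bS]]] := outer_pair xR wS xw.
apply: leq_trans (pendant_blocked xR wSR xN) _.
apply: leq_trans (sum_le_pair outdeg ZP) _; have /setDP[tS tR] := tSR.
have : t \in [set a; b] by apply: (subsetP ZP); rewrite inE tR in_nbr tS.
have t2 := outdeg_le2 tS rR tr.
case/set2P=> <-; first exact: leq_add t2 (outdeg_le3 bS).
exact: leq_add (outdeg_le3 aS) t2.
Qed.

End CubicPart.

(** * Reducing triangles, pentagons and squares *)

Lemma conflict_pairs x y z t : conflict [set x; y] [set z; t] =
  [|| x == z, adj x z, x == t, adj x t, y == z, adj y z, y == t | adj y t].
Proof.
apply/exists_inP/idP => [[a aA /exists_inP[b bB]]|].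
  by case/set2P: aA => ->; case/set2P: bB => -> /orP[] ->; rewrite ?orbT.
have w a b : a \in [set x; y] -> b \in [set z; t] -> (a == b) || adj a b ->
    exists2 a, a \in [set x; y] & [exists b in [set z; t], (a == b) || adj a b].
  by move=> ? ? ?; exists a => //; apply/exists_inP; exists b.
rewrite !orbA -!orbA => /orP[H|/orP[H|/orP[H|/orP[H|/orP[H|/orP[H|/orP[H|H]]]]]]].
- by apply: (w x z); rewrite ?set21 ?set22 // H.
- by apply: (w x z); rewrite ?set21 ?set22 // H orbT.
- by apply: (w x t); rewrite ?set21 ?set22 // H.
- by apply: (w x t); rewrite ?set21 ?set22 // H orbT.
- by apply: (w y z); rewrite ?set21 ?set22 // H.
- by apply: (w y z); rewrite ?set21 ?set22 // H orbT.
- by apply: (w y t); rewrite ?set21 ?set22 // H.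
- by apply: (w y t); rewrite ?set21 ?set22 // H orbT.
Qed.

Lemma item_conflict_sym (I : finType) (emb : I -> {set V}) :
  symmetric (fun i j => conflict (emb i) (emb j)).
Proof. by move=> i j; apply: conflict_sym. Qed.

Definition cubic_on S := forall x, x \in S -> #|nbr S x| = 3.

Definition triangle_free S := forall x y z, x \in S -> y \in S -> z \in S ->
  adj x y -> adj y z -> adj z x -> False.

Definition square_free S := forall x y z t, x \in S -> y \in S -> z \in S -> t \in S ->
  adj x y -> adj y z -> adj z t -> adj t x -> x != z -> y != t -> False.

Section CycleReduction.
Variables (S : {set V}) (m : nat) (v : 'I_m.+3 -> V).
Local Open Scope ring_scope.
Hypothesis cubic : cubic_on S.
Hypothesis v_inj : injective v.
Hypothesis vS : forall i, v i \in S.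
Hypothesis v_adj : forall i, adj (v i) (v (i + 1)).
Hypothesis v_chord : forall i j, adj (v i) (v j) -> j = i + 1 \/ j = i - 1.

Let R : {set V} := [set v i | i : 'I_m.+3].

Let ord_succ_pred (i : 'I_m.+3) : i + 1 != i - 1.
Proof.
rewrite -(inj_eq (addIr 1)) subrK -addrA -{2}[i]addr0 (inj_eq (addrI i)).
by [].
Qed.

(** The two neighbours of v i on the cycle are distinct, and without chords the third one
lies outside. *)
Lemma cycle_spokes : exists u : 'I_m.+3 -> V, forall i,
  nbr S (v i) = [set v (i + 1); v (i - 1); u i] /\ u i \notin R.
Proof.
have H i : exists w, nbr S (v i) = [set v (i + 1); v (i - 1); w] /\ w \notin R.
  have v1 : v (i + 1) \in nbr S (v i) by rewrite in_nbr vS v_adj.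
  have v2 : v (i - 1) \in nbr S (v i).
    by rewrite in_nbr vS adj_sym; have := v_adj (i - 1); rewrite subrK.
  have [|w [E wi wi']] := third_element (cubic (vS i)) v1 v2.
    by rewrite (inj_eq v_inj).
  exists w; split=> //; apply/imsetP=> -[j _ wj].
  have : w \in nbr S (v i) by rewrite E !inE eqxx orbT.
  rewrite in_nbr wj => /andP[_ /v_chord[] ji]; first by rewrite wj ji eqxx in wi.
  by rewrite wj ji eqxx in wi'.
by have [u uP] := fin_all_exists H; exists u.
Qed.

Variable u : 'I_m.+3 -> V.
Hypothesis v_nbr : forall i, nbr S (v i) = [set v (i + 1); v (i - 1); u i].
Hypothesis uR : forall i, u i \notin R.

Let vR i : v i \in R. Proof. exact: imset_f. Qed.
Let RS : R \subset S. Proof. by apply/subsetP=> _ /imsetP[i _ ->]. Qed.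

Let u_nbr i : u i \in nbr S (v i).
Proof. by rewrite v_nbr !inE eqxx orbT. Qed.
Let uS i : u i \in S. Proof. by have := u_nbr i; rewrite in_nbr => /andP[]. Qed.
Let vu_adj i : adj (v i) (u i).
Proof. by have := u_nbr i; rewrite in_nbr => /andP[]. Qed.
Let uSR i : u i \in S :\: R. Proof. by rewrite inE uR uS. Qed.

Lemma outer_neighbor i x : x \in S -> x \notin R -> adj (v i) x -> x = u i.
Proof.
move=> xS xR vx; have : x \in nbr S (v i) by rewrite in_nbr xS.
rewrite v_nbr !inE => /orP[/orP[]|] /eqP // E; by rewrite E vR in xR.
Qed.

Definition cycle_item (x : 'I_m.+3 + 'I_m.+3) : {set V} :=
  match x with inl i => [set v i; u i] | inr i => [set v i; v (i + 1)] end.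

Lemma spoke_conflict i j : conflict (cycle_item (inl i)) (cycle_item (inl j)) ->
  j = i \/ [\/ j = i + 1, j = i - 1, u i = u j | adj (u i) (u j)].
Proof.
have vu k l : v k == u l = false by apply: contraNF (uR l) => /eqP <-.
rewrite conflict_pairs !(eq_sym (u i)) !vu (inj_eq v_inj) /=.
case/orP=> [/eqP->|/or4P[H|H|H|H]]; [by left|right|right|right|right].
- by case: (v_chord H) => ->; [constructor 1|constructor 2].
- by constructor 3; apply/esym/(outer_neighbor (uS j) (uR j) H).
- by constructor 3; apply: (outer_neighbor (uS i) (uR i)); rewrite adj_sym.
- case/orP: H => [/eqP ->|E]; first by constructor 3.
  by constructor 4.
Qed.

Lemma chord_conflict i j : conflict (cycle_item (inl i)) (cycle_item (inr j)) ->
  exists2 k, k = j \/ k = j + 1 & [\/ k = i, k = i + 1, k = i - 1 | u k = u i].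
Proof.
have vu k l : v k == u l = false by apply: contraNF (uR l) => /eqP <-.
have case_v k : (v i == v k) || adj (v i) (v k) -> [\/ k = i, k = i + 1, k = i - 1 | u k = u i].
  case/orP=> [/eqP/v_inj ->|/v_chord[->|->]]; first by constructor 1.
    by constructor 2.
  by constructor 3.
have case_u k : adj (u i) (v k) -> [\/ k = i, k = i + 1, k = i - 1 | u k = u i].
  by rewrite adj_sym => H; constructor 4; apply/esym/(outer_neighbor (uS i) (uR i) H).
rewrite conflict_pairs !(eq_sym (u i)) !vu /=.
case/or4P=> [H|H|H|/or3P[H|H|H]].
- by exists j; [left|apply: case_v; rewrite H].
- by exists j; [left|apply: case_v; rewrite H orbT].
- by exists (j + 1); [right|apply: case_v; rewrite H].
- by exists (j + 1); [right|apply: case_v; rewrite H orbT].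
- by exists j; [left|apply: case_u].
- by exists (j + 1); [right|apply: case_u].
Qed.

(** The list sizes are 10 - 6 for a leaving edge, 10 - 4 for an edge of the cycle, and
10 - 5 for a leaving edge whose outer end is joined to another outer end. *)
Lemma cycle_reduction :
    (forall M : 'I_m.+3 + 'I_m.+3 -> {set K},
      (forall i, 4 <= #|M (inl i)|)%N -> (forall i, 6 <= #|M (inr i)|)%N ->
      (forall i j, adj (u i) (u j) -> 5 <= #|M (inl i)|)%N ->
      list_colorable (fun k l => conflict (cycle_item k) (cycle_item l)) M setT) ->
  colorable (S :\: R) -> colorable S.
Proof.
move=> lists colR; apply: (extend_coloring (emb := cycle_item) (D := setT) colR).
  move=> _ y /imsetP[i _ ->] _ yS vy.
  have : y \in nbr S (v i) by rewrite in_nbr yS.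
  rewrite v_nbr !inE => /orP[/orP[]|] /eqP ->.
  - by exists (inr i).
  - by exists (inr (i - 1)); rewrite //= subrK setUC.
  - by exists (inl i).
have vN i : nbr S (v i) \subset u i |: R.
  by rewrite v_nbr !subUset !sub1set !inE eqxx !vR !orbT.
move=> M MP; have {MP}M10 k : (10 <= #|M k| + #|blocked S R (cycle_item k)|)%N by apply: MP.
apply: lists => [i|i|i j uij].
- have := M10 (inl i); have := pendant_blocked6 cubic RS (vR i) (uSR i) (vu_adj i) (vN i).
  by rewrite /=; card_lia.
- have := M10 (inr i); have : (#|blocked S R (cycle_item (inr i))| <= 4)%N; last by card_lia.
  have uv k : adj (u k) (v k) by rewrite adj_sym.
  apply: (core_blocked2 cubic RS (vR i) (vR (i + 1)) (uS i) (uS (i + 1)) (vR i)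
    (vR (i + 1)) (uv i) (uv (i + 1))).
  apply/subsetP=> x /setDP[/setUP[]xN xR].
    by have := subsetP (vN i) x xN; rewrite !inE (negPf xR) orbF => ->.
  by have := subsetP (vN (i + 1)) x xN; rewrite !inE (negPf xR) orbF => ->; rewrite orbT.
- have := M10 (inl i).
  have uvj : adj (u j) (v j) by rewrite adj_sym.
  have := pendant_blocked5 cubic RS (vR i) (uSR i) (vu_adj i) (vN i) (uSR j) uij (vR j) uvj.
  by rewrite /=; card_lia.
Qed.

End CycleReduction.

Lemma nth_cycle_inj n (s : seq V) x0 : uniq s -> size s = n ->
  injective (fun i : 'I_n => nth x0 s i).
Proof.
move=> us sn i j /eqP; rewrite nth_uniq ?sn ?ltn_ord // => /eqP.
exact: val_inj.
Qed.

Lemma reduce_triangle S x y z : cubic_on S -> x \in S -> y \in S -> z \in S ->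
    adj x y -> adj y z -> adj z x ->
  (forall S', S' \proper S -> colorable S') -> colorable S.
Proof.
move=> cubic xS yS zS xy yz zx IH.
have neq a b : adj a b -> a != b by apply: contraTneq => ->; rewrite adj_irr.
pose v (i : 'I_3) := nth x [:: x; y; z] i.
have v_inj : injective v.
  by apply: nth_cycle_inj => //=; rewrite !inE negb_or neq // eq_sym neq // neq.
have vS i : v i \in S by case: i => -[|[|[|]]].
have v_adj i : adj (v i) (v (i + 1)%R) by case: i => -[|[|[|]]].
have v_chord i j : adj (v i) (v j) -> j = (i + 1)%R \/ j = (i - 1)%R.
  have [->|] := eqVneq i j; first by rewrite adj_irr.
  by case: i => -[|[|[|//]]] ?; case: j => -[|[|[|//]]] ? // _ _;
    by [left; apply: val_inj|right; apply: val_inj].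
have [u uP] := cycle_spokes cubic v_inj vS v_adj v_chord.
apply: (cycle_reduction cubic vS (fun i => (uP i).1) (fun i => (uP i).2)).
  by move=> M Mf Me _; apply: triangle_lists.
apply: IH; rewrite properE subsetDl; apply/subsetPn; exists x => //.
by rewrite !inE negb_and negbK; apply/orP; left; apply/imsetP; exists ord0.
Qed.

(** Without squares, vertices at distance two on the pentagon have different outer ends.  So
the edges leaving at these conflict only when the outer ends are adjacent, and
then five colours are left for each. *)
Lemma reduce_pentagon S x0 x1 x2 x3 x4 : cubic_on S -> triangle_free S -> square_free S ->
    x0 \in S -> x1 \in S -> x2 \in S -> x3 \in S -> x4 \in S ->
    adj x0 x1 -> adj x1 x2 -> adj x2 x3 -> adj x3 x4 -> adj x4 x0 ->
    uniq [:: x0; x1; x2; x3; x4] ->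
  (forall S', S' \proper S -> colorable S') -> colorable S.
Proof.
move=> cubic tf sf S0 S1 S2 S3 S4 a01 a12 a23 a34 a40 us IH.
pose v (i : 'I_5) := nth x0 [:: x0; x1; x2; x3; x4] i.
have v_inj : injective v by apply: nth_cycle_inj.
have vS i : v i \in S by case: i => -[|[|[|[|[|]]]]].
have v_adj i : adj (v i) (v (i + 1)%R) by case: i => -[|[|[|[|[|]]]]].
have no2 i : ~ adj (v i) (v (i + 2)%R).
  move=> H; apply: (tf (v i) (v (i + 1)%R) (v (i + 2)%R)) => //; last by rewrite adj_sym.
  by have := v_adj (i + 1)%R; rewrite -addrA.
have far (i j : 'I_5) : [\/ j = i, j = i + 1, j = i - 1 | j = i + 2]%R \/ i = (j + 2)%R.
  case: i => -[|[|[|[|[|//]]]]] ?; case: j => -[|[|[|[|[|//]]]]] ?;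
    by [left; constructor 1; apply: val_inj | left; constructor 2; apply: val_inj
       |left; constructor 3; apply: val_inj | left; constructor 4; apply: val_inj
       |right; apply: val_inj].
have v_chord i j : adj (v i) (v j) -> j = (i + 1)%R \/ j = (i - 1)%R.
  case: (far i j) => [[->|->|->|->]|->]; try by [left|right].
  - by rewrite adj_irr.
  - by move/no2.
  - by rewrite adj_sym => /no2.
have [u uP] := cycle_spokes cubic v_inj vS v_adj v_chord.
have v_nbr i := (uP i).1; have uR i := (uP i).2.
have u_nbr i : u i \in nbr S (v i) by rewrite v_nbr !inE eqxx orbT.
have uS i : u i \in S by have := u_nbr i; rewrite in_nbr => /andP[].
have vu_adj i : adj (v i) (u i) by have := u_nbr i; rewrite in_nbr => /andP[].
have u_neq i : u i != u (i + 2)%R.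
  apply/eqP=> E; apply: (sf (v i) (v (i + 1)%R) (v (i + 2)%R) (u i)) => //.
  - by have := v_adj (i + 1)%R; rewrite -addrA.
  - by rewrite E.
  - by rewrite adj_sym.
  - by rewrite (inj_eq v_inj) eq_sym; case: i {E} => -[|[|[|[|[|]]]]].
  - by apply: contraNneq (uR i) => <-; rewrite imset_f.
have not_near (i j : 'I_5) : j = (i + 2)%R \/ i = (j + 2)%R ->
    [\/ j = i, j = i + 1 | j = i - 1]%R -> False.
  case: i => -[|[|[|[|[|//]]]]] ?; case: j => -[|[|[|[|[|//]]]]] ? [] /(congr1 val) // _;
    by case=> /(congr1 val).
apply: (cycle_reduction cubic vS v_nbr uR).
  move=> M Mf Me M5; apply: pentagon_lists => //.
  - exact: item_conflict_sym.
  - move=> i; apply/negP=> /(chord_conflict v_inj v_chord v_nbr uR)[k kE].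
    have ki : k = (i + 2)%R \/ i = (k + 2)%R.
      by case: kE => ->; [left|right; case: (i) => -[|[|[|[|[|//]]]]] ?; apply: val_inj].
    case=> E; try by apply: (not_near _ _ ki); rewrite E; constructor.

    by case: ki E => ->; [move/esym|] => /eqP; rewrite (negPf (u_neq _)).
  - move=> i j ij /(spoke_conflict v_inj v_chord v_nbr uR)[E|[E|E|E|E]];
      [| | | |exact: M5 E]; exfalso;
      try by apply: (not_near _ _ ij); rewrite E; constructor.
    by case: ij E => ->; [|move/esym] => /eqP; rewrite (negPf (u_neq _)).
apply: IH; rewrite properE subsetDl; apply/subsetPn; exists x0 => //.
by rewrite !inE negb_and negbK; apply/orP; left; apply/imsetP; exists ord0.
Qed.

(** The lists of two tips that do not conflict make 8 colours.  If one of these tips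
conflicts with the third, its list is longer by one; otherwise the third list is
disjoint from both. *)
Lemma three_tips (F : 'I_3 -> {set K}) (c : rel 'I_3) :
    (forall i, 4 <= #|F i|) -> (forall i j, i != j -> c i j -> 5 <= #|F i|) ->
    symmetric c -> (forall i j, i != j -> ~~ c i j -> [disjoint F i & F j]) ->
    (exists i j, i != j /\ ~~ c i j) ->
  9 <= #|\bigcup_i F i|.
Proof.
move=> F4 F5 c_sym dis [i [j [ij cij]]].
have [k [ki kj]] : exists k, k != i /\ k != j.
  have /set0Pn[k kP] : ~: [set i; j] != set0.
    by rewrite -card_gt0; have := cardsC [set i; j]; rewrite cards2 ij card_ord; card_lia.
  by exists k; move: kP; rewrite !inE negb_or => /andP[].
have sub a b : #|F a :|: F b| <= #|\bigcup_i F i|.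
  by apply/subset_leq_card; rewrite subUset !(bigcup_sup _ isT).
have dij : #|F i :|: F j| = #|F i| + #|F j|.
  by apply/eqP; rewrite leq_card_setU; apply: dis.
have [cik|cik] := boolP (c i k).
  have := sub i j; rewrite dij; have := F4 j; have := F5 i k; rewrite eq_sym ki cik => /(_ isT isT).
  by card_lia.
have [cjk|cjk] := boolP (c j k).
  have := sub i j; rewrite dij; have := F4 i; have := F5 j k; rewrite eq_sym kj cjk => /(_ isT isT).
  by card_lia.
have dk : #|F i :|: F j :|: F k| = #|F i :|: F j| + #|F k|.
  apply/eqP; rewrite leq_card_setU disjoint_sym -setI_eq0 setIUr setU_eq0 !setI_eq0.
  by rewrite !dis // c_sym.
have : #|F i :|: F j :|: F k| <= #|\bigcup_i F i|.
  by apply/subset_leq_card; rewrite !subUset !(bigcup_sup _ isT).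
rewrite dk dij; have := F4 i; have := F4 j; have := F4 k; card_lia.
Qed.

Section ThetaGraph.
Variables (S : {set V}) (x x' : V) (y : 'I_3 -> V).
Hypothesis cubic : cubic_on S.
Hypothesis tf : triangle_free S.
Hypotheses (xS : x \in S) (x'S : x' \in S) (xx' : x != x').
Hypothesis y_inj : injective y.
Hypothesis yS : forall i, y i \in S.
Hypotheses (xy : forall i, adj x (y i)) (x'y : forall i, adj x' (y i)).
Hypothesis IH : forall S', S' \proper S -> colorable S'.

(** Remove the complete bipartite graph formed by x, x' and the y i.  If two of its
outer neighbours coincide, the inner edges near them have nine colours left.
If they are distinct, two tips conflict only when the outer neighbours are
adjacent; these are not all adjacent, for want of triangles, so that
[three_tips] applies. *)
Lemma reduce_K23 : colorable S.
Proof.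
pose R := x |: (x' |: [set y i | i : 'I_3]).
have xR : x \in R by rewrite !inE eqxx.
have x'R : x' \in R by rewrite !inE eqxx orbT.
have yR i : y i \in R by rewrite !inE imset_f ?orbT.
have RS : R \subset S.
  by rewrite !subUset !sub1set xS x'S; apply/subsetP=> _ /imsetP[i _ ->].
have nbr_of z : z \in S -> (forall i, adj z (y i)) -> nbr S z = [set y i | i : 'I_3].
  move=> zS zy; apply/esym/eqP; rewrite eqEcard cubic // card_imset // card_ord leqnn andbT.
  by apply/subsetP=> _ /imsetP[i _ ->]; rewrite in_nbr yS zy.
have xN := nbr_of x xS xy; have x'N := nbr_of x' x'S x'y.
have /fin_all_exists[w wP] i : exists w, [/\ nbr S (y i) = [set x; x'; w], w != x & w != x'].
  have H z : z \in S -> adj z (y i) -> z \in nbr S (y i).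
    by move=> zS zy; rewrite in_nbr zS adj_sym.
  have [w [E wx wx']] := third_element (cubic (yS i)) (H x xS (xy i)) (H x' x'S (x'y i)) xx'.
  by exists w.
have yN i : nbr S (y i) = [set x; x'; w i] by have [] := wP i.
have w_nbr i : w i \in nbr S (y i) by rewrite yN !inE eqxx orbT.
have wS i : w i \in S by have := w_nbr i; rewrite in_nbr => /andP[].
have yw i : adj (y i) (w i) by have := w_nbr i; rewrite in_nbr => /andP[].
have wy i : adj (w i) (y i) by rewrite adj_sym.
have yy i j : ~ adj (y i) (y j) by move=> H; apply: (tf xS (yS i) (yS j)) => //; rewrite adj_sym.
have wR i : w i \notin R.
  have [_ wx wx'] := wP i; rewrite !inE (negPf wx) (negPf wx') /=.
  by apply/imsetP=> -[j _ wj]; apply: (yy i j); rewrite -wj.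
have wSR i : w i \in S :\: R by rewrite inE wR wS.
have yNR i : nbr S (y i) \subset w i |: R.
  by apply/subsetP=> t; rewrite yN -setUA !inE => /or3P[] /eqP ->; rewrite eqxx ?orbT.
pose emb (k : 'I_3 + ('I_0 + bool * 'I_3)) : {set V} := match k with
  | inl i => [set y i; w i] | inr (inl _) => set0
  | inr (inr (b, i)) => [set (if b then x else x'); y i] end.
have adjR : S :\: R \proper S.
  by rewrite properE subsetDl; apply/subsetPn; exists x; rewrite // inE xR.
apply: (extend_coloring (emb := emb) (D := setT) (IH adjR)).
  move=> a b; rewrite !inE => /or3P[/eqP->|/eqP->|/imsetP[i _ ->]] _ bS ab.
  - have : b \in nbr S x by rewrite in_nbr bS.
    by rewrite xN => /imsetP[i _ ->]; exists (inr (inr (true, i))).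
  - have : b \in nbr S x' by rewrite in_nbr bS.
    by rewrite x'N => /imsetP[i _ ->]; exists (inr (inr (false, i))).
  - have : b \in nbr S (y i) by rewrite in_nbr bS.
    rewrite yN !inE => /orP[/orP[]|] /eqP ->.
    + by exists (inr (inr (true, i))); rewrite //= setUC.
    + by exists (inr (inr (false, i))); rewrite //= setUC.
    + by exists (inl i).
move=> M MP; have {MP}M10 k : 10 <= #|M k| + #|blocked S R (emb k)| by apply: MP.
have card6 : #|{: bool * 'I_3}| = 6 by rewrite card_prod card_bool card_ord.
have M4 i : 4 <= #|M (inl i)|.
  have := M10 (inl i); have := pendant_blocked6 cubic RS (yR i) (wSR i) (yw i) (yNR i).
  by rewrite /=; card_lia.
have coreN z i : z \in [set x; x'] -> (nbr S z :|: nbr S (y i)) :\: R \subset [set w i].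
  move=> zx; apply/subsetP=> t /setDP[/setUP[]tN tR].
    have : t \in R; last by rewrite (negPf tR).
    by case/set2P: zx tN => ->; rewrite ?xN ?x'N => /imsetP[j _ ->].
  by case/setU1P: (subsetP (yNR i) t tN) => [->|tR']; [rewrite set11|rewrite tR' in tR].
have zR (b : bool) : (if b then x else x') \in R by case: b.
have zx (b : bool) : (if b then x else x') \in [set x; x'] by case: b; rewrite !inE eqxx ?orbT.
have M8 b : 8 <= #|M (inr (inr b))|.
  case: b => b i; have := M10 (inr (inr (b, i))).
  have := core_blocked1 cubic RS (zR b) (yR i) (wS i) (yR i) (wy i) (coreN _ i (zx b)).
  by rewrite /=; card_lia.
have [/existsP[i /existsP[j /andP[ij /eqP wij]]]|/existsPn w_inj] :=
  boolP [exists i, exists j, (i != j) && (w i == w j)].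
  have [k kij] : exists k, forall l, l != k -> l = i \/ l = j.
    have /cards1P[k kE] : #|~: [set i; j]| == 1.
      by apply/eqP; have := cardsC [set i; j]; rewrite cards2 ij card_ord; card_lia.
    exists k => l; have /setP/(_ l) := kE; rewrite !inE => <-.
    by rewrite negbK => /orP[]/eqP ->; [left|right].
  apply: (merged_tips_lists k0 card6 _ (Y := [set (b, k) | b : bool])) => //.
  - by rewrite card_ord.
  - by apply: leq_trans (leq_imset_card _ _) _; rewrite card_bool.
  case=> b l lY; have := M10 (inr (inr (b, l))).
  have lk : l != k by apply: contraNneq lY => ->; rewrite imset_f.
  have yl : y i != y j by rewrite (inj_eq y_inj).
  have wl : w l = w i by case: (kij l lk) => ->.
  have wyj : adj (w l) (y j) by rewrite wl wij wy.
  have wyi : adj (w l) (y i) by rewrite wl wy.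
  have := core_blocked (zR b) (yR l) (coreN _ l (zx b)).
  have := outdeg_le1 cubic RS (wS l) (yR i) (yR j) yl wyi wyj.
  by rewrite big_set1 /=; card_lia.
have {}w_inj i j : i != j -> w i != w j.
  by move=> ij; have := w_inj i; rewrite negb_exists => /forallP/(_ j); rewrite ij.
have tip_conflict i j : i != j -> conflict (emb (inl i)) (emb (inl j)) -> adj (w i) (w j).
  move=> ij; have ywF k l : (y k == w l) = false by apply: contraNF (wR l) => /eqP <-.
  have yFw k l : k != l -> adj (y k) (w l) = false.
    move=> kl; apply/negP=> H; have : w l \in nbr S (y k) by rewrite in_nbr wS.
    rewrite yN !inE => /orP[/orP[]|] /eqP E; try by have := wR l; rewrite E ?xR ?x'R.
    by have := w_inj _ _ kl; rewrite E eqxx.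
  rewrite /emb conflict_pairs (inj_eq y_inj) (negPf ij) !(eq_sym (w i) (y j)) !ywF.
  have ji : j != i by rewrite eq_sym.
  rewrite (adj_sym (w i) (y j)) (yFw i j ij) (yFw j i ji) (negPf (w_inj _ _ ij)) /=.
  by case/orP=> // /yy.
apply: (branch_lists k0 card6 (H := 'I_0) (beta := fun=> (true, ord0))) => //.
- exact: item_conflict_sym.
- by rewrite card_ord.
- by case.
- by case.
- by case.
move=> Mdis; rewrite /colors big_imset /=; last by move=> a b _ _ [].
rewrite (eq_bigl xpredT) => [|i]; last by rewrite inE.
apply: (three_tips (c := fun i j => conflict (emb (inl i)) (emb (inl j)))) => //.
- move=> i j ij /(tip_conflict i j ij) wij; have := M10 (inl i).
  have := pendant_blocked5 cubic RS (yR i) (wSR i) (yw i) (yNR i) (wSR j) wij (yR j) (wy j).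
  by rewrite /=; card_lia.
- by move=> i j; apply: conflict_sym.
have [H|] := boolP [forall i : 'I_3, forall j : 'I_3, (i != j) ==> adj (w i) (w j)].
  have W i j : i != j -> adj (w i) (w j) by move: H => /forallP/(_ i)/forallP/(_ j)/implyP.
  by case: (tf (wS ord0) (wS (lift ord0 ord0)) (wS ord_max)); apply: W.
rewrite negb_forall => /existsP[i]; rewrite negb_forall => /existsP[j].
rewrite negb_imply => /andP[ij wij]; exists i, j; split=> //.
by apply: contra wij; apply: tip_conflict.
Qed.

End ThetaGraph.

(** What may be assumed once [reduce_K23] has dealt with the other case. *)
Definition K23_free S := forall x x' (y : 'I_3 -> V), x \in S -> x' \in S -> x != x' ->
  injective y -> (forall i, y i \in S) -> (forall i, adj x (y i)) ->
  (forall i, adj x' (y i)) -> False.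

Section PentagonPair.
Variables (S : {set V}) (a b c d p q c' d' : V).
Hypotheses (cubic : cubic_on S) (tf : triangle_free S) (kf : K23_free S).
Hypotheses (aS : a \in S) (bS : b \in S) (cS : c \in S) (dS : d \in S).
Hypothesis uniq4 : uniq [:: a; b; c; d].
Hypotheses (aN : nbr S a = [set c; d; p]) (bN : nbr S b = [set c; d; q]).
Hypotheses (cN : nbr S c = [set a; b; c']) (dN : nbr S d = [set a; b; d']).
Hypotheses (p4 : p \notin [:: a; b; c; d]) (q4 : q \notin [:: a; b; c; d]).
Hypotheses (c'4 : c' \notin [:: a; b; c; d]) (d'4 : d' \notin [:: a; b; c; d]).
Hypothesis pq : adj p q.
Hypothesis IH : forall S', S' \proper S -> colorable S'.

(** The square a c b d together with the edge p q forms two pentagons a c b q p and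
a d b q p.  All six vertices are removed.  The tips are the edge p q, with six
colours left, and the edges leaving at c and d; the other two leaving edges, at
p and q, are paired with edges of the square.  When nonconflicting tips have
disjoint lists and the tips still see fewer than nine colours, p q conflicts
with both other tips; then the outer neighbours of p, q and of c, d are the
same two vertices, fewer coloured edges are near, and the lists are longer. *)
Lemma reduce_pentagon_pair : colorable S.
Proof.
have fromN x y z t : nbr S x = [set y; z; t] ->
    [/\ y \in S, z \in S & t \in S] /\ [/\ adj x y, adj x z & adj x t].
  move=> N; have H w : w \in [set y; z; t] -> w \in S /\ adj x w.
    by rewrite -N in_nbr => /andP.
  have [yS xy] : y \in S /\ adj x y by apply: H; rewrite !inE eqxx.
  have [zS xz] : z \in S /\ adj x z by apply: H; rewrite !inE eqxx orbT.
  by have [tS xt] : t \in S /\ adj x t by apply: H; rewrite !inE eqxx !orbT.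
have [[_ _ pS] [ac ad ap]] := fromN _ _ _ _ aN.
have [[_ _ qS] [bc bd bq]] := fromN _ _ _ _ bN.
have [[_ _ c'S] [_ _ cc']] := fromN _ _ _ _ cN.
have [[_ _ d'S] [_ _ dd']] := fromN _ _ _ _ dN.
have neq x y : adj x y -> x != y by apply: contraTneq => ->; rewrite adj_irr.
move: uniq4 p4 q4 c'4 d'4; rewrite /= !inE !negb_or !andbT -!andbA.
case/and5P=> nab nac nad nbc /andP[nbd ncd] /and4P[npa npb npc npd] /and4P[nqa nqb nqc nqd].
move=> /and4P[nc'a nc'b nc'c nc'd] /and4P[nd'a nd'b nd'c nd'd].
have npq := neq _ _ pq; have sym x y : adj x y -> adj y x by rewrite adj_sym.
have nqa' : a != q by rewrite eq_sym.
have pNa : a \in nbr S p by rewrite in_nbr aS sym.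
have pNq : q \in nbr S p by rewrite in_nbr qS.
have [p' [pN np'a np'q]] := third_element (cubic pS) pNa pNq nqa'.
have nbp : b != p by rewrite eq_sym.
have qNb : b \in nbr S q by rewrite in_nbr bS sym.
have qNp : p \in nbr S q by rewrite in_nbr pS sym.
have [q' [qN nq'b nq'p]] := third_element (cubic qS) qNb qNp nbp.
have [[_ _ p'S] [pa _ pp']] := fromN _ _ _ _ pN.
have [[_ _ q'S] [qb qp qq']] := fromN _ _ _ _ qN.
have tri x y z : x \in S -> y \in S -> z \in S -> adj x y -> adj y z -> adj x z -> False.
  by move=> xS yS zS xy yz xz; apply: (tf xS yS zS) => //; apply: sym.
have adjN x y z t w : nbr S x = [set y; z; t] -> w \in S ->
    adj x w -> [|| w == y, w == z | w == t].
  by move=> N wS xw; have := in_nbr S x w; rewrite N wS xw !inE -orbA.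
have nc'p : c' != p by apply/eqP=> E; apply: (tri a c p) => //; rewrite -E.
have nc'q : c' != q by apply/eqP=> E; apply: (tri b c q) => //; rewrite -E.
have nd'p : d' != p by apply/eqP=> E; apply: (tri a d p) => //; rewrite -E.
have nd'q : d' != q by apply/eqP=> E; apply: (tri b d q) => //; rewrite -E.
have no x y z t w : nbr S x = [set y; z; t] -> w \in S -> w != y -> w != z -> w != t -> ~ adj x w.
  by move=> N wS wy wz wt /(adjN _ _ _ _ _ N wS); rewrite (negPf wy) (negPf wz) (negPf wt).
have nqp : q != p by rewrite eq_sym.
have npc' : p != c' by rewrite eq_sym.
have npd' : p != d' by rewrite eq_sym.
have nqc' : q != c' by rewrite eq_sym.
have nqd' : q != d' by rewrite eq_sym.
have np'b : p' != b by apply/eqP=> E; apply: (no _ _ _ _ _ bN pS) => //; apply: sym; rewrite -E.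
have np'c : p' != c by apply/eqP=> E; apply: (no _ _ _ _ _ cN pS) => //; apply: sym; rewrite -E.
have np'd : p' != d by apply/eqP=> E; apply: (no _ _ _ _ _ dN pS) => //; apply: sym; rewrite -E.
have np'p : p' != p by rewrite eq_sym neq.
have nq'a : q' != a by apply/eqP=> E; apply: (no _ _ _ _ _ aN qS) => //; apply: sym; rewrite -E.
have nq'c : q' != c by apply/eqP=> E; apply: (no _ _ _ _ _ cN qS) => //; apply: sym; rewrite -E.
have nq'd : q' != d by apply/eqP=> E; apply: (no _ _ _ _ _ dN qS) => //; apply: sym; rewrite -E.
have nq'q : q' != q by rewrite eq_sym neq.
have np'q' : p' != q' by apply/eqP=> E; apply: (tri p q q') => //; rewrite -E.
(* Otherwise c and d would have three common neighbours. *)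
have nc'd' : c' != d'.
  apply/eqP=> E; apply: (kf (x := c) (x' := d) (y := fun i : 'I_3 => nth a [:: a; b; c'] i)) => //.
  - apply: nth_cycle_inj => //=; rewrite !inE negb_or nab /= andbT.
    by rewrite ![_ == c']eq_sym nc'a nc'b.
  - by case=> -[|[|[|]]].
  - by case=> -[|[|[|]]] //= _; apply: sym.
  - by case=> -[|[|[|]]] //= _; rewrite ?E; do ?[exact: dd'|apply: sym].
pose R := [set x in [:: a; b; c; d; p; q]].
have RE x : x \in R = [|| x == a, x == b, x == c, x == d, x == p | x == q] by rewrite !inE.
have [aR bR cR dR] : [/\ a \in R, b \in R, c \in R & d \in R] by rewrite !RE !eqxx !orbT.
have [pR qR] : p \in R /\ q \in R by rewrite !RE !eqxx !orbT.
have RS : R \subset S by apply/subsetP=> x; rewrite RE => /or4P[/eqP->|/eqP->|/eqP->|/or3P[/eqP->|/eqP->|/eqP->]].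
have outR x : x != a -> x != b -> x != c -> x != d -> x != p -> x != q -> x \notin R.
  by rewrite RE => /negPf-> /negPf-> /negPf-> /negPf-> /negPf-> /negPf->.
have c'R : c' \notin R by apply: outR.
have d'R : d' \notin R by apply: outR.
have p'R : p' \notin R by apply: outR.
have q'R : q' \notin R by apply: outR.
pose emb (k : 'I_3 + (bool + 'I_6)) : {set V} := match k with
  | inl i => nth set0 [:: [set p; q]; [set c; c']; [set d; d']] i
  | inr (inl t) => if t then [set p; p'] else [set q; q']
  | inr (inr i) => nth set0 [:: [set a; c]; [set a; d]; [set b; c]; [set b; d];
      [set a; p]; [set b; q]] i end.
have SRS : S :\: R \proper S by rewrite properE subsetDl; apply/subsetPn; exists a; rewrite // inE aR.
pose tip n lt : 'I_3 + (bool + 'I_6) := inl (@Ordinal 3 n lt).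
pose big n lt : 'I_3 + (bool + 'I_6) := inr (inr (@Ordinal 6 n lt)).
apply: (extend_coloring (emb := emb) (D := setT) (IH SRS)).
  have cover x y z t : nbr S x = [set y; z; t] ->
      (exists k, emb k = [set x; y]) -> (exists k, emb k = [set x; z]) ->
      (exists k, emb k = [set x; t]) ->
      forall w, w \in S -> adj x w -> exists2 k, k \in setT & emb k = [set x; w].
    move=> N [k1 E1] [k2 E2] [k3 E3] w wS /(adjN _ _ _ _ _ N wS) /or3P[]/eqP ->.
    - by exists k1.
    - by exists k2.
    - by exists k3.
  move=> x w + _; rewrite RE => /or4P[/eqP->|/eqP->|/eqP->|/or3P[/eqP->|/eqP->|/eqP->]].
  - by apply: (cover _ _ _ _ aN); [exists (big 0 isT)|exists (big 1 isT)|exists (big 4 isT)].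
  - by apply: (cover _ _ _ _ bN); [exists (big 2 isT)|exists (big 3 isT)|exists (big 5 isT)].
  - apply: (cover _ _ _ _ cN); [exists (big 0 isT)|exists (big 2 isT)|by exists (tip 1 isT)]; exact: setUC.
  - apply: (cover _ _ _ _ dN); [exists (big 1 isT)|exists (big 3 isT)|by exists (tip 2 isT)]; exact: setUC.
  - by apply: (cover _ _ _ _ pN); [exists (big 4 isT); apply: setUC|exists (tip 0 isT)|exists (inr (inl true))].
  - by apply: (cover _ _ _ _ qN); [exists (big 5 isT); apply: setUC|exists (tip 0 isT); apply: setUC|exists (inr (inl false))].
move=> M MP; have {MP}M10 k : 10 <= #|M k| + #|blocked S R (emb k)| by apply: MP.
have out x y z t : nbr S x = [set y; z; t] -> y \in R -> z \in R -> nbr S x :\: R \subset [set t].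
  move=> N yR zR; apply/subsetP=> w /setDP[]; rewrite N !inE -orbA => /or3P[]/eqP -> //.
  - by rewrite -RE yR.
  - by rewrite -RE zR.
have outN x t : nbr S x :\: R \subset [set t] -> nbr S x \subset t |: R.
  move=> H; apply/subsetP=> w wN; have [wR|wR] := boolP (w \in R); first exact: setU1r.
  by have /set1P-> := subsetP H w (introT setDP (conj wN wR)); apply: setU11.
have oc := out _ _ _ _ cN aR bR; have od := out _ _ _ _ dN aR bR.
have op := out _ _ _ _ pN aR qR; have oq := out _ _ _ _ qN bR pR.
have out0 x y z t : nbr S x = [set y; z; t] -> y \in R -> z \in R -> t \in R ->
    forall w, nbr S x :\: R \subset [set w].
  move=> N yR zR tR w; suff -> : nbr S x :\: R = set0 by apply: sub0set.
  apply/eqP; rewrite setD_eq0 N; apply/subsetP=> u; rewrite !inE -orbA -RE.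
  by case/or3P=> /eqP ->.
have oa := out0 _ _ _ _ aN cR dR pR; have ob := out0 _ _ _ _ bN cR dR qR.
have c'c := sym _ _ cc'; have d'd := sym _ _ dd'; have p'p := sym _ _ pp'.
have q'q := sym _ _ qq'.
have core8 k x y w r : emb k = [set x; y] -> x \in R -> y \in R -> w \in S -> r \in R -> adj w r ->
    nbr S x :\: R \subset [set w] -> nbr S y :\: R \subset [set w] -> 8 <= #|M k|.
  move=> kE xR yR wS rR wr ox oy; have := M10 k; rewrite kE.
  have := core_blocked1 cubic RS xR yR wS rR wr.
  rewrite setDUl subUset ox oy => /(_ isT); card_lia.
have M8 i : 8 <= #|M (inr (inr i))|.
  case: i => -[|[|[|[|[|[|//]]]]]] lt.
  - exact: (core8 _ a c c' c).
  - exact: (core8 _ a d d' d).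
  - exact: (core8 _ b c c' c).
  - exact: (core8 _ b d d' d).
  - exact: (core8 _ a p p' p).
  - exact: (core8 _ b q q' q).
have opq Z : p' \in Z -> q' \in Z -> (nbr S p :|: nbr S q) :\: R \subset Z.
  by move=> p'Z q'Z; rewrite setDUl subUset (subset_trans op) ?(subset_trans oq) ?sub1set.
have M6 lt : 6 <= #|M (inl (@Ordinal 3 0 lt))|.
  have := M10 (inl (@Ordinal 3 0 lt)); rewrite /=.
  have := core_blocked2 cubic RS pR qR p'S q'S pR qR p'p q'q.
  by rewrite opq ?set21 ?set22 // => /(_ isT); card_lia.
have pendant4 k x w : emb k = [set x; w] -> x \in R -> w \in S -> w \notin R -> adj x w ->
    nbr S x :\: R \subset [set w] -> 4 <= #|M k|.
  move=> kE xR wS wR xw ox; have := M10 k; rewrite kE.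
  have wSR : w \in S :\: R by rewrite inE wR.
  by have := pendant_blocked6 cubic RS xR wSR xw (outN _ _ ox); card_lia.
have M4 i : 4 <= #|M (inl i)|.
  case: i => -[|[|[|//]]] lt; first exact: leq_trans (M6 lt).
    exact: (pendant4 _ c c').
  exact: (pendant4 _ d d').
have M4' t : 4 <= #|M (inr (inl t))|.
  by case: t; [apply: (pendant4 _ p p')|apply: (pendant4 _ q q')].
have apart x x' y y' : x != y -> ~ adj x y -> x != y' -> ~ adj x y' -> x' != y -> ~ adj x' y ->
    x' != y' -> ~ adj x' y' -> ~~ conflict [set x; x'] [set y; y'].
  rewrite conflict_pairs => /negPf-> /negP/negPf-> /negPf-> /negP/negPf->.
  by move=> /negPf-> /negP/negPf-> /negPf-> /negP/negPf->.
have [q'a' b'p'] : a != q' /\ b != p' by rewrite !(eq_sym _ q') !(eq_sym _ p').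
pose i0 := @Ordinal 3 0 isT; pose i1 := @Ordinal 3 1 isT; pose i2 := @Ordinal 3 2 isT.
have Epc : p' != c' -> ~ adj p' c.
  by move=> E /sym /(adjN _ _ _ _ _ cN p'S); rewrite (negPf np'a) (negPf np'b) (negPf E).
have Epd : p' != d' -> ~ adj p' d.
  by move=> E /sym /(adjN _ _ _ _ _ dN p'S); rewrite (negPf np'a) (negPf np'b) (negPf E).
have Eqc : q' != c' -> ~ adj q' c.
  by move=> E /sym /(adjN _ _ _ _ _ cN q'S); rewrite (negPf nq'a) (negPf nq'b) (negPf E).
have Eqd : q' != d' -> ~ adj q' d.
  by move=> E /sym /(adjN _ _ _ _ _ dN q'S); rewrite (negPf nq'a) (negPf nq'b) (negPf E).
have npb' : ~ adj p b by move=> /sym; apply: (no _ _ _ _ _ bN pS).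
have npc_ : ~ adj p c by move=> /sym; apply: (no _ _ _ _ _ cN pS).
have npd_ : ~ adj p d by move=> /sym; apply: (no _ _ _ _ _ dN pS).
have nqa_ : ~ adj q a by move=> /sym; apply: (no _ _ _ _ _ aN qS).
have nqc_ : ~ adj q c by move=> /sym; apply: (no _ _ _ _ _ cN qS).
have nqd_ : ~ adj q d by move=> /sym; apply: (no _ _ _ _ _ dN qS).
have np'b_ : ~ adj p' b by move=> /sym; apply: (no _ _ _ _ _ bN p'S).
have nq'a_ : ~ adj q' a by move=> /sym; apply: (no _ _ _ _ _ aN q'S).
(* The edge p p' conflicts with b c only if p' = c', and then not with b d, as c' and d'
   differ; likewise for q q' with a c and a d. *)
pose beta (t : bool) : 'I_6 := if t then (if p' == c' then @Ordinal 6 3 isT else @Ordinal 6 2 isT)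
  else (if q' == c' then @Ordinal 6 1 isT else @Ordinal 6 0 isT).
apply: (branch_lists k0 (card_ord 6) (beta := beta)) => //.
- exact: item_conflict_sym.
- by rewrite card_bool.
- by rewrite /beta => -[] [] //; case: ifP => _; case: ifP => _ /(congr1 val).
- case; rewrite /beta.
    case: eqP => [E|/eqP E]; apply: apart => //; last exact: Epc.
    by apply: Epd; rewrite E.
  case: eqP => [E|/eqP E]; apply: apart => //; last exact: Eqc.
  by apply: Eqd; rewrite E.
move=> dis.
set T := colors M _.
have sub i j : #|M (inl i) :|: M (inl j)| <= #|T|.
  apply/subset_leq_card; rewrite subUset.
  by rewrite !colors_sub ?imset_f ?inE.
have two i j : i != j -> ~~ conflict (emb (inl i)) (emb (inl j)) ->
    #|M (inl i)| + #|M (inl j)| <= #|T|.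
  move=> ij cij; apply: leq_trans (sub i j).
  suff /eqP <- : #|M (inl i) :|: M (inl j)| == #|M (inl i)| + #|M (inl j)| by [].
  by rewrite leq_card_setU; apply: dis.
have M60 : 6 <= #|M (inl i0)| := M6 isT.
have M41 := M4 i1; have M42 := M4 i2.
have [c01|/(two i0 i1 isT)] := boolP (conflict [set p; q] [set c; c']); last by move: M60 M41 M42; card_lia.
have [c02|/(two i0 i2 isT)] := boolP (conflict [set p; q] [set d; d']); last by move: M60 M41 M42; card_lia.
(* From here on p q conflicts with both other tips, which forces c' and d' to be p'
   and q' in some order. *)
have near e e' : e \in S -> p != e -> ~ adj p e -> q != e -> ~ adj q e -> e' \in S -> p != e' -> q != e' ->
    e' != a -> e' != b -> conflict [set p; q] [set e; e'] -> e' = p' \/ e' = q'.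
  move=> eS pe ape qe aqe e'S pe' qe' ae' be'; rewrite conflict_pairs.
  rewrite (negPf pe) (negPf qe) (negPf pe') (negPf qe') (negPf (introN idP ape)) /=.
  have pP : adj p e' -> e' = p'.
    by move=> /(adjN _ _ _ _ _ pN e'S); rewrite (negPf ae') (eq_sym e' q) (negPf qe') => /eqP.
  have qP : adj q e' -> e' = q'.
    by move=> /(adjN _ _ _ _ _ qN e'S); rewrite (negPf be') (eq_sym e' p) (negPf pe') => /eqP.
  by case/or3P=> [/pP|/aqe|/qP]; auto.
have c'E : c' = p' \/ c' = q' by apply: (near c).
have d'E : d' = p' \/ d' = q' by apply: (near d).
have link e : e = c' \/ e = d' -> exists r r', [/\ r \in R, r' \in R, r != r', adj e r & adj e r'].
  case=> ->; [case: c'E => E; rewrite E|case: d'E => E; rewrite E].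
  - by exists p, c; rewrite -[in adj p' c]E.
  - by exists q, c; rewrite -[in adj q' c]E.
  - by exists p, d; rewrite -[in adj p' d]E.
  - by exists q, d; rewrite -[in adj q' d]E.
have p'E : p' = c' \/ p' = d'.
  case: c'E d'E => [->|ec] [->|ed]; auto.
  by move: nc'd'; rewrite ec ed eqxx.
have q'E : q' = c' \/ q' = d'.
  case: c'E d'E => [ec|->] [ed|->]; auto.
  by move: nc'd'; rewrite ec ed eqxx.
have one e : e \in S -> e = c' \/ e = d' -> #|nbr (S :\: R) e| <= 1.
  by move=> eS /link[r [r' [rR r'R rr' er er']]]; apply: (outdeg_le1 cubic RS eS rR r'R rr' er er').
have tip7 k x w : emb k = [set x; w] -> x \in R -> w \in S -> w \notin R -> adj x w ->
    w = c' \/ w = d' -> nbr S x :\: R \subset [set w] -> 7 <= #|M k|.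
  move=> kE xR wS wR xw wE ox; have := M10 k; rewrite kE.
  have wSR : w \in S :\: R by rewrite inE wR.
  have := pendant_blocked xR wSR (outN _ _ ox).
  have [r [r' [rR r'R rr' wr wr']]] := link w wE.
  have rN : r \in nbr S w by rewrite in_nbr (subsetP RS).
  have r'N : r' \in nbr S w by rewrite in_nbr (subsetP RS).
  have [t [tE tr tr']] := third_element (cubic wS) rN r'N rr'.
  have tS : t \in S by have : t \in nbr S w; [rewrite tE !inE eqxx !orbT|rewrite in_nbr => /andP[]].
  have := out _ _ _ _ tE rR r'R; rewrite subset1 => /orP[]/eqP ->; rewrite ?big_set1 ?big_set0.
    by have := outdeg_le3 R cubic tS; card_lia.
  by card_lia.
have M71 : 7 <= #|M (inl i1)| by apply: (tip7 _ c c') => //; left.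
have M72 : 7 <= #|M (inl i2)| by apply: (tip7 _ d d') => //; right.
have [c12|/(two i1 i2 isT)] := boolP (conflict [set c; c'] [set d; d']); last by move: M71 M72; card_lia.
have c'd' : adj c' d'.
  move: c12; rewrite conflict_pairs (negPf ncd) ![_ == d']eq_sym.
  rewrite (negPf nd'c) (negPf nc'd) ![d' == _]eq_sym (negPf nc'd') /= => /or4P[H|H|H|//].
  - by case: (no _ _ _ _ _ cN dS) => //; rewrite eq_sym.
  - by case: (no _ _ _ _ _ cN d'S) => //; rewrite eq_sym.
  - by case: (no _ _ _ _ _ dN c'S) => //; apply: sym.
have p'q'_adj : adj p' q'.
  by move: np'q'; case: p'E q'E => -> [] ->; rewrite ?eqxx // adj_sym.
(* Now p' and q' are adjacent, and p' q' is the only coloured edge near p q. *)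
have : #|blocked S R [set p; q]| <= 1; last first.
  by have := M10 (inl i0); have /= := M60; move: (sub i0 i0); rewrite setUid /=; card_lia.
apply: leq_trans (one p' p'S p'E); rewrite -(big_set1 addn p' (fun z => #|nbr (S :\: R) z|)).
apply: blocked_le => B /edgesP[x [y [xSR ySR xy ->]]] cB; exists p'; first exact: set11.
have /setDP[xS xR] := xSR; have /setDP[yS yR] := ySR.
have q'1 z : z \in S -> z \notin R -> adj q' z -> z = p'.
  move=> zS zR qz; have := one q' q'S q'E; rewrite leq_eqVlt ltnS leqn0 => /orP[/cards1P[t tE]|].
    have zt : z \in nbr (S :\: R) q' by rewrite in_nbr qz inE zR zS.
    have pt : p' \in nbr (S :\: R) q' by rewrite in_nbr adj_sym p'q'_adj inE p'R p'S.
    by move: zt pt; rewrite tE => /set1P -> /set1P ->.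
  rewrite cards_eq0 => /eqP E.
  by have : z \in nbr (S :\: R) q'; [rewrite in_nbr qz inE zR zS|rewrite E inE].
have to e z : e \in [set p; q] -> z \in S -> z \notin R -> (e == z) || adj e z -> z = p' \/ z = q'.
  move=> eE zS zR /orP[/eqP ez|]; first by move: zR; rewrite -ez; case/set2P: eE => ->; rewrite ?pR ?qR.
  by case/set2P: eE => ->; [move/(adjN _ _ _ _ _ pN zS)|move/(adjN _ _ _ _ _ qN zS)];
    case/or3P => /eqP E; auto; move: zR; rewrite E ?aR ?bR ?pR ?qR.
case/exists_inP: cB => e eE /exists_inP[z zB ez].
case/set2P: zB ez => -> H.
  case: (to _ _ eE xS xR H) => E; first by rewrite E set21.
  by rewrite -(q'1 y yS yR) ?set22 // -E.
case: (to _ _ eE yS yR H) => E; first by rewrite E set22.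
by rewrite -(q'1 x xS xR) ?set21 // -E adj_sym.
Qed.

End PentagonPair.

(** If opposite leaving edges have no conflict, [square_lists] applies.  They conflict
either because their outer ends coincide, which gives a complete bipartite
graph on 2 and 3 vertices, or because these are adjacent, which gives two
pentagons. *)
Lemma reduce_square S x0 x1 x2 x3 : cubic_on S -> triangle_free S ->
    x0 \in S -> x1 \in S -> x2 \in S -> x3 \in S ->
    adj x0 x1 -> adj x1 x2 -> adj x2 x3 -> adj x3 x0 -> x0 != x2 -> x1 != x3 ->
  (forall S', S' \proper S -> colorable S') -> colorable S.
Proof.
move=> cubic tf S0 S1 S2 S3 a01 a12 a23 a30 n02 n13 IH.
have neq a b : adj a b -> a != b by apply: contraTneq => ->; rewrite adj_irr.
pose theta (x x' : V) (y : {ffun 'I_3 -> V}) := [&& x \in S, x' \in S, x != x', injectiveb y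
  & [forall i, [&& y i \in S, adj x (y i) & adj x' (y i)]]].
have [/existsP[x /existsP[x' /existsP[y /and5P[xS x'S xx' /injectiveP y_inj /forallP yP]]]]|/existsPn no_theta] :=
  boolP [exists x, exists x', exists y, theta x x' y].
  by apply: (reduce_K23 cubic tf xS x'S xx' y_inj _ _ _ IH) => i; case/and3P: (yP i).
have kf : K23_free S.
  move=> x x' y xS x'S xx' y_inj yS xy x'y.
  have := no_theta x; rewrite negb_exists => /forallP/(_ x').
  rewrite negb_exists => /forallP/(_ (finfun y))/negP; apply.
  rewrite /theta xS x'S xx' /=; apply/andP; split.
    by apply/injectiveP=> i j; rewrite !ffunE => /y_inj.
  by apply/forallP=> i; rewrite ffunE yS xy x'y.
pose v (i : 'I_4) := nth x0 [:: x0; x1; x2; x3] i.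
have v_inj : injective v.
  apply: nth_cycle_inj => //=; rewrite !inE !negb_or n02 n13 !neq //.
  by rewrite adj_sym.
have vS i : v i \in S by case: i => -[|[|[|[|]]]].
have v_adj i : adj (v i) (v (i + 1)%R) by case: i => -[|[|[|[|]]]].
have no2 i : ~ adj (v i) (v (i + 2)%R).
  move=> H; apply: (tf (v i) (v (i + 1)%R) (v (i + 2)%R)) => //; last by rewrite adj_sym.
  by have := v_adj (i + 1)%R; rewrite -addrA.
have far (i j : 'I_4) : [\/ j = i, j = i + 1, j = i - 1 | j = i + 2]%R.
  case: i => -[|[|[|[|//]]]] ?; case: j => -[|[|[|[|//]]]] ?;
    by [constructor 1; apply: val_inj|constructor 2; apply: val_inj
       |constructor 3; apply: val_inj|constructor 4; apply: val_inj].
have v_chord i j : adj (v i) (v j) -> j = (i + 1)%R \/ j = (i - 1)%R.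
  case: (far i j) => ->; try by [left|right].
    by rewrite adj_irr.
  by move/no2.
have [u uP] := cycle_spokes cubic v_inj vS v_adj v_chord.
have v_nbr i := (uP i).1; have uR i := (uP i).2.
have u_nbr i : u i \in nbr S (v i) by rewrite v_nbr !inE eqxx orbT.
have uS i : u i \in S by have := u_nbr i; rewrite in_nbr => /andP[].
have vu_adj i : adj (v i) (u i) by have := u_nbr i; rewrite in_nbr => /andP[].
have vu i j : v i != u j by apply: contraNneq (uR j) => <-; rewrite imset_f.
have [i12 i21 i31] : [/\ forall i : 'I_4, (i + 2 + 1 = i - 1)%R, forall i : 'I_4, (i + 2 - 1 = i + 1)%R
    & forall i : 'I_4, (i - 1 - 1 = i + 2)%R].
  by split=> -[[|[|[|[|]]]] ?] //; apply: val_inj.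
have vneq (i : 'I_4) : uniq [:: v i; v (i + 2); v (i + 1); v (i - 1)]%R.
  rewrite (map_inj_uniq v_inj [:: i; i + 2; i + 1; i - 1]%R).
  by case: i => -[|[|[|[|]]]].
have u_neq i : u i != u (i + 2)%R.
  apply/eqP=> E; have /and4P[+ + + _] := vneq i; rewrite !inE !negb_or => /and3P[n1 n2 n3] /andP[n4 n5] n6.
  apply: (kf (v i) (v (i + 2)%R) (fun k : 'I_3 => nth x0 [:: v (i + 1)%R; v (i - 1)%R; u i] k)) => //.
  - by apply: nth_cycle_inj; rewrite //= !inE negb_or n6 !vu.
  - by case=> -[|[|[|]]] //=.
  - case=> -[|[|[|]]] //= _; by have := v_adj (i - 1)%R; rewrite subrK adj_sym.
  - case=> -[|[|[|]]] //= _.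
    + by have := v_adj (i + 1)%R; rewrite -addrA adj_sym.
    + by have := v_adj (i + 2)%R; rewrite i12.
    + by rewrite E.
have [/existsP[i ui]|/existsPn no_uu] := boolP [exists i, adj (u i) (u (i + 2)%R)].
  apply: (@reduce_pentagon_pair S (v i) (v (i + 2)%R) (v (i + 1)%R) (v (i - 1)%R) (u i) (u (i + 2)%R)
    (u (i + 1)%R) (u (i - 1)%R)) => //.
  - by rewrite v_nbr i12 i21 (setUC [set v _] [set v _]).
  - by rewrite v_nbr -addrA addrK setUC (setUC [set v _] [set v _]) setUC.
  - by rewrite v_nbr i31 subrK.
  - by rewrite !inE !negb_or ![u _ == _]eq_sym !vu.
  - by rewrite !inE !negb_or ![u _ == _]eq_sym !vu.
  - by rewrite !inE !negb_or ![u _ == _]eq_sym !vu.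
  - by rewrite !inE !negb_or ![u _ == _]eq_sym !vu.
apply: (cycle_reduction cubic vS v_nbr uR).
  move=> M Mf Me _; apply: square_lists => //.
    exact: item_conflict_sym.
  move=> i; apply/negP=> /(spoke_conflict v_inj v_chord v_nbr uR)[E|[E|E|E|E]].
  - by case: i E => -[|[|[|[|//]]]] ? /(congr1 val).
  - by case: i E => -[|[|[|[|//]]]] ? /(congr1 val).
  - by case: i E => -[|[|[|[|//]]]] ? /(congr1 val).
  - by move/eqP: E; rewrite (negPf (u_neq i)).
  - by have := no_uu i; rewrite E.
apply: IH; rewrite properE subsetDl; apply/subsetPn; exists x0 => //.
by rewrite !inE negb_and negbK; apply/orP; left; apply/imsetP; exists ord0.
Qed.

Definition short_cycle S := exists2 s : seq V, uniq s && (2 < size s <= 5)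
  & cycle adj s && all (mem S) s.

(** The cycles are reduced in the order of their lengths, as each reduction uses that the
shorter ones are absent. *)
Theorem short_cycles_colorable :
    (forall S x, x \in S -> #|nbr S x| <= 3) ->
    (forall S, S != set0 -> cubic_on S -> short_cycle S) ->
  forall S, colorable S.
Proof.
move=> deg3 girth S; have [n] := ubnP #|S|; elim: n S => // n IHn S Sn.
have IH S' : S' \proper S -> colorable S'.
  by move=> /proper_card S'S; apply: IHn; apply: leq_trans S'S _.
have [->|S0] := eqVneq S set0.
  have no A : A \notin edges set0 by apply/edgesP=> -[x [y []]]; rewrite inE.
  by exists (fun=> k0) => A; have := no A => /negPf->.
have [cubic|] := boolP [forall x in S, #|nbr S x| == 3]; last first.
  rewrite negb_forall => /existsP[x]; rewrite negb_imply => /andP[xS x3].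
  apply: (remove_small_vertex xS); [exact: deg3| |].
    by have := deg3 S x xS; rewrite leq_eqVlt (negPf x3).
  by apply: IH; rewrite properD1.
have {}cubic : cubic_on S by move=> x xS; apply/eqP/(implyP (forallP cubic x)).
have short_tri : triangle_free S \/ colorable S.
  have [/existsP[x /existsP[y /existsP[z /and5P[xS yS zS xy /andP[yz zx]]]]]|/existsPn no3] :=
    boolP [exists x, exists y, exists z, [&& x \in S, y \in S, z \in S, adj x y, adj y z & adj z x]].
    by right; apply: (reduce_triangle cubic xS yS zS).
  left=> x y z xS yS zS xy yz zx; move/(_ x): no3; apply/negP; rewrite negbK.
  by apply/existsP; exists y; apply/existsP; exists z; rewrite xS yS zS xy yz.
case: short_tri => // tf.
have short_sq : square_free S \/ colorable S.
  have [/existsP[x /existsP[y /existsP[z /existsP[t]]]]|/existsPn no4] :=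
    boolP [exists x, exists y, exists z, exists t, [&& x \in S, y \in S, z \in S, t \in S
      & [&& adj x y, adj y z, adj z t, adj t x, x != z & y != t]]].
    case/and5P=> xS yS zS tS /and5P[xy yz zt tx /andP[xz yt]].
    by right; apply: (reduce_square cubic tf xS yS zS tS).
  left=> x y z t xS yS zS tS xy yz zt tx xz yt; move/(_ x): no4; apply/negP; rewrite negbK.
  apply/existsP; exists y; apply/existsP; exists z; apply/existsP; exists t.
  by rewrite xS yS zS tS xy yz zt tx xz yt.
case: short_sq => // sf.
have [s /andP[us /andP[s2 s5]] /andP[cs Ss]] := girth S S0 cubic.
case: s us s2 s5 cs Ss => [|x [|y [|z [|t [|w [|]]]]]] //= us _ _; rewrite !andbT.
- case/and3P=> xy yz zx /and3P[xS yS zS].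
  by case: (tf x y z).
- case/and4P=> xy yz zt tx /and4P[xS yS zS tS].
  case: (sf x y z t) => //; apply: contraTneq us => ->; rewrite !inE eqxx ?orbT ?andbF //.
- case/and5P=> xy yz zt tw wx /and5P[xS yS zS tS wS].
  exact: (@reduce_pentagon S x y z t w).
Qed.

End StrongListColorings.

(** * Crossing parities of segments and rays *)

Section Crossings.
Variable R : realFieldType.
Local Open Scope ring_scope.
Implicit Types a b z : R * R.

Definition along a b (s : R) : R * R :=
  (a.1 + s * (b.1 - a.1), a.2 + s * (b.2 - a.2)).

Definition meet a b z z' := exists s t : R,
  [/\ 0 <= s <= 1, 0 <= t <= 1 & along a b s = along z z' t].

(** Positive when z lies to the left of the line directed from a to b. *)
Definition orient a b z : R :=
  (b.1 - a.1) * (z.2 - a.2) - (b.2 - a.2) * (z.1 - a.1).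

(** Whether the horizontal ray to the right of z crosses the segment from a to b.  The
half-open condition on heights treats z as slightly raised, so that each
crossing of a polygonal line is counted once, even at a vertex. *)
Definition rcross z a b : bool :=
  (a.2 <= z.2 < b.2) && (0 < orient a b z) ||
  (b.2 <= z.2 < a.2) && (0 < orient b a z).

(** Whether the horizontal ray to the left of a crosses the segment from z to z'.  Here
a is treated as slightly lowered, which is the same tie-breaking as in
[rcross], seen from the other segment. *)
Definition lcross a z z' : bool :=
  (z.2 < a.2 <= z'.2) && (orient z z' a < 0) ||
  (z'.2 < a.2 <= z.2) && (orient z' z a < 0).

Lemma meetC a b z z' : meet a b z z' -> meet z z' a b.
Proof. by case=> s [t [? ? ?]]; exists t, s. Qed.

Lemma meet_swapl a b z z' : meet a b z z' -> meet b a z z'.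
Proof.
case=> s [t [s01 t01 E]]; exists (1 - s), t; split=> //; first by lra.
by rewrite -E /along; congr pair; ring.
Qed.

Lemma meet_swapr a b z z' : meet a b z z' -> meet a b z' z.
Proof. by move=> /meetC/meet_swapl/meetC. Qed.

Definition flip a : R * R := (- a.1, a.2).

Lemma meet_flip a b z z' : meet (flip a) (flip b) (flip z) (flip z') -> meet a b z z'.
Proof.
case=> s [t [s01 t01]]; rewrite /along /= => -[E1 E2].
exists s, t; split=> //; congr pair => //.
by apply: oppr_inj; move: E1; rewrite !opprD -!mulrN !opprD.
Qed.

Lemma orient_flip a b z : orient (flip a) (flip b) (flip z) = - orient a b z.
Proof. by rewrite /orient /=; ring. Qed.

Lemma rcrossC z a b : rcross z a b = rcross z b a.
Proof. by rewrite /rcross orbC. Qed.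

Lemma lcrossC a z z' : lcross a z z' = lcross a z' z.
Proof. by rewrite /lcross orbC. Qed.

Lemma on_segment a b z : a.2 < b.2 -> a.2 <= z.2 <= b.2 -> orient a b z = 0 ->
  exists2 s, 0 <= s <= 1 & along a b s = z.
Proof.
move=> ab zab Oz; have ab0 : 0 < b.2 - a.2 by lra.
exists ((z.2 - a.2) / (b.2 - a.2)).
  by rewrite divr_ge0 ?ler_pdivrMr /=; lra.
rewrite [RHS]surjective_pairing /along; congr pair; last by field; lra.
apply: (@mulIf _ (b.2 - a.2)); first by lra.
rewrite mulrDl mulrAC divfK; last by lra.
by move: Oz; rewrite /orient; lra.
Qed.

(** The line through a and b separates z from z', and both heights are within those of
the segment, so the crossing point is on the segment. *)
Lemma nested_meet a b z z' : a.2 < b.2 ->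
  a.2 <= z.2 <= b.2 -> a.2 <= z'.2 <= b.2 ->
  0 < orient a b z -> orient a b z' <= 0 -> meet a b z z'.
Proof.
move=> ab zab zab' Oz Oz'.
have D0 : 0 < orient a b z - orient a b z' by lra.
pose t := orient a b z / (orient a b z - orient a b z').
have t01 : 0 <= t <= 1 by rewrite divr_ge0 ?ler_pdivrMr //=; lra.
have [||s s01 sE] := @on_segment a b (along z z' t) ab.
- by rewrite /along /=; nra.
- have -> : orient a b (along z z' t)
      = orient a b z + t * (orient a b z' - orient a b z).
    by rewrite /orient /along /=; ring.
  by rewrite /t; field; lra.
by exists s, t.
Qed.

(** The heights of the two segments overlap between z and b.  At the height of z the
segment z z' is to the left of a b, and at the height of b it is to the right,
so they cross in between; Cramer's rule gives the parameters. *)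
Lemma staggered_meet a b z z' : a.2 < b.2 -> z.2 < z'.2 ->
  a.2 <= z.2 <= b.2 -> b.2 <= z'.2 ->
  0 <= orient a b z -> 0 <= orient z z' b -> meet a b z z'.
Proof.
move=> ab zz zab bz' Oz Ob.
pose D := (b.1 - a.1) * (z'.2 - z.2) - (b.2 - a.2) * (z'.1 - z.1).
have E : D * (z.2 - b.2) =
    orient z z' b * (b.2 - a.2) + orient a b z * (z'.2 - z.2).
  by rewrite /D /orient; ring.
have [Ob0|Ob0] := eqVneq (orient z z' b) 0.
  have [|t t01 tE] := on_segment zz _ Ob0; first by lra.
  exists 1, t; split=> //; first by lra.
  by rewrite tE /along [RHS]surjective_pairing; congr pair; ring.
have {}Ob0 : 0 < orient z z' b by rewrite lt_neqAle eq_sym Ob0.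
have zb : z.2 < b.2.
  rewrite lt_neqAle; case/andP: zab => _ ->; rewrite andbT; apply/eqP=> zb.
  by move: E; rewrite zb; nra.
have D0 : D < 0 by nra.
exists ((D + orient z z' b) / D), (- orient a b z / D); split.
- by rewrite ler_ndivlMr ?ler_ndivrMr //; nra.
- by rewrite ler_ndivlMr ?ler_ndivrMr //; nra.
rewrite /along; congr pair; apply: (@mulIf _ D); rewrite ?lt_eqF //.
  by rewrite !mulrDl ![_ / D * _ * D]mulrAC !divfK ?lt_eqF // /D /orient; ring.
by rewrite !mulrDl ![_ / D * _ * D]mulrAC !divfK ?lt_eqF // /D /orient; ring.
Qed.

(** Move a point from z to z' along a segment disjoint from a b.  Whether the ray to its
right crosses a b changes exactly when the point passes the height of a or of b
on the left of this endpoint, that is, where the ray to the left of the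
endpoint crosses the path. *)
Theorem crossing_parity a b z z' : ~ meet a b z z' ->
  rcross z a b (+) rcross z' a b = lcross a z z' (+) lcross b z z'.
Proof.
wlog ab : a b / a.2 <= b.2.
  move=> W H; have [/W|/ltW/W] := leP a.2 b.2; first exact.
  rewrite rcrossC (rcrossC z') [RHS]addbC; apply.
  by move=> /meet_swapl.
wlog zz : z z' / z.2 <= z'.2.
  move=> W H; have [/W|/ltW/W] := leP z.2 z'.2; first exact.
  rewrite lcrossC (lcrossC b) [LHS]addbC; apply.
  by move=> /meet_swapr.
move=> nm; rewrite /rcross /lcross.
have -> : (b.2 <= z.2 < a.2) = false by lra.
have -> : (b.2 <= z'.2 < a.2) = false by lra.
have -> : (z'.2 < a.2 <= z.2) = false by lra.
have -> : (z'.2 < b.2 <= z.2) = false by lra.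
rewrite /= !orbF.
(* Every overlap of the two ranges of heights is nested or staggered, up to exchanging
   the segments and reflecting left and right. *)
have stag c d x x' : ~ meet c d x x' -> c.2 < d.2 -> x.2 < x'.2 ->
    c.2 <= x.2 <= d.2 -> d.2 <= x'.2 -> (0 < orient c d x) = (orient x x' d < 0).
  move=> nmx cd xx cxd dx'; rewrite !ltNge; congr (~~ _); apply/idP/idP => H.
    rewrite leNgt; apply/negP => H'; apply: nmx; apply: meet_flip.
    by apply: staggered_meet; rewrite //= orient_flip oppr_ge0 // ltW.
  by rewrite leNgt; apply/negP => H'; apply: nmx; apply: staggered_meet; rewrite // ltW.
have nest c d x x' : ~ meet c d x x' -> c.2 < d.2 -> c.2 <= x.2 <= d.2 ->
    c.2 <= x'.2 <= d.2 -> (0 < orient c d x) = (0 < orient c d x').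
  move=> nmx cd cxd cx'd; apply/idP/idP => H; rewrite ltNge; apply/negP => H'.
    by apply: nmx; apply: nested_meet.
  by apply: nmx; apply: meet_swapr; apply: nested_meet.
have nest' c d x x' : ~ meet c d x x' -> c.2 < d.2 -> c.2 <= x.2 <= d.2 ->
    c.2 <= x'.2 <= d.2 -> (orient c d x < 0) = (orient c d x' < 0).
  move=> nmx cd cxd cx'd.
  have := nest (flip c) (flip d) (flip x) (flip x').
  by rewrite !orient_flip !oppr_gt0; apply=> // /meet_flip.
have stag' c d x x' : ~ meet c d x x' -> c.2 < d.2 -> x.2 < x'.2 ->
    c.2 <= x.2 <= d.2 -> d.2 <= x'.2 -> (orient c d x < 0) = (0 < orient x x' d).
  move=> nmx cd xx cxd dx'.
  have := stag (flip c) (flip d) (flip x) (flip x').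
  by rewrite !orient_flip oppr_gt0 oppr_lt0; apply=> // /meet_flip.
have nm' : ~ meet z z' a b by move=> /meetC.
case: (leP a.2 z.2) => az; case: (ltP z.2 b.2) => zb;
  case: (leP a.2 z'.2) => az'; case: (ltP z'.2 b.2) => zb' //=;
  case: (ltP z.2 a.2) => za //=; case: (leP b.2 z'.2) => bz //=;
  rewrite ?addbF ?addFb; try (by exfalso; lra); try by [].
- by rewrite (nest _ _ _ _ nm) ?addbb //; lra.
- by rewrite (stag _ _ _ _ nm) //; lra.
- by rewrite -(stag' _ _ _ _ nm') //; lra.
- by rewrite (nest' _ _ _ _ nm') ?addbb //; lra.
Qed.

End Crossings.

Section ParityOfDrawings.
Variable R : realFieldType.
Local Open Scope ring_scope.
Implicit Types a b z v x y : R * R.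

(** The half-turn of directions at v; the horizontal direction to the left belongs to
it, in accordance with the tie-breaking of [rcross] and [lcross]. *)
Definition upward v x := (v.2 < x.2) || (x.2 == v.2) && (x.1 < v.1).

Definition same_ray v x y := exists2 k : R, 0 < k & y = along v x k.

Lemma ratio_gt0 (s t : R) : 0 < s * t -> 0 < t / s.
Proof.
move=> st; have s0 : s != 0 by apply: contraTneq st => ->; rewrite mul0r ltxx.
have -> : t / s = s * t / s ^+ 2 by field.
by rewrite divr_gt0 // exprn_even_gt0.
Qed.

(** Each parenthesis compares the directions of x and y at v.  Exchanging them reverses
the comparison of directions in the same half-turn, and leaves it as it is for
directions in different half-turns. *)
Lemma rcross_lcross_center v x y : x != v -> y != v -> ~ same_ray v x y ->
  (rcross x v y (+) lcross y v x) (+) (rcross y v x (+) lcross x v y)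
    = ~~ (upward v x (+) upward v y).
Proof.
move=> xv yv nr.
have nr1 : orient v y x = 0 -> ~ 0 < (x.2 - v.2) * (y.2 - v.2).
  move=> O xy; apply: nr; exists ((y.2 - v.2) / (x.2 - v.2)); first exact: ratio_gt0.
  have x0 : x.2 - v.2 != 0 by apply: contraTneq xy => ->; lra.
  rewrite [LHS]surjective_pairing /along; congr pair; last by field.
  apply: (@mulIf _ (x.2 - v.2)) => //; rewrite mulrDl mulrAC divfK //.
  by move: O; rewrite /orient; lra.
have nr2 : x.2 = v.2 -> y.2 = v.2 -> (x.1 - v.1) * (y.1 - v.1) < 0.
  move=> x2 y2; rewrite ltNge; apply/negP=> xy.
  have x1 : x.1 - v.1 != 0.
    by apply: contra_neq xv => x1; rewrite [x]surjective_pairing [v]surjective_pairing x2; congr pair; lra.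
  have y1 : y.1 - v.1 != 0.
    by apply: contra_neq yv => y1; rewrite [y]surjective_pairing [v]surjective_pairing y2; congr pair; lra.
  apply: nr; exists ((y.1 - v.1) / (x.1 - v.1)).
    apply: ratio_gt0; rewrite lt_neqAle xy eq_sym mulf_neq0 //.
  rewrite [LHS]surjective_pairing /along; congr pair; last by rewrite y2 x2; ring.
  by field.
have E1 : orient y v x = - orient v y x by rewrite /orient; ring.
have E2 : orient v x y = - orient v y x by rewrite /orient; ring.
have E3 : orient x v y = orient v y x by rewrite /orient; ring.
rewrite /rcross /lcross /upward E3 E2 E1 !oppr_gt0 !oppr_lt0.
have O : orient v y x = (y.1 - v.1) * (x.2 - v.2) - (y.2 - v.2) * (x.1 - v.1) by [].
have neq1 (z : R * R) : z != v -> z.2 = v.2 -> z.1 != v.1.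
  move=> zv z2; apply: contra_neq zv => z1.
  by rewrite [z]surjective_pairing [v]surjective_pairing z1 z2.
have {}xv := neq1 x xv; have {neq1}yv := neq1 y yv.
move: nr1 nr2 O; move: (orient v y x) => o nr1 nr2 O {nr E1 E2 E3}.
case: (ltgtP x.2 v.2) => xv2; case: (ltgtP y.2 v.2) => yv2 //=.
- have {nr1 O}: o != 0 by apply/eqP=> /nr1; apply; nra.
  by case: (ltgtP x.2 y.2) => xy2 //=; case: (ltgtP o 0) => o0 //=.
- by case: (ltgtP x.2 y.2) => xy2 //=; lra.
- case: (ltgtP x.2 y.2) => xy2 /=; try by exfalso; lra.
  move: (yv yv2); case: (ltgtP y.1 v.1) => // yv1 _.
    by have o0 : 0 < o; [nra|rewrite ?o0 ?(lt_gtF o0)].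
  by have o0 : o < 0; [nra|rewrite ?o0 ?(lt_gtF o0)].
- by case: (ltgtP x.2 y.2) => xy2 //=; lra.
- have {nr1 O}: o != 0 by apply/eqP=> /nr1; apply; nra.
  by case: (ltgtP x.2 y.2) => xy2 //=; case: (ltgtP o 0) => o0 //=.
- case: (ltgtP x.2 y.2) => xy2 /=; try by exfalso; lra.
  move: (yv yv2); case: (ltgtP y.1 v.1) => // yv1 _.
    by have o0 : o < 0; [nra|rewrite ?o0 ?(lt_gtF o0)].
  by have o0 : 0 < o; [nra|rewrite ?o0 ?(lt_gtF o0)].
- case: (ltgtP x.2 y.2) => xy2 /=; try by exfalso; lra.
  move: (xv xv2); case: (ltgtP x.1 v.1) => // xv1 _.
    by have o0 : o < 0; [nra|rewrite ?o0 ?(lt_gtF o0)].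
  by have o0 : 0 < o; [nra|rewrite ?o0 ?(lt_gtF o0)].
- case: (ltgtP x.2 y.2) => xy2 /=; try by exfalso; lra.
  move: (xv xv2); case: (ltgtP x.1 v.1) => // xv1 _.
    by have o0 : 0 < o; [nra|rewrite ?o0 ?(lt_gtF o0)].
  by have o0 : o < 0; [nra|rewrite ?o0 ?(lt_gtF o0)].
- have := nr2 xv2 yv2; rewrite xv2 yv2 ltxx lexx /=.
  case: (ltgtP x.1 v.1) => xv1; case: (ltgtP y.1 v.1) => yv1 //=; nra.
Qed.

End ParityOfDrawings.

(** * Parities of drawings by polygonal lines *)

Lemma addb_eq (a b : bool) : a (+) b = false -> a = b.
Proof. by case: a; case: b. Qed.

Section Polylines.
Variable R : realFieldType.
Local Open Scope ring_scope.
Implicit Types a b z v x y : R * R.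

Definition segments a (s : seq (R * R)) := zip (a :: s) s.

Definition xpar z a s : bool :=
  \big[addb/false]_(q <- segments a s) rcross z q.1 q.2.

(** The terms of [crossing_parity] at the inner vertices cancel. *)
Lemma xpar_move a s z z' :
    (forall q, q \in segments a s -> ~ meet q.1 q.2 z z') ->
  xpar z a s (+) xpar z' a s = lcross a z z' (+) lcross (last a s) z z'.
Proof.
rewrite /xpar /segments; elim: s a => [|b s IHs] a nm /=.
  by rewrite !big_nil !addbb.
rewrite !big_cons /= addbACA crossing_parity; last first.
  by have /= := nm (a, b); apply; rewrite inE eqxx.
rewrite IHs; last by move=> q qs; apply: nm; rewrite inE qs orbT.
by rewrite addbA -(addbA (lcross a z z')) addbb addbF.
Qed.

Lemma segments_const (T : Type) (F : R * R -> T) a s :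
  (forall q, q \in segments a s -> F q.1 = F q.2) -> F a = F (last a s).
Proof.
elim: s a => //= b s IHs a H.
have -> : F a = F b by have /= := H (a, b); apply; rewrite inE eqxx.
by apply: IHs => q qs; apply: H; rewrite /segments /= inE qs orbT.
Qed.

Variables (V E : finType) (tail head : E -> V).
Hypothesis tail_head : forall e, tail e != head e.

Definition end_of (u : V) e := (u == tail e) || (u == head e).

Definition even_edge_set (Z : {set E}) :=
  forall u, ~~ odd #|[set f in Z | end_of u f]|.

(** Each vertex contributes [phi u] once for each of an even number of edges. *)
Lemma handshake (Z : {set E}) (phi : V -> bool) : even_edge_set Z ->
  \big[addb/false]_(f in Z) (phi (tail f) (+) phi (head f)) = false.
Proof.
move=> evZ.
have -> : \big[addb/false]_(f in Z) (phi (tail f) (+) phi (head f)) =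
    \big[addb/false]_(f in Z) \big[addb/false]_(u | end_of u f) phi u.
  apply: eq_bigr => f _.
  rewrite (bigD1 (tail f)) /end_of ?eqxx //= (bigD1 (head f)) /=; last first.
    by rewrite eqxx orbT eq_sym tail_head.
  rewrite big1 ?addbF // => u.
  by case: (u == tail f); case: (u == head f).
rewrite (exchange_big_dep predT) //= big1 // => u _.
rewrite (eq_bigl (fun f => f \in [set f in Z | end_of u f])) => [|f]; last by rewrite inE.
rewrite big_const; have := evZ u; move: #|_| => n evn.
transitivity (odd n && phi u); last by rewrite (negPf evn).
by elim: n {evn} => //= n ->; case: (odd n); case: (phi u).
Qed.

Variables (pos : V -> R * R) (fst_pt : E -> R * R) (rst : E -> seq (R * R)).

Let lst f := last (fst_pt f) (rst f).

Definition near (f : E) (u : V) := if u == tail f then fst_pt f else lst f.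

Hypothesis mid_mid : forall e f q q', e != f ->
  q \in segments (fst_pt e) (rst e) -> q' \in segments (fst_pt f) (rst f) ->
  ~ meet q.1 q.2 q'.1 q'.2.
Hypothesis spoke_mid : forall e f u q, e != f -> end_of u f ->
  q \in segments (fst_pt e) (rst e) -> ~ meet q.1 q.2 (pos u) (near f u).
Hypothesis spoke_spoke : forall e f u w, e != f -> u != w ->
  end_of u e -> end_of w f -> ~ meet (pos u) (near e u) (pos w) (near f w).
Hypothesis spoke_pos : forall e u, end_of u e -> near e u != pos u.
Hypothesis spoke_ray : forall e f u, e != f -> end_of u e -> end_of u f ->
  ~ same_ray (pos u) (near e u) (near f u).

(** The edge f is drawn as a straight spoke from its tail, a polygonal middle part and
a straight spoke to its head.  Middle parts may cross themselves; only
different edges have to be disjoint. *)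
Definition full f z : bool :=
  rcross z (pos (tail f)) (fst_pt f) (+) xpar z (fst_pt f) (rst f)
    (+) rcross z (lst f) (pos (head f)).

(** For an even set Z not containing e, the sum over Z tells whether e lies inside Z. *)
Definition side_parity e f := full f (fst_pt e).

(** The crossings of the ray from the vertex u with f, except for the spoke of f at u:
the sum over the edges f of an even set gives the position of u up to the terms
at u, which depend on the direction in which u is left. *)
Definition trunk_parity (u : V) f : bool :=
  ((u != tail f) && rcross (pos u) (pos (tail f)) (fst_pt f))
    (+) xpar (pos u) (fst_pt f) (rst f)
    (+) ((u != head f) && rcross (pos u) (lst f) (pos (head f))).

Definition local_parity (u : V) e f : bool :=
  rcross (near e u) (pos u) (near f u) (+) lcross (near f u) (pos u) (near e u).

Definition spoke_side (u : V) e : bool := upward (pos u) (near e u).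

Lemma local_parity_sym u e f : e != f -> end_of u e -> end_of u f ->
  local_parity u e f (+) local_parity u f e = ~~ (spoke_side u e (+) spoke_side u f).
Proof.
move=> ef ue uf; rewrite /local_parity rcross_lcross_center //; try exact: spoke_pos.
exact: spoke_ray.
Qed.

Lemma near_tail f : near f (tail f) = fst_pt f.
Proof. by rewrite /near eqxx. Qed.

Lemma near_head f : near f (head f) = lst f.
Proof. by rewrite /near eq_sym (negPf (tail_head f)). Qed.

Lemma end_tail f : end_of (tail f) f. Proof. by rewrite /end_of eqxx. Qed.
Lemma end_head f : end_of (head f) f. Proof. by rewrite /end_of eqxx orbT. Qed.

Lemma full_move f z z' :
    (forall q, q \in segments (fst_pt f) (rst f) -> ~ meet q.1 q.2 z z') ->
    ~ meet (pos (tail f)) (fst_pt f) z z' -> ~ meet (lst f) (pos (head f)) z z' ->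
  full f z (+) full f z' = lcross (pos (tail f)) z z' (+) lcross (pos (head f)) z z'.
Proof.
move=> H1 H2 H3; rewrite /full.
have := xpar_move H1; rewrite -/(lst f).
have := crossing_parity H2; have := crossing_parity H3.
move: (xpar _ _ _) (xpar _ _ _) (rcross _ _ _) (rcross _ _ _) (rcross _ _ _)
  (rcross _ _ _) (lcross _ _ _) (lcross _ _ _) (lcross _ _ _) (lcross _ _ _).
by do 10!case.
Qed.

(** Moving a point along a segment that avoids Z changes the parity for each edge of Z
by a term for each of its endpoints, and these cancel by [handshake]. *)
Lemma full_move_even (Z : {set E}) z z' : even_edge_set Z ->
    (forall f, f \in Z ->
      [/\ forall q, q \in segments (fst_pt f) (rst f) -> ~ meet q.1 q.2 z z',
         ~ meet (pos (tail f)) (fst_pt f) z z' & ~ meet (lst f) (pos (head f)) z z']) ->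
  \big[addb/false]_(f in Z) full f z = \big[addb/false]_(f in Z) full f z'.
Proof.
move=> evZ nm; apply: addb_eq; rewrite -big_split /=.
rewrite -[RHS](handshake (fun u => lcross (pos u) z z') evZ).
by apply: eq_bigr => f /nm[H1 H2 H3]; apply: full_move.
Qed.

(** The middle part of e avoids the other edges. *)
Lemma parity_along e (Z : {set E}) : even_edge_set Z -> e \notin Z ->
  \big[addb/false]_(f in Z) full f (fst_pt e) = \big[addb/false]_(f in Z) full f (lst e).
Proof.
move=> evZ eZ; rewrite /lst.
apply: (@segments_const bool (fun z => \big[addb/false]_(f in Z) full f z)) => q qe.
apply: full_move_even => // f fZ.
have ef : e != f by apply: contraNneq eZ => ->.
split.
- by move=> q' q'f /meetC; apply: mid_mid qe q'f.
- by move=> /meetC; rewrite -near_tail; apply: spoke_mid (end_tail f) qe.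
- by move=> /meet_swapl /meetC; rewrite -near_head; apply: spoke_mid (end_head f) qe.
Qed.

(** By [parity_along] the point may be taken at the end of the spoke of e at u, and it is
then moved along this spoke to u.  The spokes at u are met at u itself, and they
leave the local terms. *)
Theorem side_parity_local e u (Z : {set E}) : even_edge_set Z -> e \notin Z ->
    end_of u e ->
  \big[addb/false]_(f in Z) side_parity e f =
  \big[addb/false]_(f in Z) trunk_parity u f (+)
  \big[addb/false]_(f in Z | end_of u f) local_parity u e f.
Proof.
move=> evZ eZ ue.
have -> : \big[addb/false]_(f in Z) side_parity e f =
    \big[addb/false]_(f in Z) full f (near e u).
  by rewrite /near; case: ifP => // _; rewrite -parity_along.
(* The terms at the vertices other than u cancel over the even set Z. *)
pose phi w := (w != u) && lcross (pos w) (pos u) (near e u).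
have addphi (t : bool) : t = t (+) \big[addb/false]_(f in Z) (phi (tail f) (+) phi (head f)).
  by rewrite (handshake phi evZ) addbF.
rewrite big_mkcondr -big_split /= [RHS]addphi -big_split /=.
apply: eq_bigr => f fZ {addphi}.
have ef : e != f by apply: contraNneq eZ => ->.
have mids q : q \in segments (fst_pt f) (rst f) -> ~ meet q.1 q.2 (pos u) (near e u).
  by move=> qf; apply: (@spoke_mid f e) => //; rewrite eq_sym.
have spk w : end_of w f -> w != u -> ~ meet (pos w) (near f w) (pos u) (near e u).
  by move=> wf wu; apply: spoke_spoke => //; rewrite eq_sym.
have spk' w : end_of w f -> w != u -> ~ meet (near f w) (pos w) (pos u) (near e u).
  by move=> wf wu /meet_swapl; apply: spk.
have := xpar_move mids; rewrite -/(lst f) => X.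
have := spk (tail f) (end_tail f); have := spk' (head f) (end_head f).
rewrite near_tail near_head => H T; rewrite /full /trunk_parity /phi /local_parity /end_of.
move: (near e u) X H T {spk spk' mids phi} => y X H T.
have [tu|tu] := eqVneq u (tail f); [|have [hu|hu] := eqVneq u (head f)].
- have hu : head f != u by rewrite tu eq_sym tail_head.
  have := crossing_parity (H hu); move: X; rewrite tu near_tail -tu hu (eq_sym u) hu /=.
  move: (xpar _ _ _) (xpar _ _ _) (rcross _ _ _) (rcross _ _ _) (rcross _ _ _)
    (lcross _ _ _) (lcross _ _ _) (lcross _ _ _).
  by do 8!case.
- have {}tu : tail f != u by rewrite eq_sym.
  have := crossing_parity (T tu); move: X; rewrite hu near_head -hu (rcrossC y (pos u)) /=.
  move: (xpar _ _ _) (xpar _ _ _) (rcross _ _ _) (rcross _ _ _) (rcross _ _ _)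
    (lcross _ _ _) (lcross _ _ _) (lcross _ _ _).
  by do 8!case.
have {}tu : tail f != u by rewrite eq_sym.
have {}hu : head f != u by rewrite eq_sym.
have := crossing_parity (T tu); have := crossing_parity (H hu); move: X; rewrite /=.
move: (xpar _ _ _) (xpar _ _ _) (rcross _ _ _) (rcross _ _ _) (rcross _ _ _)
  (rcross _ _ _) (lcross _ _ _) (lcross _ _ _) (lcross _ _ _) (lcross _ _ _).
by do 10!case.
Qed.

End Polylines.

(** * Curves in the plane *)

Section Curves.
Variable R : realType.
Local Open Scope ring_scope.
Local Open Scope classical_set_scope.
Implicit Types (a b : R) (alpha beta : R -> R * R).

(** The arcs are only controlled on the unit interval; composing with this retraction makes
them continuous everywhere. *)
Definition clamp (t : R) : R := Num.max 0 (Num.min 1 t).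

Lemma clamp_in t : 0 <= clamp t <= 1.
Proof. by rewrite /clamp le_max lexx /= ge_max ler01 ge_min lexx. Qed.

Lemma clamp_id t : 0 <= t <= 1 -> clamp t = t.
Proof. by case/andP=> t0 t1; rewrite /clamp (min_idPr t1) (max_idPr t0). Qed.

Lemma clamp_continuous : continuous clamp.
Proof.
move=> t; apply: continuous_max; first exact: cvg_cst.
by apply: continuous_min; [exact: cvg_cst|exact: cvg_id].
Qed.

Lemma continuous_clamp alpha :
  {within `[0, 1], continuous alpha} -> continuous (alpha \o clamp).
Proof.
move=> /subspace_continuousP ca t.
have ct : `[0, 1] (clamp t) by rewrite /= in_itv /= clamp_in.
move=> W /(ca (clamp t) ct) /(clamp_continuous (x := t)) Wc.
have : \forall s \near t, `[0, 1] (clamp s) -> W (alpha (clamp s)) by exact: Wc.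
by apply: filterS => s; apply; rewrite /= in_itv /= clamp_in.
Qed.

Lemma norm_continuous_comp (T : topologicalType) (f g : T -> R * R) :
  continuous f -> continuous g -> continuous (fun t => `|f t - g t|).
Proof.
move=> cf cg t; apply: (@continuous_comp _ _ _ (fun t => f t - g t) Num.norm).
  by apply: continuousB; [exact: cf|exact: cg].
exact: norm_continuous.
Qed.

Lemma disjoint_curves_gap alpha beta a b a' b' :
    continuous alpha -> continuous beta -> a <= b -> a' <= b' ->
    (forall s t, a <= s <= b -> a' <= t <= b' -> alpha s != beta t) ->
  exists2 d : R, 0 < d & forall s t, a <= s <= b -> a' <= t <= b' ->
    d <= `|alpha s - beta t|.
Proof.
move=> ca cb ab ab' dis.
pose f (q : R * R) := `|alpha q.1 - beta q.2|.
have cf : continuous f.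
  apply: norm_continuous_comp => q.
    by apply: continuous_comp; [exact: cvg_fst|exact: ca].
  by apply: continuous_comp; [exact: cvg_snd|exact: cb].
have [|||[s t]] := @compact_EVT_min _ R f (`[a, b] `*` `[a', b']).
- by exists (a, a'); rewrite /= !in_itv /= !lexx ab ab'.
- by apply: compact_setX; exact: segment_compact.
- exact: continuous_subspaceT.
rewrite classical_sets.inE => -[]; rewrite /= !in_itv /= => sab tab fmin.
exists (f (s, t)); first by rewrite normr_gt0 subr_eq0 dis.
by move=> s' t' s'ab t'ab; apply: (fmin (s', t')); rewrite classical_sets.inE /= !in_itv.
Qed.

Lemma unif_continuous_curve alpha a b (d : R) : continuous alpha -> 0 < d ->
  exists2 m : R, 0 < m & forall s t, a <= s <= b -> a <= t <= b ->
    `|s - t| < m -> `|alpha s - alpha t| < d.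
Proof.
move=> ca d0; pose f (q : R * R) := `|alpha q.1 - alpha q.2|.
have cf : continuous f.
  apply: norm_continuous_comp => q.
    by apply: continuous_comp; [exact: cvg_fst|exact: ca].
  by apply: continuous_comp; [exact: cvg_snd|exact: ca].
pose K := (`[a, b] `*` `[a, b]) `&` f @^-1` [set x | d <= x].
have cK : compact K.
  apply: compact_closedI; first by apply: compact_setX; exact: segment_compact.
  by apply: closed_comp => [q _|]; [exact: cf|exact: closed_ge].
pose g (q : R * R) : R := `|q.1 - q.2|.
have cg : continuous g.
  by move=> q; apply: cvg_norm; apply: cvgB; [exact: cvg_fst|exact: cvg_snd].
have [K0|K0] := pselect (K !=set0); last first.
  exists 1 => // s t sab tab _; rewrite ltNge; apply/negP=> fd.
  by apply: K0; exists (s, t); rewrite /K /= !in_itv.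
have [[s t]] := compact_EVT_min K0 cK (continuous_subspaceT cg).
rewrite classical_sets.inE => -[[sab tab] dst] gmin; exists (g (s, t)).
  rewrite normr_gt0 subr_eq0 /=; apply: contraTneq d0 => st.
  by move: dst; rewrite /= st /f /= subrr normr0 -leNgt.
move=> s' t' s'ab t'ab; apply: contraTT; rewrite -!leNgt => dst'.
by apply: (gmin (s', t')); rewrite classical_sets.inE /K /= !in_itv.
Qed.

(** The maximum of the compact set of times in question; equality comes from the
intermediate value theorem. *)
Lemma last_visit (f : R -> R) a b r : continuous f -> a <= b -> f a <= r -> r < f b ->
  exists t, [/\ a <= t < b, f t = r & forall s, t < s <= b -> r < f s].
Proof.
move=> cf ab far rfb.
pose K := `[a, b] `&` f @^-1` [set x | x <= r].
have cK : compact K.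
  apply: compact_closedI; first exact: segment_compact.
  by apply: closed_comp => [q _|]; [exact: cf|exact: closed_le].
have K0 : K !=set0 by exists a; rewrite /K /= in_itv /= lexx.
have [|t] := @compact_EVT_max _ R id K K0 cK.
  by apply: continuous_subspaceT => t; exact: cvg_id.
rewrite classical_sets.inE => -[/=]; rewrite in_itv /= => /andP[at_ tb] ftr tmax.
have [||c cab fc] := @IVT R f t b r tb; first exact: continuous_subspaceT.
- by rewrite ge_min ftr /= le_max (ltW rfb) orbT.
have ct : c = t.
  apply/eqP; rewrite eq_le; move: cab; rewrite in_itv /= => /andP[tc cb]; rewrite tc andbT.
  by apply: tmax; rewrite classical_sets.inE /K /= in_itv /= fc lexx cb (le_trans at_ tc).
rewrite ct in fc; exists t; split=> //.
  by rewrite at_ lt_neqAle tb andbT; apply: contraTneq rfb => <-; rewrite fc ltxx.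
move=> s /andP[ts sb]; rewrite ltNge; apply/negP => fsr.
have : s <= t by apply: tmax; rewrite classical_sets.inE /K /= in_itv /= sb (le_trans at_ (ltW ts)).
by rewrite leNgt ts.
Qed.

Lemma first_visit (f : R -> R) a b r : continuous f -> a <= b -> r < f a -> f b <= r ->
  exists t, [/\ a < t <= b, f t = r & forall s, a <= s < t -> r < f s].
Proof.
move=> cf ab far rfb.
have cn : continuous (fun t => f (- t)).
  by move=> t; apply: (@continuous_comp _ _ _ -%R f); [exact: opp_continuous|exact: cf].
have [|||t [tab ft tmax]] := @last_visit _ (- b) (- a) r cn; rewrite ?lerN2 ?opprK //.
exists (- t); split=> //; first by lra.
by move=> s sat; have := tmax (- s); rewrite opprK; apply; lra.
Qed.

End Curves.

(** * From arcs to polygonal lines *)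

Section SpokeGeometry.
Variable R : realType.
Local Open Scope ring_scope.
Implicit Types a b z : R * R.

Lemma alongE a b (s : R) : along a b s = a + s *: (b - a).
Proof. by []. Qed.

Lemma along_dist a b (s : R) : 0 <= s -> `|along a b s - a| = s * `|b - a|.
Proof. by move=> s0; rewrite alongE addrC addKr normrZ ger0_norm. Qed.

Lemma along_dist_le a b (s : R) : 0 <= s <= 1 -> `|along a b s - a| <= `|b - a|.
Proof. by case/andP=> s0 s1; rewrite along_dist // ler_piMl. Qed.

Lemma along_continuous a b : continuous (along a b).
Proof.
move=> s; have -> : along a b = (fun s => a + s *: (b - a)) by apply/funext.
by apply: cvgD; [exact: cvg_cst|exact: scalel_continuous].
Qed.

Lemma common_lower_bound (I : finType) (d : I -> R) :
  (forall i, 0 < d i) -> exists2 m : R, 0 < m & forall i, m <= d i.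
Proof.
move=> d0; exists (\big[Num.min/1]_i d i); last by move=> i; apply: bigmin_le_cond.
by apply: lt_bigmin.
Qed.

Lemma segments_mesh (F : nat -> R * R) k n q :
  q \in segments (F k) [seq F i | i <- iota k.+1 n] ->
  exists2 i, (k <= i < k + n)%N & q = (F i, F i.+1).
Proof.
elim: n k => //= n IHn k; rewrite /segments /= inE => /predU1P[->|/IHn[i ki ->]].
  by exists k => //; lia.
by exists i => //; lia.
Qed.

End SpokeGeometry.
Section PolygonalDrawing.
Variables (R : realType) (G : sgraph).
Local Open Scope ring_scope.

Lemma edge_endpoints (e : edge G) (x y : G) : val e = [set x; y] -> adj x y.
Proof.
case: e => A /= + AE; rewrite AE inE => /existsP[u /existsP[w /andP[uw /eqP E]]].
have: (u \in [set x; y]) && (w \in [set x; y]) by rewrite E !inE !eqxx orbT.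
rewrite !inE => /andP[/orP[]/eqP eu /orP[]/eqP ew]; move: uw; rewrite eu ew ?adj_irr //.
by rewrite adj_sym.
Qed.

Variables (p : G -> R * R) (gamma : edge G -> R -> R * R).
Hypothesis drawing : plane_drawing p gamma.

Let g e := gamma e \o clamp (R := R).

Lemma arc_continuous e : continuous (g e).
Proof. exact: continuous_clamp (@drawing_arc_continuous _ _ _ _ drawing e). Qed.

Lemma oriented_ends : exists tail head : edge G -> G, forall e,
  [/\ val e = [set tail e; head e], tail e != head e,
      g e 0 = p (tail e) & g e 1 = p (head e)].
Proof.
have /choice[xy xyP] : forall e, exists xy : G * G,
    [/\ val e = [set xy.1; xy.2], gamma e 0 = p xy.1 & gamma e 1 = p xy.2].
  by move=> e; have [x [y ?]] := drawing_arc_ends drawing e; exists (x, y).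
exists (fun e => (xy e).1), (fun e => (xy e).2) => e; have [E e0 e1] := xyP e.
split=> //.
- by apply: contraTneq (edge_endpoints E) => ->; rewrite adj_irr.
- by rewrite /g /= clamp_id // lexx ler01.
- by rewrite /g /= clamp_id // lexx ler01.
Qed.

Variables tail head : edge G -> G.
Hypothesis endsP : forall e,
  [/\ val e = [set tail e; head e], tail e != head e,
      g e 0 = p (tail e) & g e 1 = p (head e)].

Lemma arc_avoids e u t : 0 <= t <= 1 -> ~~ end_of tail head u e -> g e t != p u.
Proof.
move=> t01 /norP[ut uh]; have [_ _ e0 e1] := endsP e.
have [->|t0] := eqVneq t 0.
  by rewrite e0; apply: contraNneq ut => /(drawing_vertex_inj drawing) ->.
have [->|t1] := eqVneq t 1.
  by rewrite e1; apply: contraNneq uh => /(drawing_vertex_inj drawing) ->.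
rewrite /g /= clamp_id //; apply/eqP/(drawing_arc_vertex drawing).
by case/andP: t01 => *; rewrite in_itv /= !lt_neqAle eq_sym t0 t1 /=; apply/andP.
Qed.

Lemma arcs_disjoint e f s t : e != f -> 0 < s < 1 -> 0 < t < 1 -> g e s != g f t.
Proof.
move=> ef s01 t01; rewrite /g /= !clamp_id; try by lra.
by apply/eqP/(drawing_arc_arc drawing ef); rewrite in_itv /=.
Qed.

(** A common radius for disjoint discs around the vertices, each meeting only the arcs
that end at its centre. *)
Lemma vertex_radius : exists r : R, [/\ 0 < r,
  forall u w, u != w -> 2 * r < `|p u - p w| &
  forall e u t, ~~ end_of tail head u e -> 0 <= t <= 1 -> r < `|g e t - p u|].
Proof.
have /choice[d1 d1P] : forall uw : G * G, exists d : R,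
    0 < d /\ (uw.1 != uw.2 -> d <= `|p uw.1 - p uw.2|).
  move=> [u w] /=; have [->|uw] := eqVneq u w; first by exists 1.
  exists `|p u - p w|; split=> //; rewrite normr_gt0 subr_eq0.
  by apply: contra_neq uw => /(drawing_vertex_inj drawing).
have /choice[d2 d2P] : forall eu : edge G * G, exists d : R, 0 < d /\
    (~~ end_of tail head eu.2 eu.1 -> forall t, 0 <= t <= 1 ->
       d <= `|g eu.1 t - p eu.2|).
  move=> [e u] /=; have [ue|ue] := boolP (end_of tail head u e).
    by exists 1.
  have [|||||d d0 dP] := @disjoint_curves_gap R (g e) (fun=> p u) 0 1 0 0 => //.
  - exact: arc_continuous.
  - exact: cst_continuous.
  - by move=> s t s01 _; apply: arc_avoids.
  by exists d; split=> // _ t t01; apply: (dP t 0) => //; rewrite lexx.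
have [m1 m10 m1P] := common_lower_bound (fun uw => (d1P uw).1).
have [m2 m20 m2P] := common_lower_bound (fun eu => (d2P eu).1).
(* Half of the minimum would leave equality possible. *)
exists (Num.min m1 m2 / 3); split.
- by rewrite divr_gt0 // lt_min m10.
- move=> u w uw; apply: lt_le_trans ((d1P (u, w)).2 uw).
  apply: lt_le_trans (m1P _); have : Num.min m1 m2 <= m1 by rewrite ge_min lexx.
  lra.
- move=> e u t ue t01; apply: lt_le_trans ((d2P (e, u)).2 ue t t01).
  apply: lt_le_trans (m2P _).
  have : Num.min m1 m2 <= m2 by rewrite ge_min lexx orbT.
  have : 0 < Num.min m1 m2 by rewrite lt_min m10.
  lra.
Qed.

(** The part of an arc between the last exit from the disc of its tail and the first
entry afterwards into the disc of its head.  It avoids the interiors of all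
discs, so that it can be completed by straight spokes inside the two discs. *)
Lemma arc_core r : 0 < r -> (forall u w, u != w -> 2 * r < `|p u - p w|) ->
    (forall e u t, ~~ end_of tail head u e -> 0 <= t <= 1 -> r < `|g e t - p u|) ->
  forall e, exists ab : R * R,
    [/\ 0 < ab.1 < ab.2, ab.2 < 1, `|g e ab.1 - p (tail e)| = r,
        `|g e ab.2 - p (head e)| = r &
        forall u t, ab.1 <= t <= ab.2 -> r <= `|g e t - p u|].
Proof.
move=> r0 sep far e; have [_ th e0 e1] := endsP e.
have dist_cont u : continuous (fun t => `|g e t - p u|).
  by apply: norm_continuous_comp; [exact: arc_continuous|exact: cst_continuous].
have [||a [a01 fa aP]] := last_visit (dist_cont (tail e)) ler01 (r := r).
- by rewrite e0 subrr normr0 ltW.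
- by rewrite e1 distrC; have := sep _ _ th; lra.
have h1 : `|g e 1 - p (head e)| <= r by rewrite e1 subrr normr0 ltW.
have ha : r < `|g e a - p (head e)|.
  have := sep _ _ th; have := ler_distD (g e a) (p (tail e)) (p (head e)).
  by rewrite [in X in _ <= X + _]distrC fa; lra.
have [|b [b01 fb bP]] := first_visit (dist_cont (head e)) _ ha h1; first by lra.
have a0 : a != 0.
  by apply: contraTneq r0 => a0; move: fa; rewrite a0 e0 subrr normr0 => <-; rewrite ltxx.
have b1 : b != 1.
  by apply: contraTneq r0 => b1; move: fb; rewrite b1 e1 subrr normr0 => <-; rewrite ltxx.
exists (a, b); split=> //=.
- by rewrite lt_neqAle eq_sym a0; lra.
- by rewrite lt_neqAle b1; lra.
move=> u t tab; have [|ue] := boolP (end_of tail head u e); last by apply/ltW/far => //; lra.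
case/orP=> /eqP ->.
- have [->|ta] := eqVneq t a; first by rewrite fa.
  by apply/ltW/aP; rewrite lt_neqAle eq_sym ta; lra.
- have [->|tb] := eqVneq t b; first by rewrite fb.
  by apply/ltW/bP; rewrite [t < b]lt_neqAle tb; lra.
Qed.

End PolygonalDrawing.
Section PlanarParity.
Variables (R : realType) (G : sgraph).
Local Open Scope ring_scope.

Lemma segment_near (x y z z' : R * R) (d : R) : `|x - y| < d -> forall s t,
  0 <= s <= 1 -> along x y s = along z z' t -> `|x - along z z' t| < d.
Proof.
move=> xy s t s01 <-; apply: le_lt_trans xy; rewrite distrC (distrC x y).
exact: along_dist_le.
Qed.

(** Every arc is replaced by a spoke, a polygonal line through finely spaced points of
its core, and a spoke.  The cores of different edges have a positive distance,
and so do a core and the spokes of other edges; a mesh of a third of the least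
of these distances keeps the polygonal lines disjoint.  Spokes in different
discs are disjoint, and those in the same disc have different directions, since
they end at different points of its boundary. *)
Theorem planar_parity : planar R G ->
  exists (tail head : edge G -> G),
    (forall e, val e = [set tail e; head e] /\ tail e != head e) /\
  exists (side : edge G -> edge G -> bool) (trunk : G -> edge G -> bool)
    (loc : G -> edge G -> edge G -> bool) (up : G -> edge G -> bool),
    (forall u e (Z : {set edge G}), even_edge_set tail head Z -> e \notin Z ->
       end_of tail head u e ->
       \big[addb/false]_(f in Z) side e f =
       \big[addb/false]_(f in Z) trunk u f (+)
       \big[addb/false]_(f in Z | end_of tail head u f) loc u e f) /\
    (forall u e f, e != f -> end_of tail head u e -> end_of tail head u f ->
       loc u e f (+) loc u f e = ~~ (up u e (+) up u f)).
Proof.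
move=> [p [gamma drawing]].
have [tail [head endsP]] := oriented_ends drawing.
pose g e := gamma e \o clamp (R := R).
have cg e : continuous (g e) := @arc_continuous R G p gamma drawing e.
have [r [r0 sep far]] := vertex_radius drawing endsP.
have [core coreP] := choice (arc_core drawing endsP r0 sep far).
pose a e := (core e).1; pose b e := (core e).2.
pose spoke f u : R * R := if u == tail f then g f (a f) else g f (b f).
have spoke_tail f : spoke f (tail f) = g f (a f) by rewrite /spoke eqxx.
have spoke_head f : spoke f (head f) = g f (b f).
  by rewrite /spoke eq_sym; have [_ /negPf -> _ _] := endsP f.
have core01 e t : a e <= t <= b e -> 0 < t < 1.
  by move=> t_ab; have [? ? _ _ _] := coreP e; rewrite /a /b in t_ab; lra.
have ab e : a e < b e by have [/andP[_ ?] _ _ _ _] := coreP e.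
have spoke_r f u : end_of tail head u f -> `|spoke f u - p u| = r.
  have [_ _ ft fh _] := coreP f.
  by case/orP=> /eqP ->; rewrite ?spoke_tail ?spoke_head.
have spoke_core f u : exists2 t, a f <= t <= b f & spoke f u = g f t.
  rewrite /spoke; case: ifP => _; [exists (a f)|exists (b f)] => //; have := ab f; lra.
have coresD e f s t : e != f -> a e <= s <= b e -> a f <= t <= b f -> g e s != g f t.
  by move=> ef sab tab; apply: (arcs_disjoint drawing) (core01 _ _ sab) (core01 _ _ tab).
have /choice[d dP] : forall efu : edge G * edge G * G, exists d : R, 0 < d /\
   (efu.1.1 != efu.1.2 ->
      (forall s t, a efu.1.1 <= s <= b efu.1.1 -> a efu.1.2 <= t <= b efu.1.2 ->
         d <= `|g efu.1.1 s - g efu.1.2 t|) /\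
      (end_of tail head efu.2 efu.1.2 ->
       forall s t, a efu.1.1 <= s <= b efu.1.1 -> 0 <= t <= 1 ->
         d <= `|g efu.1.1 s - along (p efu.2) (spoke efu.1.2 efu.2) t|)).
  move=> [[e f] u] /=; have [->|ef] := eqVneq e f; first by exists 1.
  have [|d1 d10 d1P] := disjoint_curves_gap (cg e) (cg f) (ltW (ab e)) (ltW (ab f)).
    by move=> s t; apply: coresD.
  have [uf|uf] := boolP (end_of tail head u f); last by exists d1.
  have [|d2 d20 d2P] := disjoint_curves_gap (cg e)
    (@along_continuous R (p u) (spoke f u)) (ltW (ab e)) ler01.
    move=> s t sab t01.
    have rs : r <= `|g e s - p u| by have [_ _ _ _] := coreP e; apply.
    have [->|t1] := eqVneq t 1.
      have -> : along (p u) (spoke f u) 1 = spoke f u by rewrite alongE scale1r addrC subrK.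
      by have [t' t'ab ->] := spoke_core f u; apply: coresD.
    apply: contraTneq rs => ->; rewrite -ltNge along_dist ?spoke_r //; last by case/andP: t01.
    by rewrite gtr_pMl // lt_neqAle t1; case/andP: t01.
  exists (Num.min d1 d2); split; first by rewrite lt_min d10.
  move=> _; split=> [s t sab tab|_ s t sab t01]; rewrite ge_min.
    by rewrite d1P.
  by rewrite d2P ?orbT.
have [dl dl0 dlP] := common_lower_bound (fun efu => (dP efu).1).
have gap_cores e f s t : e != f -> a e <= s <= b e -> a f <= t <= b f ->
    dl <= `|g e s - g f t|.
  move=> ef sab tab; apply: le_trans (dlP (e, f, tail e)) _.
  by apply: ((dP (e, f, tail e)).2 ef).1.
have gap_spoke e f u s t : e != f -> end_of tail head u f -> a e <= s <= b e ->
    0 <= t <= 1 -> dl <= `|g e s - along (p u) (spoke f u) t|.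
  move=> ef uf sab t01; apply: le_trans (dlP (e, f, u)) _.
  by apply: ((dP (e, f, u)).2 ef).2.
have dl3 : 0 < dl / 3 by rewrite divr_gt0.
(* The times for i = 0, ..., n + 1 divide the core into n + 1 equal steps. *)
pose time e n (i : nat) := a e + i%:R * ((b e - a e) / n.+1%:R).
have time_in e n i : (i <= n.+1)%N -> a e <= time e n i <= b e.
  move=> iN; have bma : 0 < b e - a e by rewrite subr_gt0.
  have q0 : 0 < (b e - a e) / n.+1%:R by rewrite divr_gt0 ?ltr0n.
  rewrite lerDl mulr_ge0 ?ler0n ?(ltW q0) //= -lerBrDl mulrCA ger_pMr //.
  by rewrite ler_pdivrMr ?ltr0n // mul1r ler_nat.
have /choice[N NP] : forall e, exists n : nat, forall i, (i < n.+1)%N ->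
    `|g e (time e n i) - g e (time e n i.+1)| < dl / 3.
  move=> e; have [m m0 mP] := @unif_continuous_curve R (g e) (a e) (b e) _ (cg e) dl3.
  have bma : 0 < b e - a e by rewrite subr_gt0.
  pose n := Num.Def.archi_bound ((b e - a e) / m).
  have nm : (b e - a e) / n.+1%:R < m.
    have : (b e - a e) / m < n%:R by apply: archi_boundP; rewrite divr_ge0 // ltW.
    rewrite ltr_pdivrMr // ltr_pdivrMr ?ltr0n // -natr1 => H.
    by rewrite mulrDr mulr1 mulrC; apply: lt_trans H _; rewrite ltrDl.
  exists n => i ltin.
  apply: mP; rewrite ?time_in // 1?ltnW //.
  rewrite /time; set q := (b e - a e) / _ in nm *.
  have -> : a e + i%:R * q - (a e + i.+1%:R * q) = - q by rewrite -natr1; ring.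
  by rewrite normrN gtr0_norm // divr_gt0 ?ltr0n.
pose tau e := time e (N e).
have tau0 e : tau e 0%N = a e by rewrite /tau /time mul0r addr0.
have tauN e : tau e (N e).+1 = b e.
  by rewrite /tau /time mulrC divfK ?pnatr_eq0 // addrC subrK.
pose F e i := g e (tau e i).
pose rst e := [seq F e i | i <- iota 1 (N e).+1].
have nearE f u : near tail (F^~ 0%N) rst f u = spoke f u.
  rewrite /near /spoke; case: ifP => _; first by rewrite /F tau0.
  rewrite /rst last_map (_ : last _ _ = (N f).+1) ?tauN //; first by rewrite /F tauN.
  by rewrite -nth_last size_iota nth_iota.
have segP e q : q \in segments (F e 0%N) (rst e) -> exists2 s, a e <= s <= b e &
    exists2 s', a e <= s' <= b e & q = (g e s, g e s') /\ `|g e s - g e s'| < dl / 3.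
  move=> /segments_mesh[i /andP[_ iN] ->]; exists (tau e i); first by apply: time_in; lia.
  exists (tau e i.+1); first by apply: time_in; lia.
  by split=> //; apply: (NP e i); lia.
have th e : tail e != head e by have [] := endsP e.
exists tail, head; split; first by move=> e; have [? ? _ _] := endsP e.
exists (side_parity tail head p (F^~ 0%N) rst), (trunk_parity tail head p (F^~ 0%N) rst),
  (local_parity tail p (F^~ 0%N) rst), (spoke_side tail p (F^~ 0%N) rst).
have mid_mid e f q q' : e != f -> q \in segments (F e 0%N) (rst e) ->
    q' \in segments (F f 0%N) (rst f) -> ~ meet q.1 q.2 q'.1 q'.2.
  move=> ef /segP[s sab [s' _ [-> ss']]] /segP[t tab [t' _ [-> tt']]] /= [x [y [x01 y01 E]]].
  have := gap_cores _ _ _ _ ef sab tab.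
  have H1 := segment_near ss' x01 E; have H2 := @along_dist_le R (g f t) (g f t') y y01.
  rewrite [X in _ <= X]distrC in H2.
  by have := ler_distD (along (g f t) (g f t') y) (g e s) (g f t); lra.
have spoke_mid e f u q : e != f -> end_of tail head u f ->
    q \in segments (F e 0%N) (rst e) -> ~ meet q.1 q.2 (p u) (near tail (F^~ 0%N) rst f u).
  move=> ef uf /segP[s sab [s' _ [-> ss']]] /= [x [y [x01 y01 E]]]; rewrite nearE in E.
  have := gap_spoke _ _ _ _ _ ef uf sab y01; have := segment_near ss' x01 E; lra.
have spoke_spoke e f u w : e != f -> u != w -> end_of tail head u e ->
    end_of tail head w f -> ~ meet (p u) (near tail (F^~ 0%N) rst e u)
      (p w) (near tail (F^~ 0%N) rst f w).
  move=> ef uw ue wf [x [y [x01 y01]]]; rewrite !nearE => E.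
  have := sep _ _ uw; have := ler_distD (along (p u) (spoke e u) x) (p u) (p w).
  have := along_dist_le (p u) (spoke e u) x01; have := along_dist_le (p w) (spoke f w) y01.
  by rewrite -E !spoke_r // (distrC (p u) (along _ _ _)); lra.
have spoke_pos e u : end_of tail head u e -> near tail (F^~ 0%N) rst e u != p u.
  by move=> ue; rewrite nearE -subr_eq0 -normr_gt0 spoke_r.
have spoke_ray e f u : e != f -> end_of tail head u e -> end_of tail head u f ->
    ~ same_ray (p u) (near tail (F^~ 0%N) rst e u) (near tail (F^~ 0%N) rst f u).
  move=> ef ue uf; rewrite !nearE => -[k k0 E].
  have k1 : k = 1.
    have := @along_dist R (p u) (spoke e u) k (ltW k0); rewrite -E !spoke_r // => kr.
    by apply: (@mulIf _ r); rewrite ?gt_eqF // -kr mul1r.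
  have [s sab Es] := spoke_core e u; have [t tab Et] := spoke_core f u.
  have /eqP[] := coresD _ _ _ _ ef sab tab; rewrite -Es -Et E k1 alongE scale1r.
  by rewrite addrC subrK.
split=> [u e Z evZ eZ ue|u e f ef ue uf].
  exact: (side_parity_local th mid_mid spoke_mid spoke_spoke).
exact: (@local_parity_sym _ _ _ tail head).
Qed.

End PlanarParity.

(** * A short even edge set from the parities *)

Lemma card3P (T : finType) (A : {set T}) : #|A| = 3 ->
  exists x y z, [/\ x != y, y != z, x != z & A = [set x; y; z]].
Proof.
move=> A3; have : size (enum A) = 3 by rewrite -cardE.
have := enum_uniq A; have := mem_enum A.
case: (enum A) => [|x [|y [|z []]]] // mA; rewrite /= !inE negb_or !andbT -andbA.
case/and3P=> xy xz yz _; exists x, y, z; split=> //.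
by apply/setP=> t; rewrite -mA !inE orbA.
Qed.

Section LinearAlgebraF2.
Local Open Scope ring_scope.

Lemma F2_cases (x : 'F_2) : x = 0 \/ x = 1.
Proof. by case: x => -[|[|//]] lt; [left|right]; apply: val_inj. Qed.

Lemma F2_addxx (d : nat) (u : 'cV['F_2]_d) : u + u = 0.
Proof.
apply/matrixP=> i j; rewrite !mxE; have [->|->] := F2_cases (u i j).
  by rewrite addr0.
exact: val_inj.
Qed.

Lemma F2_addb (s t : bool) : ((s (+) t)%:R : 'F_2) = s%:R + t%:R.
Proof. by case: s; case: t; rewrite ?addr0 ?add0r //; apply: val_inj. Qed.

Lemma F2_big (I : finType) (P : pred I) (s : I -> bool) :
  ((\big[addb/false]_(i | P i) s i)%:R : 'F_2) = \sum_(i | P i) (s i)%:R.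
Proof.
apply: (big_morph (fun s : bool => s%:R : 'F_2)) => //; exact: F2_addb.
Qed.

(** Such a u lies on the line spanned by c, and the field has only the scalars 0 and 1. *)
Lemma functional_multiple (d : nat) (c u : 'cV['F_2]_d) :
    (forall y : 'rV_d, y *m c = 0 -> y *m u = 0) -> u = 0 \/ u = c.
Proof.
move=> H; have : (u^T <= c^T)%MS.
  rewrite submxE; apply/eqP; apply: trmx_inj; rewrite trmx_mul trmxK trmx0.
  have : (cokermx c^T)^T *m c = 0 by rewrite -[c in _ *m c]trmxK -trmx_mul mulmx_coker trmx0.
  move: (_^T) => Y Yc; apply/row_matrixP=> i; rewrite row_mul row0; apply: H.
  by rewrite -row_mul Yc row0.
case/sub_rVP=> l E; have {E}-> : u = l *: c by apply: trmx_inj; rewrite linearZ.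
by have [->|->] := F2_cases l; rewrite ?scale0r ?scale1r; [left|right].
Qed.

End LinearAlgebraF2.

Section Faces.
Local Open Scope ring_scope.

(** The three edges at a cubic vertex are represented by functionals c1, c2 and c3 with
sum 0, and the faces at the vertex, up to translation, by 0, c1, c2 and c3.  The
number t i tells which two of these lie along edge i, and the parity condition
expresses a consistent cyclic order; then every face lies along an even number
of the edges. *)
Lemma three_sides_even (d : nat) (c1 c2 c3 x : 'cV['F_2]_d) (t1 t2 t3 : bool) :
    c1 + c2 + c3 = 0 -> t1 (+) t2 (+) t3 ->
  ((c1 != 0) && (if t1 then (x == c2) || (x == c3) else (x == 0) || (x == c1)))
  (+) ((c2 != 0) && (if t2 then (x == c1) || (x == c3) else (x == 0) || (x == c2)))
  (+) ((c3 != 0) && (if t3 then (x == c1) || (x == c2) else (x == 0) || (x == c3)))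
  = false.
Proof.
move=> c0 todd.
have c3E : c3 = c1 + c2.
  by rewrite -[LHS]add0r -(F2_addxx (c1 + c2)) -addrA c0 addr0.
have [c10|c10] := eqVneq c1 0.
  have c23 : c3 = c2 by rewrite c3E c10 add0r.
  rewrite c23 c10; case: (c2 != 0); by move: todd; case: t1; case: t2; case: t3 => //= _; case: (x == 0); case: (x == c2).
have [c20|c20] := eqVneq c2 0.
  have c13 : c3 = c1 by rewrite c3E c20 addr0.
  rewrite c13 c20 c10; by move: todd; case: t1; case: t2; case: t3 => //= _; case: (x == 0); case: (x == c1).
have [c30|c30] := eqVneq c3 0.
  have c12 : c2 = c1 by rewrite -[LHS]add0r -(F2_addxx c1) -addrA -c3E c30 addr0.
  rewrite c12 c30; by move: todd; case: t1; case: t2; case: t3 => //= _; case: (x == 0); case: (x == c1).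
have c12 : c1 != c2 by apply: contraNneq c30 => c12; rewrite c3E c12 F2_addxx.
have c13 : c1 != c3 by apply: contraNneq c20 => c13; rewrite -[c2]add0r -(F2_addxx c1) -addrA -c3E -c13 F2_addxx.
have c23 : c2 != c3 by apply: contraNneq c10 => c23; rewrite -[c1]addr0 -(F2_addxx c2) addrA -c3E -c23 F2_addxx.
have excl u w : u != w -> ~~ ((x == u) && (x == w)).
  by apply: contraNN => /andP[/eqP <-].
move: (excl _ _ c12) (excl _ _ c13) (excl _ _ c23) (excl _ _ c10) (excl _ _ c20) (excl _ _ c30).
by move: todd; case: t1; case: t2; case: t3 => //= _; case: (x == 0); case: (x == c1); case: (x == c2); case: (x == c3).
Qed.

End Faces.

(** The data are those provided by [planar_parity], and F is the edge set of a cubic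
subgraph on S. *)
Section ShortEvenSets.
Variables (V E : finType) (tail head : E -> V).
Hypothesis tail_head : forall e, tail e != head e.
Local Notation end_of := (end_of tail head).
Local Notation even_edge_set := (even_edge_set tail head).
Variables (side : E -> E -> bool) (trunk : V -> E -> bool).
Variables (loc : V -> E -> E -> bool) (up : V -> E -> bool).
Hypothesis side_local : forall u e (Z : {set E}), even_edge_set Z -> e \notin Z ->
  end_of u e ->
  \big[addb/false]_(f in Z) side e f =
  \big[addb/false]_(f in Z) trunk u f (+)
  \big[addb/false]_(f in Z | end_of u f) loc u e f.
Hypothesis loc_sym : forall u e f, e != f -> end_of u e -> end_of u f ->
  loc u e f (+) loc u f e = ~~ (up u e (+) up u f).
Variables (S : {set V}) (F : {set E}).
Hypothesis S_neq0 : S != set0.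
Hypothesis F_ends : forall e u, e \in F -> end_of u e -> u \in S.
Hypothesis S_cubic : forall u, u \in S -> #|[set e in F | end_of u e]| = 3.
Local Open Scope ring_scope.

Let m := #|F|.
Let n := #|S|.
Let ev (i : 'I_m) : E := enum_val i.
Let vx (j : 'I_n) : V := enum_val j.
Let incidence : 'M['F_2]_(m, n) := \matrix_(i, j) (end_of (vx j) (ev i))%:R.
Let d := \rank (kermx incidence).
Let B : 'M['F_2]_(d, m) := row_base (kermx incidence).

Let ev_inj : injective ev. Proof. exact: enum_val_inj. Qed.

Lemma card_edges : (2 * m = 3 * n)%N.
Proof.
transitivity (\sum_(e in F) \sum_(u in S | end_of u e) 1)%N.
  rewrite (eq_bigr (fun=> 2%N)) ?sum_nat_const 1?mulnC // => e eF.
  have <- : #|[set tail e; head e]| = 2%N by rewrite cards2 tail_head.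
  rewrite sum1dep_card; apply: eq_card => u; rewrite !inE.
  by apply/andP/idP => [[_]//|ue]; split=> //; apply: F_ends eF ue.
rewrite (exchange_big_dep (mem S)) /=; last by move=> e u _ /andP[].
rewrite (eq_bigr (fun=> 3%N)) ?sum_nat_const 1?mulnC // => u uS.
rewrite sum1dep_card -(S_cubic uS); apply: eq_card => e.
by rewrite !inE uS.
Qed.

Lemma sum_ends (phi : V -> 'F_2) i :
  \sum_(u in S) (end_of u (ev i))%:R * phi u = phi (tail (ev i)) + phi (head (ev i)).
Proof.
have eF : ev i \in F by exact: enum_valP.
rewrite (bigD1 (tail (ev i))) /=; last by apply: (F_ends eF); rewrite end_tail.
rewrite (bigD1 (head (ev i))) /=; last first.
  by rewrite eq_sym tail_head andbT; apply: (F_ends eF); rewrite end_head.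
rewrite end_tail end_head !mul1r addrA big1 ?addr0 // => u /andP[/andP[_ ut] uh].
by rewrite /end_of (negPf ut) (negPf uh) mul0r.
Qed.

(** The incidence matrix has rank less than n, because each of its rows has exactly
two entries 1, so that the vector of ones is in the kernel. *)
Lemma cycle_dim : (m < d + n)%N.
Proof.
have n0 : (0 < n)%N by rewrite card_gt0.
pose c : 'cV['F_2]_n := const_mx 1.
have r0 : incidence *m c = 0.
  apply/matrixP=> i k; rewrite !mxE.
  transitivity (\sum_(u in S) (end_of u (ev i))%:R * (1 : 'F_2)).
    by rewrite [RHS]big_enum_val; apply: eq_bigr => j _; rewrite !mxE.
  by rewrite sum_ends; apply: val_inj.
have : (c^T <= kermx incidence^T)%MS by apply/sub_kermxP; rewrite -trmx_mul r0 trmx0.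
move/mxrankS; rewrite rank_rV mxrank_ker mxrank_tr.
have -> : c^T != 0.
  apply/eqP=> /matrixP/(_ 0 (Ordinal n0)); rewrite !mxE => /eqP; by rewrite oner_eq0.
rewrite /d mxrank_ker; have := rank_leq_row incidence; rewrite /= -/m; lia.
Qed.

Let supp (z : 'rV['F_2]_m) : {set E} := ev @: [set i | z 0 i != 0].

Lemma supp_sub z : supp z \subset F.
Proof. by apply/subsetP=> _ /imsetP[i _ ->]; apply: enum_valP. Qed.

Lemma mem_supp z i : (ev i \in supp z) = (z 0 i != 0).
Proof. by rewrite mem_imset ?inE. Qed.

Lemma supp_parity (z : 'rV_m) (phi : E -> bool) :
  ((\big[addb/false]_(f in supp z) phi f)%:R : 'F_2) = \sum_i z 0 i * (phi (ev i))%:R.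
Proof.
rewrite F2_big big_imset /=; last by move=> i k _ _; apply: ev_inj.
rewrite [RHS](bigID (fun i => z 0 i != 0)) /= [X in _ = _ + X]big1 ?addr0; last first.
  by move=> i; case: eqP => // -> _; rewrite mul0r.
apply: eq_big => [i|i]; rewrite inE // => zi.
by have [z0|->] := F2_cases (z 0 i); [rewrite z0 eqxx in zi | rewrite mul1r].
Qed.

Lemma supp_even z : z *m incidence = 0 -> even_edge_set (supp z).
Proof.
move=> z0 u; have [uS|uS] := boolP (u \in S); last first.
  rewrite (_ : [set _ in _ | _] = set0) ?cards0 //; apply/setP=> f; rewrite !inE.
  apply/negP=> /andP[/(subsetP (supp_sub z)) fF uf]; case/negP: uS.
  exact: F_ends fF uf.
have -> : odd #|[set f in supp z | end_of u f]| = \big[addb/false]_(f in supp z) end_of u f.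
  rewrite -sum1dep_card big_mkcondr /=.
  rewrite (big_morph odd oddD (erefl _)) /=.
  by apply: eq_bigr => f _; case: (end_of u f).
have : (z *m incidence) 0 (enum_rank_in uS u) = 0 by rewrite z0 mxE.
have incE i : incidence i (enum_rank_in uS u) = (end_of u (ev i))%:R.
  by rewrite mxE /vx enum_rankK_in.
rewrite mxE (eq_bigr (fun i => z 0 i * (end_of u (ev i))%:R)) => [|i _]; last first.
  by rewrite incE.
by rewrite -supp_parity; case: (\big[_/_]_(_ in _) _).
Qed.

Let chain (y : 'rV['F_2]_d) : 'rV_m := y *m B.

Lemma chain_cycle y : chain y *m incidence = 0.
Proof. by apply/sub_kermxP; rewrite -(eq_row_base (kermx incidence)) submxMl. Qed.

Let cochain (phi : E -> bool) : 'cV['F_2]_d := B *m \col_k (phi (ev k))%:R.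

(** A column of size d is a functional on the cycle space through its values on the basis
B; [cochain phi] is the functional that sums phi over the support of a cycle. *)
Lemma cochain_eval y phi :
  (y *m cochain phi) 0 0 = (\big[addb/false]_(f in supp (chain y)) phi f)%:R.
Proof.
by rewrite supp_parity mulmxA mxE; apply: eq_bigr => i _; rewrite [in X in _ * X]mxE.
Qed.

Let cross i : 'cV['F_2]_d := col i B.
Let face i := cochain (fun f => (f != ev i) && side (ev i) f).

Let F2_addx (x : 'F_2) : x + x = 0.
Proof. by have [->|->] := F2_cases x; apply: val_inj. Qed.

Let crossE i k l : cross i k l = B k i.
Proof. by rewrite mxE. Qed.

Lemma cross_eval y i : (y *m cross i) 0 0 = chain y 0 i.
Proof. by rewrite mxE [RHS]mxE; apply: eq_bigr => k _; rewrite crossE. Qed.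

Lemma cross_eq0 y i : (y *m cross i == 0) = (chain y 0 i == 0).
Proof.
rewrite -cross_eval; apply/eqP/eqP => [->|H]; first by rewrite mxE.
by apply/matrixP=> k l; rewrite !ord1 H mxE.
Qed.

Section Star.
Variables (u : V) (i1 i2 i3 : 'I_m).
Hypotheses (i12 : i1 != i2) (i23 : i2 != i3) (i13 : i1 != i3).
Hypothesis star : forall i, end_of u (ev i) = [|| i == i1, i == i2 | i == i3].

Let star_sum (phi : 'I_m -> 'F_2) :
  \sum_i phi i * (end_of u (ev i))%:R = phi i1 + phi i2 + phi i3.
Proof.
rewrite (bigD1 i1) // (bigD1 i2) 1?eq_sym // (bigD1 i3) /=; last first.
  by rewrite !(eq_sym i3) i13 i23.
rewrite !star !eqxx !orbT !mulr1 big1 ?addr0 ?addrA // => i /andP[/andP[n1 n2] n3].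
by rewrite star (negPf n1) (negPf n2) (negPf n3) mulr0.
Qed.

(** Every cycle has an even number of the three edges at u. *)
Lemma cross_star : u \in S -> cross i1 + cross i2 + cross i3 = 0.
Proof.
move=> uS; apply/matrixP=> k l.
rewrite mxE [X in X + _]mxE !crossE [RHS]mxE.
have /matrixP/(_ 0 (enum_rank_in uS u)) := chain_cycle (delta_mx 0 k).
rewrite mxE (eq_bigr (fun i => B k i * (end_of u (ev i))%:R)) => [|i _].
  by rewrite star_sum => ->; rewrite mxE.
by rewrite /chain -rowE [X in X * _]mxE [X in _ * X]mxE /vx enum_rankK_in.
Qed.

(** The face along an edge at u is described by data at u.  The formula holds on the
cycles that avoid the edge, and such a description determines a functional up
to the one belonging to the edge, by [functional_multiple]. *)
Lemma face_star : let w := cochain (trunk u) + (loc u (ev i1) (ev i2))%:R *: cross i2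
    + (loc u (ev i1) (ev i3))%:R *: cross i3 in
  face i1 = w \/ face i1 = w + cross i1.
Proof.
move=> w; suff [H|H] : face i1 + w = 0 \/ face i1 + w = cross i1.
- by left; rewrite -[RHS]add0r -H -addrA F2_addxx addr0.
- by right; rewrite -H addrCA F2_addxx addr0.
apply: functional_multiple => y /eqP; rewrite cross_eq0 => /eqP y1.
have e1 : ev i1 \notin supp (chain y) by rewrite mem_supp y1 eqxx.
have ue1 : end_of u (ev i1) by rewrite star eqxx.
apply/matrixP=> k l; rewrite !ord1 !mulmxDr -!scalemxAr.
rewrite [LHS]mxE [X in _ + X]mxE [X in _ + (X + _)]mxE !cochain_eval.
rewrite [X in _ + (_ + X + _)]mxE [X in _ + (_ + X)]mxE !cross_eval [RHS]mxE.
rewrite (eq_bigr (side (ev i1))) => [|f fZ]; last first.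
  by rewrite (contraNneq _ e1) // => <-.
rewrite (side_local (supp_even (chain_cycle y)) e1 ue1) F2_addb big_mkcondr /=.
rewrite (supp_parity _ (fun f => if end_of u f then _ else _)).
rewrite (eq_bigr (fun i => (chain y 0 i * (loc u (ev i1) (ev i))%:R) * (end_of u (ev i))%:R)).
  rewrite star_sum y1 mul0r add0r -addrA addrA.
  rewrite [_ + (_ + _)]addrC ![chain _ _ _ * _]mulrC.
  by rewrite [_ + _ + _%:R]addrAC F2_addx add0r F2_addx.
by move=> i _; case: (end_of u (ev i)); rewrite ?mulr1 // !mulr0.
Qed.

End Star.

(** The two faces along edge i are [face i] and [face i + cross i]; they coincide exactly when
the edge is in no cycle, and such an edge is on no border. *)
Definition face_border (f : 'cV['F_2]_d) : {set 'I_m} :=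
  [set i | (cross i != 0) && ((f == face i) || (f == face i + cross i))].

(** After translation by the functional of u, [face_star] identifies the two faces along
each of the three edges with two of 0 and the three [cross], and the symmetry
of the local terms is the consistency condition of [three_sides_even]. *)
Lemma face_border_star u i1 i2 i3 f (i12 : i1 != i2) (i23 : i2 != i3) (i13 : i1 != i3)
    (star : forall i, end_of u (ev i) = [|| i == i1, i == i2 | i == i3]) (uS : u \in S) :
  (i1 \in face_border f) (+) (i2 \in face_border f) (+) (i3 \in face_border f) = false.
Proof.
have star' : forall i, end_of u (ev i) = [|| i == i2, i == i3 | i == i1].
  by move=> i; rewrite star; case: (i == i1); rewrite ?orbT // orbF.
have star'' : forall i, end_of u (ev i) = [|| i == i3, i == i1 | i == i2].
  by move=> i; rewrite star; case: (i == i3); rewrite ?orbT // orbF.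
have i21 : i2 != i1 by rewrite eq_sym.
have i32 : i3 != i2 by rewrite eq_sym.
have i31 : i3 != i1 by rewrite eq_sym.
have c0 := cross_star i12 i23 i13 star uS.
have f1 := face_star i12 i23 i13 star; have f2 := face_star i23 i31 i21 star'.
have f3 := face_star i31 i12 i32 star''.
have uniq_ev i j : i != j -> ev i != ev j by apply: contra_neq => /ev_inj.
have ue1 : end_of u (ev i1) by rewrite star eqxx.
have ue2 : end_of u (ev i2) by rewrite star eqxx orbT.
have ue3 : end_of u (ev i3) by rewrite star eqxx !orbT.
have l12 := loc_sym (uniq_ev _ _ i12) ue1 ue2.
have l23 := loc_sym (uniq_ev _ _ i23) ue2 ue3.
have l13 := loc_sym (uniq_ev _ _ i13) ue1 ue3.
have todd : (loc u (ev i1) (ev i2) (+) loc u (ev i1) (ev i3))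
    (+) (loc u (ev i2) (ev i3) (+) loc u (ev i2) (ev i1))
    (+) (loc u (ev i3) (ev i1) (+) loc u (ev i3) (ev i2)).
  move: l12 l23 l13; move: (up u _) (up u _) (up u _) => a b c.
  by do 6!case: (loc _ _ _); case: a; case: b; case: c.
have := three_sides_even (f + cochain (trunk u)) c0 todd.
rewrite !inE; move: c0 f1 f2 f3 {todd l12 l23 l13}.
move: (cross i1) (cross i2) (cross i3) (face i1) (face i2) (face i3) (cochain _).
move=> c1 c2 c3 a1 a2 a3 R c0 f1 f2 f3.
(* Translation by R brings the faces along one edge into the form of [three_sides_even]. *)
have side_set (a b c c' : 'cV['F_2]_d) (s t : bool) : c + b + c' = 0 ->
    a = R + s%:R *: b + t%:R *: c' \/ a = R + s%:R *: b + t%:R *: c' + c ->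
    ((f == a) || (f == a + c)) =
    (if s (+) t then (f + R == b) || (f + R == c') else (f + R == 0) || (f + R == c)).
  move=> cbc aE; have bE : b = c + c'.
    by apply: (addrI b); rewrite F2_addxx addrA (addrC b) cbc.
  have shift v : (f == R + v) = (f + R == v).
    by rewrite -(inj_eq (addIr R)) [R + v]addrC -addrA F2_addxx addr0.
  have ccb : c' + c = b by rewrite bE addrC.
  have cb : b + c = c' by rewrite bE addrAC F2_addxx add0r.
  have cb' : b + c' = c by rewrite bE -addrA F2_addxx addr0.
  case: aE => ->; case: s; case: t; rewrite /= ?scale1r ?scale0r ?addr0 -?addrA ?shift.
  - by rewrite ccb F2_addxx cb' orbC.
  - by rewrite cb.
  - by rewrite ccb orbC.
  - by rewrite -(inj_eq (addIr R) f R) F2_addxx.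
  - by rewrite F2_addxx addr0 ccb F2_addxx cb'.
  - by rewrite F2_addxx addr0 cb orbC.
  - by rewrite F2_addxx addr0 ccb.
  - by rewrite F2_addxx orbC.
rewrite (side_set _ _ _ _ _ _ c0 f1).
rewrite (side_set _ _ _ _ _ _ _ f2); last by rewrite addrAC [c2 + c1]addrC.
rewrite (side_set _ _ _ _ _ _ _ f3); last by rewrite -addrA addrC.
by rewrite ![(f + R == c3) || (f + R == c1)]orbC.
Qed.

Lemma face_border_even f : even_edge_set (ev @: face_border f).
Proof.
move=> u.
have -> : [set e in ev @: face_border f | end_of u e]
    = ev @: [set i in face_border f | end_of u (ev i)].
  apply/setP=> e; rewrite inE; apply/andP/imsetP => [[/imsetP[i iF ->] ue]|[i]].
    by exists i; rewrite // inE iF.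
  by rewrite inE => /andP[iF ue] ->; rewrite imset_f.
rewrite card_imset //.
have [uS|uS] := boolP (u \in S); last first.
  rewrite (_ : [set _ in _ | _] = set0) ?cards0 //; apply/setP=> i; rewrite in_set0 inE.
  apply: contraNF uS => /andP[_ ui]; exact: F_ends (enum_valP i) ui.
have [e1 [e2 [e3 [e12 e23 e13 E3]]]] := card3P (S_cubic uS).
have inF e : e \in [set e1; e2; e3] -> exists i, e = ev i.
  by rewrite -E3 inE => /andP[eF _]; exists (enum_rank_in eF e); rewrite /ev enum_rankK_in.
have [i1 E1] := inF e1 (ltac:(by rewrite !inE eqxx)).
have [i2 E2] := inF e2 (ltac:(by rewrite !inE eqxx orbT)).
have [i3 E3'] := inF e3 (ltac:(by rewrite !inE eqxx orbT)).
have star i : end_of u (ev i) = [|| i == i1, i == i2 | i == i3].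
  have := enum_valP i; rewrite -[enum_val i]/(ev i) => iF.
  have /setP/(_ (ev i)) := E3; rewrite !inE iF /= => ->.
  by rewrite E1 E2 E3' !(inj_eq ev_inj) orbA.
rewrite E1 E2 E3' !(inj_eq ev_inj) in e12 e23 e13.
rewrite -sum1dep_card big_mkcond /= (bigD1 i1) // (bigD1 i2) 1?eq_sym // (bigD1 i3) /=; last first.
  by rewrite !(eq_sym i3) e13 e23.
rewrite big1 => [|i /andP[/andP[n1 n2] n3]]; last first.
  by rewrite star (negPf n1) (negPf n2) (negPf n3) andbF.
rewrite !star !eqxx !orbT !andbT; have := face_border_star f e12 e23 e13 star uS.
by do 3!case: (_ \in face_border f).
Qed.

Let nonbridge := [set i | cross i != 0].
Let faces := \bigcup_(i in nonbridge) [set face i; face i + cross i].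

Lemma face_border_neq0 f : f \in faces -> face_border f != set0.
Proof.
case/bigcupP=> i; rewrite inE => ci; rewrite !inE => fi.
by apply/set0Pn; exists i; rewrite inE ci.
Qed.

Lemma sum_face_border : (\sum_(f in faces) #|face_border f| <= 2 * m)%N.
Proof.
under eq_bigr => f _ do rewrite -sum1_card.
rewrite (exchange_big_dep (mem nonbridge)) /=; last first.
  by move=> f i _; rewrite !inE => /andP[].
apply: (@leq_trans (\sum_(i in nonbridge) 2)%N); last first.
  by rewrite sum_nat_const mulnC leq_mul2l -[leqRHS]card_ord max_card.
apply: leq_sum => i iN.
rewrite sum1dep_card; apply: (@leq_trans #|[set face i; face i + cross i]|).
  by apply/subset_leq_card/subsetP=> f; rewrite !inE => /and3P[].
by rewrite cards2; case: (_ != _).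
Qed.

Lemma dim_gt0 : (0 < d)%N.
Proof.
have := cycle_dim; have := card_edges; have : (0 < n)%N by rewrite card_gt0.
lia.
Qed.

(** The differences of faces span the space of functionals: the difference of the two
faces along edge i is column i of B, and B has rank d. *)
Lemma card_faces : (d < #|faces|)%N.
Proof.
have freeB : \rank B = d by apply/eqP/row_base_free.
have [f0 f0F] : exists f0, f0 \in faces.
  have [/eqP N0|/set0Pn[i iN]] := boolP (nonbridge == set0); last first.
    by exists (face i); apply/bigcupP; exists i => //; rewrite !inE eqxx.
  have B0 : B = 0.
    apply/matrixP=> k i; rewrite [RHS]mxE -(crossE i k 0).
    have /negbT : i \in nonbridge = false by rewrite N0 inE.
    by rewrite inE negbK => /eqP ->; rewrite mxE.
  by have := freeB; rewrite B0 mxrank0 => d0; exfalso; move: dim_gt0; rewrite -d0.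
pose W : 'M['F_2]_(#|faces :\ f0|, d) := \matrix_k (enum_val k - f0)^T.
have inW f : f \in faces -> ((f - f0)^T <= W)%MS.
  move=> fF; have [->|ff0] := eqVneq f f0; first by rewrite subrr trmx0 sub0mx.
  have fF' : f \in faces :\ f0 by rewrite !inE ff0.
  have -> : (f - f0)^T = row (enum_rank_in fF' f) W by rewrite rowK enum_rankK_in.
  exact: row_sub.
have : (B^T <= W)%MS.
  apply/row_subP=> i; rewrite -tr_col -/(cross i).
  have [->|ci] := eqVneq (cross i) 0; first by rewrite trmx0 sub0mx.
  have iN : i \in nonbridge by rewrite inE.
  have -> : cross i = (face i + cross i - f0) - (face i - f0).
    by rewrite opprB addrA subrK addrAC subrr add0r.
  rewrite linearB; apply: addmx_sub; first by apply: inW; apply/bigcupP; exists i => //; rewrite !inE eqxx orbT.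
  by rewrite eqmx_opp; apply: inW; apply/bigcupP; exists i => //; rewrite !inE eqxx.
move/mxrankS; rewrite mxrank_tr freeB => dW.
rewrite (cardsD1 f0) f0F ltnS; exact: leq_trans dW (rank_leq_row _).
Qed.

(** If all borders had at least six edges, then 6 (d + 1) <= 2 m, against
d >= m - n + 1 and 2 m = 3 n. *)
Theorem short_even_set :
  exists Z : {set E}, [/\ Z != set0, Z \subset F, even_edge_set Z & (#|Z| <= 5)%N].
Proof.
have [/exists_inP[f fF f5]|/exists_inPn big] :=
  boolP [exists f in faces, (#|face_border f| <= 5)%N].
  exists (ev @: face_border f); split; last by rewrite card_imset.
  - have /set0Pn[i iF] := face_border_neq0 fF.
    by apply/set0Pn; exists (ev i); rewrite imset_f.
  - by apply/subsetP=> _ /imsetP[i _ ->]; apply: enum_valP.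
  - exact: face_border_even.
have : (\sum_(f in faces) 6 <= \sum_(f in faces) #|face_border f|)%N.
  by apply: leq_sum => f fF; have := big f fF; rewrite -ltnNge.
rewrite sum_nat_const => /leq_trans/(_ sum_face_border).
have := cycle_dim; have := card_edges; have := card_faces; lia.
Qed.

End ShortEvenSets.

(** * Short cycles and the planar case *)

Section ShortCycles.
Variables (V E : finType) (tail head : E -> V).
Hypothesis tail_head : forall e, tail e != head e.
Hypothesis ends_inj : injective (fun e => [set tail e; head e]).
Variable Z : {set E}.
Hypothesis Z_even : even_edge_set tail head Z.

Definition joined : rel V := fun x y => [exists e in Z, [set tail e; head e] == [set x; y]].

Lemma joined_sym : symmetric joined.
Proof. by move=> x y; rewrite /joined setUC. Qed.

Lemma joined_irr : irreflexive joined.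
Proof.
move=> x; apply/existsP=> -[e /andP[_ /eqP/(congr1 (fun A : {set V} => #|A|))]].
by rewrite setUid cards1 cards2 tail_head.
Qed.

Lemma joined_end x y : joined x y -> exists2 e, e \in Z & end_of tail head x e.
Proof.
case/exists_inP=> e eZ /eqP eE; exists e => //.
have : x \in [set tail e; head e] by rewrite eE set21.
by rewrite !inE.
Qed.

(** An even degree that is not 0 is at least 2, and there are no parallel edges. *)
Lemma second_joined x y : joined x y -> exists2 w, w != y & joined x w.
Proof.
case/exists_inP=> e eZ /eqP eE.
have : x \in [set tail e; head e] by rewrite eE set21.
rewrite !inE => xe; have eA : e \in [set f in Z | end_of tail head x f] by rewrite inE eZ.
have := Z_even x; rewrite (cardsD1 e) eA /= negbK => odd_rest.
have /set0Pn[f] : [set f in Z | end_of tail head x f] :\ e != set0.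
  by apply: contraTneq odd_rest => ->; rewrite cards0.
rewrite !inE => /and3P[fe fZ xf].
have [w fE] : exists w, [set tail f; head f] = [set x; w].
  case/orP: xf => /eqP ->; first by exists (head f).
  by exists (tail f); rewrite setUC.
exists w; last by apply/exists_inP; exists f; rewrite // fE.
by apply: contraNneq fe => wy; apply/eqP/ends_inj; rewrite /= fE eE wy.
Qed.

(** Every covered vertex has degree at least 2 in Z. *)
Lemma card_covered : #|[set u | [exists e in Z, end_of tail head u e]]| <= #|Z|.
Proof.
set W := [set u | _]; rewrite -(leq_pmul2r (isT : 0 < 2)) -!sum_nat_const.
apply: (@leq_trans (\sum_(u in W) \sum_(e in Z | end_of tail head u e) 1)).
  apply: leq_sum => u; rewrite inE => /exists_inP[e eZ ue].
  have := Z_even u; rewrite sum1dep_card.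
  have : 0 < #|[set f in Z | end_of tail head u f]|.
    by rewrite card_gt0; apply/set0Pn; exists e; rewrite inE eZ.
  by case: #|_| => [|[|]].
rewrite (exchange_big_dep (mem Z)) /=; last by move=> u e _ /andP[].
apply: leq_sum => e eZ; rewrite sum1dep_card.
apply: leq_trans (_ : #|[set tail e; head e]| <= 2); last by rewrite cards2; case: (_ != _).
by apply/subset_leq_card/subsetP=> u; rewrite !inE => /andP[_ /andP[]].
Qed.

(** A path is prolonged at its start, by [second_joined], until the new vertex is on
the path already; this closes a cycle, all of whose vertices are covered by
Z. *)
Lemma even_edge_set_cycle : Z != set0 ->
  exists2 s : seq V, uniq s && (2 < size s <= #|Z|) & cycle joined s.
Proof.
move=> /set0Pn[e0 e0Z].
have extend n : (exists2 s : seq V, uniq s && (2 < size s) & cycle joined s) \/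
    exists x y p, [/\ size p = n, uniq [:: x, y & p] & path joined x (y :: p)].
  elim: n => [|n [?|[x [y [p [pn us xp]]]]]]; [|by left|].
    right; exists (tail e0), (head e0), [::]; split; rewrite //= ?inE ?tail_head //.
    by rewrite andbT; apply/exists_inP; exists e0.
  have xy : joined x y by move: xp => /= /andP[].
  have [w wy xw] := second_joined xy.
  have [wp|wp] := boolP (w \in p); last first.
    right; exists w, x, (y :: p); split; first by rewrite /= pn.
      rewrite cons_uniq us andbT !inE !negb_or wy wp !andbT.
      by apply: contraTneq xw => ->; rewrite joined_irr.
    by rewrite /= joined_sym xw.
  left; case/path.splitP: wp us xp => p1 p2 us xp.
  exists (x :: y :: rcons p1 w).
    by move: us; rewrite -!cat_cons cat_uniq => /andP[-> _]; rewrite /= size_rcons.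
  move: xp; rewrite -cat_cons cat_path => /andP[xp _].
  by rewrite (cycle_path x) /= last_rcons joined_sym xw.
case: (extend #|V|) => [[s /andP[us s2] cs]|[x [y [p [pn us _]]]]].
  exists s => //; rewrite us s2 /=; apply: leq_trans card_covered.
  rewrite -(card_uniqP us); apply/subset_leq_card/subsetP=> u us'.
  have [e eZ ue] := joined_end (next_cycle cs us').
  by rewrite inE; apply/exists_inP; exists e.
by have := max_card (mem [:: x, y & p]); rewrite (card_uniqP us) /= pn ltnNge leqnSn.
Qed.

End ShortCycles.

Section PlanarSubcubic.
Variable G : sgraph.
Notation gadj := (@adj G).

Lemma in_edges (A : {set G}) : (A \in edges gadj [set: G]) = (A \in edge_set G).
Proof.
apply/edgesP/idP => [[x [y [_ _ xy ->]]]|].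
  by rewrite inE; apply/existsP; exists x; apply/existsP; exists y; rewrite xy eqxx.
rewrite inE => /existsP[x /existsP[y /andP[xy /eqP ->]]]; exists x, y.
by rewrite !inE.
Qed.

Lemma strong_conflict (e f : edge G) :
    adjacent_edges e f \/ (exists g : edge G, adjacent_edges e g /\ adjacent_edges f g) ->
  conflict gadj (val e) (val f).
Proof.
move=> near; apply/exists_inP.
case: near => [/andP[_ /set0Pn[x /setIP[xe xf]]]|[g [/andP[_ /set0Pn[x /setIP[xe xg]]]]]].
  by exists x => //; apply/exists_inP; exists x; rewrite ?eqxx.
move=> /andP[_ /set0Pn[y /setIP[yf yg]]]; exists x => //; apply/exists_inP; exists y => //.
have [//|xy] := eqVneq x y; apply: (@edge_endpoints G g).
have /[!inE] /existsP[a /existsP[b /andP[ab /eqP gE]]] := valP g.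
move: xg yg xy; rewrite gE => /set2P[] -> /set2P[] ->; rewrite ?eqxx //.
by rewrite setUC.
Qed.

Lemma card_edges_at (S : {set G}) u : u \in S ->
  #|[set e : edge G | (val e \subset S) && (u \in val e)]| = #|nbr gadj S u|.
Proof.
move=> uS; rewrite -(card_imset _ val_inj) -(card_in_imset (f := fun y => [set u; y])); last first.
  move=> y z; rewrite !in_nbr => /andP[_ uy] _ E.
  have : y \in [set u; z] by rewrite -E set22.
  by case/set2P=> // yu; rewrite yu adj_irr in uy.
apply: eq_card => A; apply/imsetP/imsetP => [[e]|[y]].
  rewrite inE => /andP[eS ue] ->.
  have /[!inE] /existsP[a /existsP[b /andP[ab /eqP eE]]] := valP e.
  move: eS ue; rewrite eE subUset !sub1set => /andP[aS bS] /set2P[] ->.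
    by exists b; rewrite // in_nbr bS.
  by exists a; rewrite 1?setUC // in_nbr aS adj_sym.
rewrite in_nbr => /andP[yS uy] ->.
have uyE : [set u; y] \in edge_set G.
  by rewrite inE; apply/existsP; exists u; apply/existsP; exists y; rewrite uy eqxx.
by exists (exist (fun A : {set G} => A \in edge_set G) _ uyE); rewrite // inE /= subUset !sub1set uS yS set21.
Qed.

Lemma planar_short_cycle (R : realType) (S : {set G}) :
  planar R G -> S != set0 -> cubic_on gadj S -> short_cycle gadj S.
Proof.
move=> /planar_parity[tail [head [ends [side [trunk [loc [up [parity symmetry]]]]]]]] S0 cubic.
have tail_head e : tail e != head e := (ends e).2.
have end_in u e : end_of tail head u e = (u \in val e) by rewrite (ends e).1 !inE.
have F_ends e u : e \in [set e : edge G | val e \subset S] -> end_of tail head u e -> u \in S.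
  by rewrite inE end_in => /subsetP eS /eS.
have F_cubic u : u \in S ->
    #|[set e in [set e : edge G | val e \subset S] | end_of tail head u e]| = 3.
  by move=> uS; rewrite -(cubic u uS) -card_edges_at //; apply: eq_card => e; rewrite !inE -!end_in.
have [Z [Z0 /subsetP ZF Zeven Z5]] := short_even_set tail_head parity symmetry S0 F_ends F_cubic.
have ends_inj : injective (fun e => [set tail e; head e]).
  by move=> e f /=; rewrite -!(proj1 (ends _)) => /val_inj.
have [s /andP[us /andP[s2 sZ]] cs] := even_edge_set_cycle tail_head ends_inj Zeven Z0.
have joinedP x y : joined tail head Z x y -> gadj x y.
  by case/exists_inP=> e _ /eqP eE; apply: (@edge_endpoints G e); rewrite (ends e).1.
exists s; first by rewrite us s2 (leq_trans sZ).
rewrite (sub_cycle joinedP cs) /=; apply/allP=> u us'.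
have [e eZ ue] := joined_end (next_cycle cs us').
exact: F_ends (ZF e eZ) ue.
Qed.

Lemma planar_subcubic_colorable (R : realType) (K : finType) (k0 : K) (L : {set G} -> {set K}) :
    planar R G -> max_degree G <= 3 -> (forall A, 10 <= #|L A|) ->
  colorable gadj L [set: G].
Proof.
move=> G_planar G3 L10.
apply: (short_cycles_colorable (@adj_sym G) (@adj_irr G) k0 L10) => [S x _|S]; last first.
  exact: planar_short_cycle G_planar.
apply: leq_trans (leq_trans (leq_bigmax x) G3).
by apply/subset_leq_card/subsetP=> y; rewrite in_nbr inE => /andP[].
Qed.

End PlanarSubcubic.

(** For each e, n colours of its list are chosen.  Since colours of an arbitrary type have no
decidable equality, a colour is represented by one fixed pair of an element and
an index among those with this colour. *)
Lemma finite_palette (E : finType) (C : Type) (n : nat) (L : E -> set C) :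
    (forall e, (`I_n #<= L e)%card) ->
  exists (K : finType) (L' : E -> {set K}) (g : K -> C),
    [/\ forall e, n <= #|L' e|, forall e k, k \in L' e -> L e (g k)
      & forall e f k l, k \in L' e -> l \in L' f -> g k = g l -> k = l].
Proof.
move=> Ln.
have /choice[g gP] e : exists g : 'I_n -> C, injective g /\ forall i, L e (g i).
  have /card_leP[f] := Ln e.
  exists (fun i : 'I_n => sval (f (SigSub (mem_set (ltn_ord i : `I_n i))))); split.
    move=> i j ij; apply: val_inj.
    suff : SigSub (mem_set (ltn_ord i : `I_n i)) =
           SigSub (mem_set (ltn_ord j : `I_n j)) by move/(congr1 val).
    have f_inj : set_inj classical_sets.setT f by exact: inj.
    by apply: f_inj; rewrite ?classical_sets.in_setT //; apply: val_inj.
  by move=> i; case: (f _) => a /= /set_mem.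
pose G (x : E * 'I_n) := g x.1 x.2.
pose rep x := odflt x [pick y | `[< G y = G x >]].
have G_rep x : G (rep x) = G x.
  by rewrite /rep; case: pickP => //= y /asboolP.
have rep_eq x y : G x = G y -> rep x = rep y.
  move=> xy; rewrite /rep; have -> : [pick z | `[< G z = G x >]] = [pick z | `[< G z = G y >]].
    by apply: eq_pick => z; rewrite xy.
  by case: pickP => // /(_ y) /asboolP.
exists (E * 'I_n)%type, (fun e => [set rep (e, i) | i : 'I_n]), G; split.
- move=> e; rewrite card_imset ?card_ord // => i j /(congr1 G); rewrite !G_rep.
  exact: (gP e).1.
- by move=> e _ /imsetP[i _ ->]; rewrite G_rep; apply: (gP e).2.
- by move=> e f _ _ /imsetP[i _ ->] /imsetP[j _ ->]; rewrite !G_rep => /rep_eq.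
Qed.

Theorem theorem1p3 (R : realType) (G : sgraph)
    (G_planar : planar R G) (G_subcubic : (max_degree G <= 3)%N) :
  (strong_list_chromatic_index G <= 10)%N.
Proof.
rewrite /strong_list_chromatic_index; case: ex_minnP => k _; apply.
apply/andP; split=> //; apply/asboolP => C L /finite_palette[K [L' [g [L'10 gL g_inj]]]].
case: (pickP {: edge G}) => [e0 _|no_edge]; last first.
  exists (fun e => False_rect C (notF (esym (no_edge e)))).
  by split=> e; have := no_edge e.
have /card_gt0P[k0 _] : 0 < #|L' e0| by apply: leq_trans (L'10 e0).
pose LL (A : {set G}) := L' (insubd e0 A).
have [c cL cP] := planar_subcubic_colorable k0 (L := LL) G_planar G_subcubic (fun=> L'10 _).
have eE (e : edge G) : val e \in edges (@adj G) [set: G] by rewrite in_edges (valP e).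
have cLe (e : edge G) : c (val e) \in L' e by have := cL _ (eE e); rewrite /LL valKd.
exists (fun e => g (c (val e))); split=> [e f ef /strong_conflict hef|e]; last exact: gL (cLe e).
move=> /(g_inj e f _ _ (cLe e) (cLe f)); exact/eqP/cP.
Qed.
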